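(* Let $p>0$ and let $u:\mathbb{R}^4\to\mathbb{R}$ be a solution to $\Delta^2 u=(1-|x|^p)e^{4u}$ in $\mathbb{R}^4$ such that $(1-|y|^p)e^{4u}\in L^1(\mathbb{R}^4)$, and let $$v(x):=\frac{1}{8\pi^2}\int_{\mathbb{R}^4}\log\left(\frac{|y|}{|x-y|}\right)(1-|y|^p)e^{4u(y)}\,dy.$$ Then $u=v+P$ where $P$ is a polynomial of degree at most $2$. Moreover there is a constant $C$ such that $$\Delta u(x)=-\frac{1}{4\pi^2}\int_{\mathbb{R}^4}\frac{1}{|x-y|^2}(1-|y|^p)e^{4u(y)}\,dy+C\quad\text{for all }x\in\mathbb{R}^4.$$ *)

(* Defs.v *)
From HB Require Import structures.
From mathcomp Require Import all_boot all_order all_algebra.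
From mathcomp Require Import all_classical all_reals all_analysis.
Set Implicit Arguments. Unset Strict Implicit. Unset Printing Implicit Defensive.
Import Order.TTheory GRing.Theory Num.Theory.
Import numFieldNormedType.Exports.
Local Open Scope classical_set_scope.
Local Open Scope ring_scope.

Definition R4 (R : realType) : Type := (((R * R) * R) * R)%type.

Definition coord4 {R : realType} (x : R4 R) (i : 'I_4) : R :=
  match val i with
  | 0%N => x.1.1.1 | 1%N => x.1.1.2 | 2%N => x.1.2 | _ => x.2 end.

Definition e4 {R : realType} (i : 'I_4) : R4 R :=
  (((((val i == 0%N)%:R, (val i == 1%N)%:R), (val i == 2%N)%:R),
     (val i == 3%N)%:R) : R4 R).

Definition enorm4 {R : realType} (x : R4 R) : R :=
  Num.sqrt (\sum_(i < 4) coord4 x i ^+ 2).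

Definition leb4 {R : realType} :=
  (((@lebesgue_measure R \x @lebesgue_measure R) \x @lebesgue_measure R)
      \x @lebesgue_measure R)%E.

Definition iterD {R : realType} (s : seq 'I_4) (f : R4 R -> R) : R4 R -> R :=
  foldr (fun i g => 'D_(e4 i) g) f s.

Definition C4 {R : realType} (f : R4 R -> R) : Prop :=
  forall s : seq 'I_4, (size s <= 4)%N ->
    continuous (iterD s f) /\
    ((size s < 4)%N -> forall (i : 'I_4) (x : R4 R), derivable (iterD s f) x (e4 i)).

Definition Lap {R : realType} (f : R4 R -> R) : R4 R -> R :=
  fun x => \sum_(i < 4) 'D_(e4 i) ('D_(e4 i) f) x.

Definition poly_deg_le2 {R : realType} (P : R4 R -> R) : Prop :=
  exists (c : R) (b : 'I_4 -> R) (A : 'I_4 -> 'I_4 -> R),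
    forall x, P x = c + \sum_(i < 4) b i * coord4 x i
                  + \sum_(i < 4) \sum_(j < 4) A i j * coord4 x i * coord4 x j.

(* Main.v *)
(** Put f = Lap (Lap u) and, for s = |x - y|^2, let S_k[g](t) be the integral of
    g(y) (t - s)_+^k dy. Then S_k' = k S_(k-1), and integrating by parts,
    S_(k+2)[Lap g] = 4 (k+2) ((k+1) t S_k[g] - (k+3) S_(k+1)[g]). Hence suitable
    combinations of the t^(-n) S_k are constant in t; computing their limit at
    t = 0 expresses u(x) and Lap u(x) exactly as weighted averages of u at scale
    r = sqrt t plus truncated logarithmic and Newtonian potentials of f.

    Since |f| dominates u outside a ball, the positive part of u is under
    control, and the same identities bound the mean of |u| over a ball of
    radius r by O(r^2). Then, as r tends to infinity, the average occurring in
    Lap u(x) - Lap u(0) is O(1/r), and the one in u(x) - u(0) is a polynomial of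
    degree 2 in x up to O(1/r). As the polynomials of degree at most 2 without
    constant term are closed under pointwise limits, no growth estimate for the
    potentials and no Liouville theorem is needed. *)

Require Import Defs.
From HB Require Import structures.
From mathcomp Require Import all_boot all_order all_algebra.
From mathcomp Require Import all_classical all_reals all_analysis.
From mathcomp Require Import measurable_realfun ring lra.
Set Implicit Arguments. Unset Strict Implicit. Unset Printing Implicit Defensive.
Import Order.TTheory GRing.Theory Num.Theory.
Import numFieldNormedType.Exports.
Local Open Scope classical_set_scope.
Local Open Scope ring_scope.

(** * Derivatives along a direction and powers of positive parts *)

Section calculus.
Context {R : realType}.
Implicit Types (f g F G : R -> R) (a b t w : R) (k : nat).

(** Cut-offs [(t - s)_+^k] replace spheres and balls: they are [C^(k-1)] on the whole space, so
    Green's identity reduces to Fubini and the fundamental theorem of calculus on lines. The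
    exponents come from the far end. Means of [|u|] at radius r may grow like r^2, so comparing the
    averages centred at [x] and at 0 up to O(1/r) takes a second order expansion of the cut-off with
    cubic error, obtained here from exponent 4 on. Hence the indices 4 and 5 for [u], 6 for [Lap u]
    and 7 for [f]. The factors 1/(4 pi^2) and 1/(8 pi^2) arise from the moments of 1, whose constant
    is identified by letting [(1 - s/n)_+^n] tend to a Gaussian. As [f] is only integrable, its
    logarithmic potential is handled through the difference between the centres [x] and 0; this is
    why the kernel of [v] contains [log |y|]. *)

Lemma is_derive_cvgP {V : normedModType R} (f : V -> R) (x v : V) (d : R) :
  is_derive x v f d <->
  (h^-1 * (f (h *: v + x) - f x) @[h --> 0^'] --> d).
Proof.
split=> [[df <-]|df]; first exact: df.
have H : derivable f x v by apply/cvg_ex; exists d.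
by apply: DeriveDef => //; exact: cvg_lim df.
Qed.

Lemma is_derive_epsP {V : normedModType R} (f : V -> R) (x v : V) (d : R) :
  is_derive x v f d <->
  (forall e, 0 < e -> exists2 r, 0 < r & forall h : R, 0 < `|h| -> `|h| < r ->
     `|f (h *: v + x) - f x - h * d| <= e * `|h|).
Proof.
have E h : h != 0 -> `|d - h^-1 * (f (h *: v + x) - f x)| =
    `|f (h *: v + x) - f x - h * d| / `|h|.
  move=> h0; rewrite -normfV -normrM distrC; congr `|_|.
  by rewrite mulrBl mulrC (mulrC h d) mulfK.
rewrite is_derive_cvgP; split.
  move=> /cvgrPdist_le H e e0; have := H e e0.
  rewrite near_withinE => /nbhs_ballP[r /= r0 {}H].
  exists r => // h h0 hr; have hn0 : h != 0 by rewrite -normr_gt0.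
  have /= := H h; rewrite /ball/= sub0r normrN => /(_ hr hn0).
  by rewrite E// ler_pdivrMr.
move=> H; apply/cvgrPdist_le => e /H[r r0 {}H].
rewrite near_withinE; apply/nbhs_ballP; exists r => //= h.
rewrite /ball/= sub0r normrN => hr hn0.
by rewrite E// ler_pdivrMr ?normr_gt0//; apply: H => //; rewrite normr_gt0.
Qed.

Lemma is_derive_line {V : normedModType R} (f : V -> R) (x v : V) (r d : R) :
  is_derive r 1 (fun t : R => f (t *: v + x)) d <-> is_derive (r *: v + x) v f d.
Proof.
rewrite !is_derive_cvgP.
rewrite (_ : (fun h : R => h^-1 * (f (h *: v + (r *: v + x)) - _)) =
  (fun h : R => h^-1 * (f ((h *: 1 + r : R) *: v + x) - f (r *: v + x))))//.
by apply/funext => h; rewrite [h *: 1]mulr1 scalerDl addrA.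
Qed.

Lemma is_derive_line0 {V : normedModType R} (f : V -> R) (x v : V) (d : R) :
  is_derive (0 : R) 1 (fun t : R => f (t *: v + x)) d <-> is_derive x v f d.
Proof. by rewrite is_derive_line scale0r add0r. Qed.

Lemma is_derive_mul {V : normedModType R} (f g : V -> R) (x v : V) (df dg : R) :
  is_derive x v f df -> is_derive x v g dg ->
  is_derive x v (fun y => f y * g y) (f x * dg + g x * df).
Proof. by move=> hf hg; exact: is_deriveM. Qed.

Lemma is_derive_scal {V : normedModType R} (f : V -> R) (c : R) (x v : V) (df : R) :
  is_derive x v f df -> is_derive x v (fun y => c * f y) (c * df).
Proof. by move=> h; exact: (@is_deriveZ _ _ _ f c _ _ _ h). Qed.

Lemma is_derive_add {V : normedModType R} (f g : V -> R) (x v : V) (df dg : R) :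
  is_derive x v f df -> is_derive x v g dg ->
  is_derive x v (fun y => f y + g y) (df + dg).
Proof. by move=> hf hg; exact: is_deriveD. Qed.

Lemma is_derive_sub {V : normedModType R} (f g : V -> R) (x v : V) (df dg : R) :
  is_derive x v f df -> is_derive x v g dg ->
  is_derive x v (fun y => f y - g y) (df - dg).
Proof. by move=> hf hg; exact: is_deriveB. Qed.

(** [f] is only known along the direction [v], so the one-variable chain rule is applied to its
    restriction to the line through [x]. *)
Lemma is_derive_chain {V : normedModType R} (F : R -> R) (f : V -> R) (x v : V)
    (dF df : R) :
  is_derive (f x) 1 F dF -> is_derive x v f df ->
  is_derive x v (fun y => F (f y)) (dF * df).
Proof.
move=> hF /is_derive_line0 hf; apply/is_derive_line0.
rewrite -[X in f X](_ : 0 *: v + x = x) in hF; last by rewrite scale0r add0r.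
have := @is_derive1_comp _ F (fun t : R => f (t *: v + x)) 0 _ _ hF hf.
by rewrite mulrC.
Qed.

(** [ppow 0] is the constant 1 on the whole line, also for negative [w]; the cut-off starts at
    exponent 1, whence the shifted exponents below. *)
Definition ppow k w : R := Num.max w 0 ^+ k.

Lemma is_derive1_continuous F (G : R -> R) :
  (forall t, is_derive t 1 F (G t)) -> continuous F.
Proof. by move=> dF x; apply/differentiable_continuous/derivable1_diffP. Qed.

(** The mean value theorem in a form that can be iterated: a bound of order [k] on the derivative
    gives one of order [k + 1] on the increment, the factor [1 / (k + 1)] being given up. The Taylor
    estimates for [ppow] follow from it. *)
Lemma derive_increment_bound F (G : R -> R) w0 w C k :
  (forall t, is_derive t 1 F (G t)) ->
  (forall t, Num.min w0 w <= t <= Num.max w0 w -> `|G t| <= C * `|t - w0| ^+ k) ->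
  0 <= C -> `|F w - F w0| <= C * `|w - w0| ^+ k.+1.
Proof.
move=> dF hG C0.
have cF := is_derive1_continuous dF.
case: (ltgtP w0 w) => [lt|lt|->]; last by rewrite !subrr normr0 expr0n mulr0.
- have [|c /andP[/= c1 c2] ->] := @MVT R F G w0 w lt (fun x _ => dF x).
    exact: continuous_subspaceT.
  rewrite !bnd_simp in c1 c2.
  rewrite normrM exprSr mulrA ler_wpM2r//.
  apply: le_trans (hG c _) _; first by rewrite ge_min le_max !(ltW c1) !(ltW c2) orbT.
  rewrite ler_wpM2l// lerXn2r ?nnegrE//.
  by rewrite !ger0_norm ?subr_ge0 ?(ltW c1) ?(ltW lt)// lerD2r ltW.
- have [|c /andP[/= c1 c2] e] := @MVT R F G w w0 lt (fun x _ => dF x).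
    exact: continuous_subspaceT.
  rewrite !bnd_simp in c1 c2.
  rewrite distrC e.
  rewrite normrM exprSr mulrA [`|w - w0|]distrC ler_wpM2r//.
  apply: le_trans (hG c _) _; first by rewrite ge_min le_max !(ltW c1) !(ltW c2) orbT.
  rewrite ler_wpM2l// lerXn2r ?nnegrE//.
  have -> : `|c - w0| = w0 - c by rewrite ler0_norm ?opprB// subr_le0 ltW.
  by rewrite ger0_norm ?subr_ge0 ?(ltW lt)//; lra.
Qed.

Lemma le_of_derive_ge0 (F G : R -> R) c a b :
  (forall t, c < t -> is_derive t 1 F (G t)) -> (forall t, c < t -> 0 <= G t) ->
  c < a -> a <= b -> F a <= F b.
Proof.
move=> dF G0 ca; rewrite le_eqVlt => /predU1P[->//|ab].
have [||r /andP[/= ar _]] := @MVT R F G a b ab.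
- by move=> x /andP[/= ax _]; apply: dF; rewrite bnd_simp in ax; exact: lt_trans ax.
- apply: derivable_within_continuous => x /andP[/= ax _].
  by rewrite bnd_simp in ax; have [] := dF x (lt_le_trans ca ax).
rewrite bnd_simp in ar.
by rewrite -subr_ge0 => ->; rewrite mulr_ge0 ?subr_ge0 ?(ltW ab)// G0// (lt_trans ca).
Qed.

Lemma constant_of_derive0_pos F a b :
  (forall t, 0 < t -> is_derive t 1 F 0) -> 0 < a -> 0 < b -> F a = F b.
Proof.
move=> dF; wlog ab : a b / a <= b.
  move=> H a0 b0; have [ab|/ltW ba] := leP a b; first exact: H.
  by apply/esym; exact: H.
move=> a0 b0; apply/eqP; rewrite eq_le (le_of_derive_ge0 dF)//=.
have dF' t : 0 < t -> is_derive t 1 (- F) 0.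
  by move=> t0; rewrite -oppr0; exact: is_deriveN (dF t t0).
by rewrite -lerN2; exact: (le_of_derive_ge0 dF').
Qed.

Lemma constant_of_derive0 F (l : R) :
  (forall t, 0 < t -> is_derive t 1 F 0) -> F n.+1%:R^-1 @[n --> \oo] --> l ->
  forall t, 0 < t -> F t = l.
Proof.
move=> dF Fl t t0; suff h : F n.+1%:R^-1 @[n --> \oo] --> F t.
  exact: (cvg_unique _ h Fl).
by apply: cvg_near_cst; apply: nearW => n; exact: constant_of_derive0_pos.
Qed.

(** At 0 both one-sided difference quotients tend to 0 because [G 0 = G' 0 = 0]. The bound [M]
    leaves room for a [G] that is singular at a finite point, as [ln (1 - w)] is at 1. *)
Lemma is_derive_glue G (G' : R -> R) M w : 0 < M ->
  (forall t, t < M -> is_derive t 1 G (G' t)) -> G 0 = 0 -> G' 0 = 0 -> w < M ->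
  is_derive w 1 (fun t => G (Num.max t 0)) (G' (Num.max w 0)).
Proof.
move=> M0 dG G0 G'0 wM.
have [w0|w0|->] := ltgtP w 0.
- rewrite G'0.
  have H : (\near w, (fun=> 0) w = (fun t => G (Num.max t 0)) w).
    near=> z; rewrite max_r ?G0//.
    by apply: ltW; near: z; exact: lt_nbhsl.
  exact: (near_eq_is_derive H).
- have H : (\near w, G w = (fun t => G (Num.max t 0)) w).
    near=> z; rewrite max_l//.
    by apply: ltW; near: z; exact: lt_nbhsr.
  by apply: (near_eq_is_derive H); exact: dG.
- rewrite G'0; apply/is_derive_epsP => e e0.
  have /is_derive_epsP/(_ e e0)[r r0 H] := dG 0 M0.
  exists r => // h h0 hr; rewrite maxxx G0 !mulr0 !subr0.
  have := H h h0 hr; rewrite G0 G'0 mulr0 !subr0 /GRing.scale/= mulr1 addr0.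
  case: (leP h 0) => [_|//]; rewrite G0 normr0 => _.
  by rewrite mulr_ge0// ltW.
Unshelve. all: end_near. Qed.

Lemma ppow_ge0 k w : 0 <= ppow k w.
Proof. by rewrite exprn_ge0// le_max lexx orbT. Qed.

Lemma ppow_le0 k w : w <= 0 -> ppow k.+1 w = 0.
Proof. by move=> w0; rewrite /ppow max_r// expr0n. Qed.

Lemma ppow_ge k w : 0 <= w -> ppow k w = w ^+ k.
Proof. by move=> w0; rewrite /ppow max_l. Qed.

Lemma ppowS k w : ppow k.+2 w = w * ppow k.+1 w.
Proof.
case: (leP w 0) => w0; first by rewrite !ppow_le0// mulr0.
by rewrite !ppow_ge ?(ltW w0)// exprS.
Qed.

Lemma ppow_le k w t : w <= t -> ppow k w <= ppow k t.
Proof.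
move=> wt; apply: lerXn2r.
- by rewrite nnegrE le_max lexx orbT.
- by rewrite nnegrE le_max lexx orbT.
- by rewrite ge_max !le_max wt lexx orbT.
Qed.

Lemma ppow_le1 k w : w <= 1 -> ppow k w <= 1.
Proof. by move=> /(ppow_le k)/le_trans; apply; rewrite ppow_ge// expr1n. Qed.

Lemma ppowM k c w : 0 <= c -> ppow k (c * w) = c ^+ k * ppow k w.
Proof. by move=> c0; rewrite /ppow -exprMn maxr_pMr// mulr0. Qed.

(** From exponent 2 on, since [ppow 1] has a corner at 0. *)
Lemma is_derive_ppow k w : is_derive w 1 (ppow k.+2) (k.+2%:R * ppow k.+1 w).
Proof.
apply: (@is_derive_glue (fun t => t ^+ k.+2) (fun t => k.+2%:R * t ^+ k.+1) (`|w| + 1)).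
- by rewrite ltr_pwDr.
- move=> t _; apply: DeriveDef; first exact: exprn_derivable.
  by rewrite exp_derive /GRing.scale/= mulr1.
- by rewrite expr0n.
- by rewrite expr0n mulr0.
- have := ler_norm w; lra.
Qed.

Lemma continuous_ppow k : continuous (ppow k).
Proof.
move=> x; apply: (@continuous_comp _ _ _ (fun w => Num.max w 0) (fun w => w ^+ k)).
  by apply: continuous_max => //; exact: cvg_cst.
exact: exprn_continuous.
Qed.
End calculus.

(** * Truncated moments over a measure space *)

Section truncated_moments.
Context d (T : measurableType d) (R : realType) (mu : {measure set T -> \bar R}).
Implicit Types (f g : T -> R) (k : nat) (t : R).

Local Notation I := (Rintegral mu setT).
Local Notation intg g := (mu.-integrable setT (EFin \o g)).

Lemma integrable_measurable_fun g : intg g -> measurable_fun setT g.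
Proof. by move=> /integrableP[/measurable_EFinP]. Qed.

Lemma integrable_dom f g : measurable_fun setT f -> intg g ->
  (forall y, `|f y| <= g y) -> intg f.
Proof.
move=> mf ig fg; apply: le_integrable ig => //; first exact/measurable_EFinP.
by move=> y _ /=; rewrite lee_fin (le_trans (fg y))// ler_norm.
Qed.

Lemma integrable_addr f g : intg f -> intg g -> intg (fun y => f y + g y).
Proof.
move=> If Ig; rewrite (_ : _ \o _ = (EFin \o f) \+ (EFin \o g))%E//.
exact: integrableD.
Qed.

Lemma integrable_subr f g : intg f -> intg g -> intg (fun y => f y - g y).
Proof.
move=> If Ig; rewrite (_ : _ \o _ = (EFin \o f) \- (EFin \o g))%E//.
exact: integrableB.
Qed.

Lemma integrable_scale c f : intg f -> intg (fun y => c * f y).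
Proof.
move=> If; rewrite (_ : _ \o _ = (fun y => c%:E * (EFin \o f) y)%E)//.
exact: integrableZl.
Qed.

Lemma integrable_normr f : intg f -> intg (fun y => `|f y|).
Proof. by move=> If; exact: integrable_norm. Qed.

Lemma norm_Rintegral_le f g : intg f -> intg g -> (forall y, `|f y| <= g y) ->
  `|I f| <= I g.
Proof.
move=> If Ig fg; apply: le_trans (le_normr_Rintegral _ If) _ => //.
by apply: le_Rintegral => //; exact: integrable_normr.
Qed.

Lemma Rintegral_dct (F : nat -> T -> R) f g :
  (forall n, measurable_fun setT (F n)) -> measurable_fun setT f -> intg g ->
  {ae mu, forall y, F n y @[n --> \oo] --> f y} ->
  (forall n y, `|F n y| <= g y) ->
  intg f /\ I (F n) @[n --> \oo] --> I f.
Proof.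
move=> mF mf Ig Ff Fg.
have [|||| |If _ H] := @dominated_convergence _ _ _ mu setT measurableT
   (fun n => EFin \o F n) (EFin \o f) (EFin \o g).
- by move=> n; apply/measurable_EFinP/mF.
- exact/measurable_EFinP.
- apply: filterS Ff => y h _; apply: cvg_EFin => //; exact: nearW.
- by [].
- by apply: aeW => y n _ /=; rewrite lee_fin.
split=> //; apply: fine_cvg; rewrite fineK//.
exact: integrable_fin_num.
Qed.

Lemma Rintegral_dctW (F : nat -> T -> R) f g :
  (forall n, measurable_fun setT (F n)) -> intg g ->
  (forall y, F n y @[n --> \oo] --> f y) ->
  (forall n y, `|F n y| <= g y) ->
  intg f /\ I (F n) @[n --> \oo] --> I f.
Proof.
move=> mF Ig Ff Fg; apply: Rintegral_dct Ig _ Fg => //; last exact: aeW.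
by apply: measurable_fun_cvg => // y _; exact: Ff.
Qed.

Lemma integrable_nondecreasing_cvg (F : nat -> T -> R) f C :
  (forall n, intg (F n)) -> (forall n y, 0 <= F n y) ->
  (forall y m n, (m <= n)%N -> F m y <= F n y) ->
  (forall y, F n y @[n --> \oo] --> f y) ->
  (forall n, I (F n) <= C) -> intg f.
Proof.
move=> IF F0 ndF Ff FC.
have mF n := integrable_measurable_fun (IF n).
have f0 y : 0 <= f y.
  rewrite -(cvg_lim _ (Ff y))//; apply: limr_ge; last exact: nearW.
  exact: cvgP (Ff y).
apply/integrableP; split.
  by apply/measurable_EFinP; apply: measurable_fun_cvg mF _ => y _; exact: Ff.
apply: (@le_lt_trans _ _ C%:E); last exact: ltry.
have := @cvg_monotone_convergence _ _ _ mu setT measurableT (fun n => EFin \o F n)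
  (fun n => (measurable_EFinP _ _).2 (mF n)) (fun n y _ => F0 n y) _.
rewrite (_ : (\int[mu]_(x in setT) limn ((fun n => EFin \o F n) ^~ x) = \int[mu]_x `|(EFin \o f) x|)%E); last first.
  apply: eq_integral => y _; rewrite /= ger0_norm//.
  apply/cvg_lim => //.
  by apply: (@cvg_EFin _ _ _ _ (fun n => (F n y)%:E) (f y)) (Ff y); exact: nearW.
move=> h; apply: (cvge_le _ (h _)).
  apply: nearW => n; rewrite -(fineK (integrable_fin_num measurableT (IF n))) lee_fin.
  exact: FC.
by move=> y _ m n mn; rewrite lee_fin; exact: ndF.
Qed.

Lemma integrable_sum_ord n (F : 'I_n -> T -> R) : (forall i, intg (F i)) ->
  intg (fun y => \sum_(i < n) F i y).
Proof.
elim: n F => [|n IH] F IF.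
  rewrite (_ : _ \o _ = cst 0%E); first exact: integrable0.
  by apply/funext => y /=; rewrite big_ord0.
rewrite (_ : _ \o _ = (EFin \o (fun y => \sum_(i < n) F (widen_ord (leqnSn n) i) y + F ord_max y))).
  by apply: integrable_addr => //; exact: IH.
by apply/funext => y /=; rewrite big_ord_recr.
Qed.

Lemma Rintegral_sum_ord n (F : 'I_n -> T -> R) : (forall i, intg (F i)) ->
  I (fun y => \sum_(i < n) F i y) = \sum_(i < n) I (F i).
Proof.
elim: n F => [|n IH] F IF.
  rewrite big_ord0 -[RHS](mul0r (fine (mu setT))) -Rintegral_cst//.
  by apply: eq_Rintegral => y _; rewrite big_ord0.
rewrite big_ord_recr/= -IH// -RintegralD//; last exact: integrable_sum_ord.
by apply: eq_Rintegral => y _; rewrite big_ord_recr.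
Qed.

Variable s : T -> R.
Hypothesis ms : measurable_fun setT s.
Hypothesis s0 : forall y, 0 <= s y.

(** [S_k[g](t)] of the overview for an abstract nonnegative [s]; later [s] is the squared distance
    to the centre. *)
Definition tmoment g k t : R := I (fun y => g y * ppow k (t - s y)).

(** Integrability on every sublevel set of [s]. It is phrased with the weight [(t - s)_+], at least
    1 where [s <= t - 1], so that all integrals extend over the whole space. *)
Definition loc_integrable g := measurable_fun setT g /\
  forall t, intg (fun y => g y * ppow 1 (t - s y)).

Lemma measurable_ppow_sub k t : measurable_fun setT (fun y => ppow k (t - s y)).
Proof.
apply: (measurableT_comp (f := ppow k)).
  by apply: continuous_measurable_fun; exact: continuous_ppow.
exact: measurable_funB.
Qed.

Lemma ppow_sub_le k t y : 0 <= t -> ppow k (t - s y) <= t ^+ k.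
Proof.
by move=> t0; rewrite -(ppow_ge k t0) ppow_le// gerBl.
Qed.

Lemma loc_integrable_ppow g k t : loc_integrable g ->
  intg (fun y => g y * ppow k.+1 (t - s y)).
Proof.
move=> [mg Ig].
have m := fun k => measurable_funM mg (measurable_ppow_sub k t).
apply: (@integrable_dom _ (fun y => Num.max t 0 ^+ k * `|g y * ppow 1 (t - s y)|)); first exact: m.
  by apply: integrable_scale; exact: integrable_normr.
move=> y; rewrite !normrM mulrCA ler_wpM2l// !ger0_norm ?ppow_ge0//.
rewrite [leLHS]/ppow exprSr ler_wpM2r ?ppow_ge0 ?le_max ?lexx ?orbT//.
by apply: ppow_le; rewrite gerBl.
Qed.

Lemma integrable_loc g : intg g -> loc_integrable g.
Proof.
move=> Ig; have mg := integrable_measurable_fun Ig; split=> // t.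
apply: (@integrable_dom _ (fun y => Num.max t 0 * `|g y|)) => //.
- by apply: measurable_funM => //; exact: measurable_ppow_sub.
- by apply: integrable_scale; exact: integrable_normr.
- move=> y; rewrite normrM mulrC ler_wpM2r// ger0_norm ?ppow_ge0// /ppow expr1.
  by rewrite ge_max !le_max lexx orbT andbT gerBl// s0.
Qed.

Lemma is_derive_tmoment g k t : loc_integrable g ->
  is_derive t 1 (tmoment g k.+2) (k.+2%:R * tmoment g k.+1 t).
Proof.
move=> Lg; have [mg _] := Lg.
pose F t y := g y * ppow k.+2 (t - s y).
have dF (r : R) y : is_derive r 1 (F ^~ y) (k.+2%:R * (g y * ppow k.+1 (r - s y))).
  rewrite mulrCA.
  have h : is_derive r 1 (fun r => ppow k.+2 (r - s y)) (k.+2%:R * ppow k.+1 (r - s y)).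
    have /= := @is_derive1_comp _ (ppow k.+2) (fun r => r - s y) r _ _ (is_derive_ppow k _)
      (is_deriveB (is_derive_id _ _) (is_derive_cst _ _ _)).
    by rewrite subr0 mulr1.
  exact: (@is_deriveZ _ _ _ _ (g y) _ _ _ h).
have d1F r y : partial1of2 F r y = k.+2%:R * (g y * ppow k.+1 (r - s y)).
  by rewrite partial1of2E; exact: derive_val.
have ht : `]t - 1, t + 1[%classic t by rewrite /= in_itv/=; lra.
have IF r : intg (F r) by exact: loc_integrable_ppow.
(* [ppow] is nondecreasing, so on the window around [t] the derivative is dominated by its value at
   the right end [t + 1]. *)
pose G y := k.+2%:R * `|g y * ppow k.+1 (t + 1 - s y)|.
have G0 y : 0 <= G y by rewrite mulr_ge0.
have IG : intg G.
  by rewrite /G; apply: integrable_scale; apply: integrable_normr; exact: loc_integrable_ppow.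
have GF r y : `]t - 1, t + 1[%classic r -> setT y -> `|partial1of2 F r y| <= G y.
  rewrite /= in_itv/= => /andP[_ r1] _; rewrite d1F normrM ger0_norm//.
  rewrite ler_wpM2l// !normrM ler_wpM2l// !ger0_norm ?ppow_ge0//.
  by rewrite ppow_le// lerD2r ltW.
have h := cvg_differentiation_under_integral measurableT ht (fun r _ => IF r)
  (fun r y _ _ => @ex_derive _ _ _ _ _ _ _ (dF r y)) G0 IG GF.
apply/is_derive_cvgP; rewrite -RintegralZl//; last exact: loc_integrable_ppow.
rewrite -(@eq_Rintegral _ _ _ mu setT _ _ (fun y _ => d1F t y)).
by under eq_fun do rewrite scaler1.
Qed.
Lemma tmoment_lin a b f g k t : loc_integrable f -> loc_integrable g ->
  tmoment (fun y => a * f y + b * g y) k.+1 t =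
  a * tmoment f k.+1 t + b * tmoment g k.+1 t.
Proof.
move=> Lf Lg; have If := loc_integrable_ppow k t Lf; have Ig := loc_integrable_ppow k t Lg.
rewrite /tmoment -!RintegralZl// -RintegralD//; [|exact: integrable_scale..].
by apply: eq_Rintegral => y _; ring.
Qed.

(** [s = t - (t - s)]: a factor [s] is traded for one more power of the cut-off. *)
Lemma tmoment_mul g k t : loc_integrable g ->
  tmoment (fun y => g y * s y) k.+1 t = t * tmoment g k.+1 t - tmoment g k.+2 t.
Proof.
move=> Lg; have I1 := loc_integrable_ppow k t Lg; have I2 := loc_integrable_ppow k.+1 t Lg.
rewrite /tmoment -RintegralZl// -RintegralB//; last exact: integrable_scale.
by apply: eq_Rintegral => y _; rewrite [in RHS]ppowS; ring.
Qed.

Lemma le_tmoment f g k t : loc_integrable f -> loc_integrable g ->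
  (forall y, s y <= t -> f y <= g y) -> tmoment f k.+1 t <= tmoment g k.+1 t.
Proof.
move=> Lf Lg fg; apply: le_Rintegral => //; [exact: loc_integrable_ppow..|].
move=> y _; have [st|ts] := leP (s y) t.
  by rewrite ler_wpM2r ?ppow_ge0// fg.
by rewrite !ppow_le0 ?mulr0// subr_le0 ltW.
Qed.

Lemma tmoment_le0 g k t : t <= 0 -> tmoment g k.+1 t = 0.
Proof.
move=> t0; rewrite /tmoment (_ : (fun _ => _) = cst 0).
  by rewrite Rintegral_cst// mul0r.
by apply/funext => y; rewrite ppow_le0 ?mulr0// subr_le0 (le_trans t0).
Qed.

Lemma norm_tmoment_le f k t : intg f -> 0 <= t ->
  `|tmoment f k.+1 t| <= t ^+ k.+1 * I (fun y => `|f y|).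
Proof.
move=> If t0; rewrite -RintegralZl//; last exact: integrable_normr.
apply: norm_Rintegral_le.
- exact/loc_integrable_ppow/integrable_loc.
- by apply: integrable_scale; exact: integrable_normr.
- move=> y; rewrite normrM mulrC ler_wpM2r// ger0_norm ?ppow_ge0//.
  exact: ppow_sub_le.
Qed.

Lemma loc_integrable_normr g : loc_integrable g -> loc_integrable (fun y => `|g y|).
Proof.
move=> [mg Ig]; split; first exact: measurableT_comp.
move=> t; have := integrable_normr (Ig t).
by under eq_fun do rewrite normrM [X in _ * X]ger0_norm ?ppow_ge0//.
Qed.

End truncated_moments.

(** * Integration on R^4 *)

Section product_measurability.
Context {R : realType}.

(* [j] identifies the measurable space [M] with the topological space [X]. *)
Lemma measurable_preimage_open_prod d (M : measurableType d) (X : topologicalType)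
    (j : M -> X) :
  (forall U, open U -> measurable (j @^-1` U)) ->
  forall U : set (X * R), open U ->
    measurable ((fun z : M * measurableTypeR R => (j z.1, z.2 : R)) @^-1` U).
Proof.
move=> jopen U oU.
(* An open set of the product is the countable union, over rational intervals, of the open
   rectangles that it contains; the interior makes the first side open, whatever the topology of
   [X]. *)
pose V (q : rat * rat) : set X :=
  [set x | forall r : R, ratr q.1 < r -> r < ratr q.2 -> U (x, r)]^°.
pose W (q : rat * rat) : set (M * measurableTypeR R) :=
  (j @^-1` V q) `*` `]ratr q.1, ratr q.2[%classic.
have -> : (fun z : M * measurableTypeR R => (j z.1, z.2 : R)) @^-1` U = \bigcup_q W q.
  rewrite eqEsubset; split => [[x r] /= Uxr|[x r] [q _ [/= Vx]]]; last first.
    by rewrite /= in_itv/= => /andP[r1 r2]; exact: (interior_subset Vx).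
  have := oU; rewrite openE => /(_ _ Uxr)[[A B] /= [nA nB] AB].
  have [e /= e0 eB] : nbhs r B by [].
  have [q1] := rat_in_itvoo (x := r - e) (y := r) ltac:(by rewrite ltrBlDr ltrDl).
  have [q2] := rat_in_itvoo (x := r) (y := r + e) ltac:(by rewrite ltrDl).
  rewrite !in_itv/= => /andP[r2 r2e] /andP[r1e r1].
  exists (q1, q2) => //; split => /=; last by rewrite in_itv/= r1 r2.
  rewrite /V/= /interior; apply: filterS nA => z Az s sq1 sq2.
  apply: AB => /=; split => //; apply: eB; rewrite /ball_/=.
  by rewrite ltr_norml; apply/andP; split; lra.
apply: countable_bigcupT_measurable => // q; apply: measurableX => //.
by apply: jopen; exact: open_interior.
Qed.

(** Continuity refers to the product topology of [R4], measurability to the iterated product of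
    Borel sigma-algebras; one application of the rectangle argument per product identifies open sets
    as measurable. *)
Lemma continuous_measurable_R4 (g : R4 R -> R) : continuous g ->
  measurable_fun setT (g : measurableTypeR R * measurableTypeR R * measurableTypeR R
     * measurableTypeR R -> R).
Proof.
move=> cg.
have H1 (U : set R) : open U -> measurable ((fun z : measurableTypeR R => z : R) @^-1` U).
  by move=> oU; exact: open_measurable.
have H2 := measurable_preimage_open_prod H1.
have H3 := measurable_preimage_open_prod H2.
have H4 := measurable_preimage_open_prod H3.
apply: (measurability _ (RGenOpens.measurableE R)).
move=> _ [_ [a [b ->] <-]]; rewrite setTI.
have oA : open (g @^-1` `]a, b[) by move/continuousP : cg; apply; exact: interval_open.
have := H4 _ oA.
rewrite (_ : _ @^-1` (g @^-1` _) = g @^-1` `]a, b[)//.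
by apply/seteqP; split => -[[[? ?] ?] ?].
Qed.
End product_measurability.

Section null_slices.
Local Open Scope ereal_scope.
Context d1 d2 (X : measurableType d1) (Y : measurableType d2) (R : realType).
Variables (m1 : {sigma_finite_measure set X -> \bar R})
  (m2 : {sigma_finite_measure set Y -> \bar R}).

(** The hypothesis on slices may assume integrability, which holds for almost every slice; this is
    what allows the lemma to be applied again inside a slice. *)
Lemma integral_prod_null_snd (f : X * Y -> \bar R) :
  (m1 \x m2).-integrable setT f ->
  (forall x, m2.-integrable setT (fun y => f (x, y)) -> \int[m2]_y f (x, y) = 0) ->
  \int[m1 \x m2]_z f z = 0.
Proof.
move=> If f0; rewrite -(integral12_prod_meas1 If).
transitivity (\int[m1]_x (cst 0 x : \bar R)); last by rewrite integral0.
apply: ae_eq_integral => //; first exact: (measurable_fubini_F If).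
by have := ae_integrable1 If; apply: filterS => x /f0.
Qed.

Lemma integral_prod_null_fst (f : X * Y -> \bar R) :
  (m1 \x m2).-integrable setT f ->
  (forall y, m1.-integrable setT (fun x => f (x, y)) -> \int[m1]_x f (x, y) = 0) ->
  \int[m1 \x m2]_z f z = 0.
Proof.
move=> If f0; rewrite -(integral21_prod_meas1 If).
transitivity (\int[m2]_x (cst 0 x : \bar R)); last by rewrite integral0.
apply: ae_eq_integral => //; first exact: (measurable_fubini_G If).
by have := ae_integrable2 If; apply: filterS => x /f0.
Qed.
End null_slices.

Section sigma_finite_product.
Local Open Scope ereal_scope.
Context d1 d2 (X : measurableType d1) (Y : measurableType d2) (R : realType).

Lemma product_measure1_lty (m1 : {measure set X -> \bar R})
    (m2 : {sigma_finite_measure set Y -> \bar R}) (A1 : set X) (A2 : set Y) :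
  measurable A1 -> measurable A2 -> m1 A1 < +oo -> m2 A2 < +oo ->
  (m1 \x m2) (A1 `*` A2) < +oo.
Proof.
move=> mA1 mA2 A1y A2y; rewrite [X in X < _]product_measure1E//.
by rewrite lte_mul_pinfty// ge0_fin_numE.
Qed.

Variables (m1 : {sigma_finite_measure set X -> \bar R})
  (m2 : {sigma_finite_measure set Y -> \bar R}).

Lemma sigma_finite_product_measure1 : sigma_finite setT (m1 \x m2).
Proof.
have /sigma_finiteP[F [FT Fnd Fy]] := sigma_finiteT m1.
have /sigma_finiteP[G [GT Gnd Gy]] := sigma_finiteT m2.
exists (fun n => F n `*` G n) => [|n]; last first.
  have [[mF Fny] [mG Gny]] := (Fy n, Gy n).
  by split; [exact: measurableX|exact: product_measure1_lty].
apply/esym/seteqP; split => // -[x y] _.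
have [n _ Fx] : (\bigcup_n F n) x by rewrite -FT.
have [k _ Gy'] : (\bigcup_n G n) y by rewrite -GT.
exists (n + k)%N => //; split => /=.
  exact: (subsetPset _ _ (Fnd n _ (leq_addr _ _))).
exact: (subsetPset _ _ (Gnd k _ (leq_addl _ _))).
Qed.

(* The library only provides the sigma-finite structure of [m1 \x m2] for
   subprobability measures. *)
Definition sigma_finite_product := (m1 \x m2).
HB.instance Definition _ := Measure.on sigma_finite_product.
HB.instance Definition _ := @Measure_isSigmaFinite.Build _ _ _ sigma_finite_product
  sigma_finite_product_measure1.
End sigma_finite_product.

(** These unfold to the partial products inside [leb4], so that Fubini can peel off its factors one
    at a time. *)
Notation leb2 R := (sigma_finite_product (@lebesgue_measure R) (@lebesgue_measure R)).
Notation leb3 R := (sigma_finite_product (leb2 R) (@lebesgue_measure R)).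

Section R4_integration.
Context {R : realType}.
Implicit Types (x y : R4 R) (g h : R4 R -> R).

Lemma integral_derive_compact (h h' : R -> R) (A : R) :
  (forall r : R, is_derive r 1 h (h' r)) -> continuous h' ->
  (forall r, A < `|r| -> h r = 0) ->
  (\int[@lebesgue_measure R]_r (h' r)%:E = 0)%E.
Proof.
move=> dh ch' h0.
pose B := `|A| + 1.
have AB : A < B by rewrite /B; have := ler_norm A; lra.
have B0 : - B < B by rewrite /B; have := normr_ge0 A; lra.
have h'0 r : A < `|r| -> h' r = 0.
  move=> Ar; have := dh r => /[dup] -[_ <-] _.
  have -> : 'D_1 h r = 'D_1 (fun=> 0) r.
    apply: near_eq_derive; near=> z; apply: h0; near: z.
    have /(_ r) := @norm_continuous _ R^o.
    by move/cvgrPdist_lt => /(_ (`|r| - A)); rewrite subr_gt0 => /(_ Ar);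
      apply: filterS => z; rewrite ltr_distlC opprB addrCA subrr addr0 => /andP[].
  exact: derive_cst.
have -> : (\int[@lebesgue_measure R]_r (h' r)%:E =
  \int[@lebesgue_measure R]_(r in `[(- B)%R, B]) (h' r)%:E)%E.
  rewrite [RHS]integral_mkcond; apply: eq_integral => r _.
  rewrite /patch; case: ifPn => //; rewrite notin_setE/= in_itv/= => rB.
  rewrite h'0//; apply: (lt_le_trans AB).
  by rewrite leNgt ltr_norml; apply/negP => /andP[? ?]; apply: rB; apply/andP; split; exact: ltW.
rewrite (@continuous_FTC2 _ h' h (- B) B B0).
- rewrite !h0 ?subee// ?normrN ger0_norm//; rewrite /B; have := normr_ge0 A; lra.
- exact: continuous_subspaceT.
- have ch := is_derive1_continuous dh; split.
  + by move=> z _; have [] := dh z.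
  + by apply: cvg_at_right_filter; exact: ch.
  + by apply: cvg_at_left_filter; exact: ch.
- by move=> z _; rewrite derive1E; exact: derive_val.
Unshelve. all: end_near. Qed.

Lemma continuous_coord4 (i : 'I_4) : continuous (fun y : R4 R => coord4 y i).
Proof.
case: i => [[|[|[|[|//]]]] Hi] y; rewrite /coord4/=.
- apply: (@continuous_comp _ _ _ (fun y : R4 R => y.1.1) fst); last exact: cvg_fst.
  apply: (@continuous_comp _ _ _ (fun y : R4 R => y.1) fst); exact: cvg_fst.
- apply: (@continuous_comp _ _ _ (fun y : R4 R => y.1.1) snd); last exact: cvg_snd.
  apply: (@continuous_comp _ _ _ (fun y : R4 R => y.1) fst); exact: cvg_fst.
- apply: (@continuous_comp _ _ _ (fun y : R4 R => y.1) snd); last exact: cvg_snd.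
  exact: cvg_fst.
- exact: cvg_snd.
Qed.

Lemma sum_coord4 (F : 'I_4 -> R) :
  \sum_(i < 4) F i = F (inord 0) + F (inord 1) + F (inord 2) + F (inord 3).
Proof.
rewrite !big_ord_recl big_ord0 addr0 !addrA.
by congr (_ + _ + _ + _); congr F; apply: val_inj; rewrite /= inordK.
Qed.

(** Balls of the maximum norm are products of segments, so compactness and finite measure follow
    factor by factor. *)
Definition box4 (A : R) : set (R4 R) := [set y | forall i, `|coord4 y i| <= A].

Lemma box4E (A : R) : box4 A =
  ((`[(-A)%R, A] `*` `[(-A)%R, A]) `*` `[(-A)%R, A]) `*` `[(-A)%R, A].
Proof.
apply/seteqP; split => [[[[a b] c] e] H|[[[a b] c] e] /= [[[]]]]; rewrite /= ?in_itv/=.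
  have := (H (inord 0), H (inord 1), H (inord 2), H (inord 3)).
  by rewrite /coord4/= !inordK//= !ler_norml => -[[[-> ->] ->] ->].
rewrite -!ler_norml => H0 H1 H2 H3.
by case=> [[|[|[|[|//]]]] Hi].
Qed.

Lemma continuous_bounded_box4 g (A : R) : continuous g ->
  exists2 C, 0 <= C & forall y, box4 A y -> `|g y| <= C.
Proof.
move=> cg.
have cb : compact (box4 A).
  by rewrite box4E; do 3! (apply: compact_setX; last exact: segment_compact); exact: segment_compact.
have [[y0 By0]|] := pselect (box4 A !=set0); last first.
  by move=> H; exists 0 => // y By; exfalso; apply: H; exists y.
have [c _ Hc] : exists2 c, c \in box4 A & forall t, t \in box4 A -> `|g t| <= `|g c|.
  apply: compact_EVT_max => //; first by exists y0.
  apply: continuous_subspaceT => y; apply: continuous_comp (cg y) _.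
  exact: norm_continuous.
by exists `|g c| => // y By; apply: Hc; exact: mem_set.
Qed.

Lemma leb4_box (A : R) : (leb4 (box4 A) < +oo)%E.
Proof.
rewrite box4E /leb4.
have I : (@lebesgue_measure R `[(- A)%R, A]%classic < +oo)%E.
  by rewrite lebesgue_measure_itv/=; case: ifP => _; rewrite -?EFinD ltry.
have mJ : measurable (`[(- A)%R, A]%classic : set (measurableTypeR R)) by [].
have mJ2 := measurableX mJ mJ.
have I2 : (leb2 R (`[(- A)%R, A] `*` `[(- A)%R, A]) < +oo)%E.
  exact: product_measure1_lty.
have I3 : (leb3 R ((`[(- A)%R, A] `*` `[(- A)%R, A]) `*` `[(- A)%R, A]) < +oo)%E.
  exact: product_measure1_lty.
exact: (@product_measure1_lty _ _ _ _ _ (leb3 R) _ _ _ (measurableX mJ2 mJ)).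
Qed.

Lemma measurable_box4 (A : R) : measurable (box4 A).
Proof. by rewrite box4E; do 3! (apply: measurableX; last by []). Qed.
End R4_integration.

(** * Integrals of compactly supported derivatives over R^4 *)

Section R4_divergence.
Context {R : realType}.
Implicit Types (x y : R4 R) (g h : R4 R -> R).

Local Notation I := (Rintegral (@leb4 R) setT).
Local Notation intg g := ((@leb4 R).-integrable setT (EFin \o g)).

Lemma integrable_continuous_bsupp g (A : R) : continuous g ->
  (forall y, ~ box4 A y -> g y = 0) -> intg g.
Proof.
move=> cg g0; have [C C0 gC] := continuous_bounded_box4 A cg.
apply: (@integrable_dom _ _ _ (@leb4 R) g (fun y => C * \1_(box4 A) y)).
- exact: continuous_measurable_R4.
- apply: integrable_scale; rewrite (_ : _ \o _ = (cst 1%E) \_ (box4 A)); last first.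
    by apply/funext => y; rewrite patchE/= indicE; case: ifP.
  rewrite -(integrable_mkcond (mu := @leb4 R) (cst 1%E) (measurable_box4 A)).
  apply: measurable_bounded_integrable => //; first exact: measurable_box4.
    exact: leb4_box.
  by exists 1; split=> // M M1 y _ /=; rewrite normr1 ltW.
- move=> y; rewrite indicE; have [By|By] := pselect (box4 A y).
    by rewrite mem_set// mulr1; exact: gC.
  by rewrite memNset// mulr0 g0// normr0.
Qed.

Lemma slice_derive_integral0 (i : 'I_4) h (h' : R4 R -> R) (A : R) y :
  (forall y, is_derive y (e4 i) h (h' y)) -> continuous h' ->
  (forall y, ~ box4 A y -> h y = 0) ->
  coord4 y i = 0 ->
  (\int[@lebesgue_measure R]_r (h' (r *: e4 i + y))%:E = 0)%E.
Proof.
move=> dh ch' h0 yi.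
apply: (@integral_derive_compact _ (fun r => h (r *: e4 i + y)) _ A).
- by move=> r; apply/is_derive_line.
- move=> r; apply: (@continuous_comp _ _ _ (fun r : R => r *: e4 i + y) h'); last exact: ch'.
  apply: continuousD; last exact: cvg_cst.
  by apply: continuousZl; exact: cvg_id.
- move=> r Ar; apply: h0 => /(_ i); rewrite leNgt => /negP; apply.
  suff -> : coord4 (r *: e4 i + y) i = r by [].
  move: yi; case: i {dh} => [[|[|[|[|//]]]] Hi]; rewrite /coord4/= => ->;
    by rewrite addr0 [_ *: _]mulr1.
Qed.

(** Fubini reduces the claim to the lines parallel to [e4 i], on which [h] has compact support and
    the fundamental theorem of calculus applies. *)
Lemma Rintegral_derive_bsupp (i : 'I_4) h (h' : R4 R -> R) (A : R) :
  (forall y, is_derive y (e4 i) h (h' y)) -> continuous h' ->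
  (forall y, ~ box4 A y -> h y = 0) -> (forall y, ~ box4 A y -> h' y = 0) ->
  I h' = 0.
Proof.
move=> dh ch' h0 h'0.
have S y := @slice_derive_integral0 i h h' A y dh ch' h0.
have /= If := integrable_continuous_bsupp ch' h'0.
rewrite /Rintegral.
suff -> : (\int[leb4]_x (h' x)%:E = 0)%E by [].
move: S If; rewrite /leb4; case: i dh => [[|[|[|[|//]]]] Hi] dh S If.
- apply: (@integral_prod_null_fst _ _ _ _ _ (leb3 R) _ _ If) => e If3.
  apply: (@integral_prod_null_fst _ _ _ _ _ (leb2 R) _ _ If3) => c If2.
  apply: (integral_prod_null_fst If2) => b If1.
  rewrite -[RHS](S (0, b, c, e))//; apply: eq_integral => r _.
  by rewrite /e4/=; congr (h' _)%:E; congr (_, _, _, _);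
    rewrite /= [_ *: _]mulr_natr/= ?mulr0n ?add0r// addr0.
- apply: (@integral_prod_null_fst _ _ _ _ _ (leb3 R) _ _ If) => e If3.
  apply: (@integral_prod_null_fst _ _ _ _ _ (leb2 R) _ _ If3) => c If2.
  apply: (integral_prod_null_snd If2) => a If1.
  rewrite -[RHS](S (a, 0, c, e))//; apply: eq_integral => r _.
  by rewrite /e4/=; congr (h' _)%:E; congr (_, _, _, _);
    rewrite /= [_ *: _]mulr_natr/= ?mulr0n ?add0r// addr0.
- apply: (@integral_prod_null_fst _ _ _ _ _ (leb3 R) _ _ If) => e If3.
  apply: (@integral_prod_null_snd _ _ _ _ _ (leb2 R) _ _ If3) => -[a b] If2.
  rewrite -[RHS](S (a, b, 0, e))//; apply: eq_integral => r _.
  by rewrite /e4/=; congr (h' _)%:E; congr (_, _, _, _);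
    rewrite /= [_ *: _]mulr_natr/= ?mulr0n ?add0r// addr0.
- apply: (@integral_prod_null_snd _ _ _ _ _ (leb3 R) _ _ If) => -[[a b] c] If3.
  rewrite -[RHS](S (a, b, c, 0))//; apply: eq_integral => r _.
  by rewrite /e4/=; congr (h' _)%:E; congr (_, _, _, _);
    rewrite /= [_ *: _]mulr_natr/= ?mulr0n ?add0r// addr0.
Qed.
End R4_divergence.

(** * Truncated moments and the Laplacian *)

Section Laplacian_moments.
Context {R : realType}.
Implicit Types (x y : R4 R) (g h : R4 R -> R) (i j : 'I_4) (k : nat) (t : R).

Local Notation I := (Rintegral (@leb4 R) setT).
Local Notation intg g := ((@leb4 R).-integrable setT (EFin \o g)).

Definition sqd x y : R := \sum_(i < 4) (coord4 x i - coord4 y i) ^+ 2.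

Lemma sqd_ge0 x y : 0 <= sqd x y.
Proof. by apply: sumr_ge0 => i _; exact: sqr_ge0. Qed.

Lemma coord4B x y i : coord4 (x - y) i = coord4 x i - coord4 y i.
Proof. by case: i => [[|[|[|[|//]]]] Hi]. Qed.

Lemma coord4D x y i : coord4 (x + y) i = coord4 x i + coord4 y i.
Proof. by case: i => [[|[|[|[|//]]]] Hi]. Qed.

Lemma coord4Z r x i : coord4 (r *: x) i = r * coord4 x i.
Proof. by case: i => [[|[|[|[|//]]]] Hi]. Qed.

Lemma coord4_e4 i j : coord4 (e4 i : R4 R) j = (i == j)%:R.
Proof. by case: i j => [[|[|[|[|//]]]] Hi] [[|[|[|[|//]]]] Hj]. Qed.

Lemma enorm4_sqr x y : enorm4 (x - y) ^+ 2 = sqd x y.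
Proof.
rewrite /enorm4 sqr_sqrtr; last by apply: sumr_ge0 => i _; exact: sqr_ge0.
by apply: eq_bigr => i _; rewrite coord4B.
Qed.

Lemma continuous_sum4 (F : 'I_4 -> R4 R -> R) : (forall i, continuous (F i)) ->
  continuous (fun y => \sum_(i < 4) F i y).
Proof. by move=> cF; apply: continuous_big => //; exact: add_continuous. Qed.

Lemma continuous_sqd x : continuous (sqd x).
Proof.
apply: continuous_sum4 => i y; apply: (@continuous_comp _ _ _ (fun y => coord4 x i - coord4 y i) (fun r : R => r ^+ 2));
  last exact: exprn_continuous.
by apply: cvgB; [exact: cvg_cst|exact: continuous_coord4].
Qed.

Lemma is_derive_coord4 i j y : is_derive y (e4 i) (fun y => coord4 y j) ((i == j)%:R : R).
Proof.
apply/is_derive_epsP => e e0; exists 1 => // h h0 _.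
rewrite coord4D coord4Z coord4_e4 addrK subrr normr0.
by rewrite mulr_ge0// ltW.
Qed.

Lemma is_derive_sqd x i y :
  is_derive y (e4 i) (sqd x) (- 2 * (coord4 x i - coord4 y i)).
Proof.
rewrite (_ : sqd x = \sum_(j < 4)
   (fun y => (coord4 x j - coord4 y j) * (coord4 x j - coord4 y j))); last first.
  by apply/funext => z; rewrite fct_sumE; apply: eq_bigr => j _; rewrite expr2.
have D j : is_derive y (e4 i)
    (fun y => (coord4 x j - coord4 y j) * (coord4 x j - coord4 y j))
    (- 2 * (coord4 x j - coord4 y j) * (i == j)%:R).
  have h := is_derive_sub (is_derive_cst (coord4 x j) y (e4 i)) (is_derive_coord4 i j y).
  by apply: is_derive_eq (is_derive_mul h h) _; rewrite /cst/=; ring.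
apply: is_derive_eq (is_derive_sum D) _.
by rewrite (bigD1 i)//= big1 ?addr0 ?eqxx ?mulr1// => j /negPf; rewrite eq_sym => ->; rewrite mulr0.
Qed.

Definition trunc k x t y : R := ppow k (t - sqd x y).

Lemma is_derive_trunc k x t i y : is_derive y (e4 i) (trunc k.+2 x t)
  (k.+2%:R * (2 * ((coord4 x i - coord4 y i) * trunc k.+1 x t y))).
Proof.
have h := is_derive_sub (is_derive_cst t y (e4 i)) (is_derive_sqd x i y).
by apply: is_derive_eq (is_derive_chain (is_derive_ppow k _) h) _; rewrite /trunc/cst; ring.
Qed.

(** From exponent 3 on the cut-off is twice continuously differentiable, as Green's identity
    requires; this is the derivative of its first derivative. *)
Lemma is_derive_trunc2 k x t i y : is_derive y (e4 i)
  (fun y => k.+3%:R * (2 * ((coord4 x i - coord4 y i) * trunc k.+2 x t y)))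
  (k.+3%:R * (2 * (k.+2%:R * 2 * ((coord4 x i - coord4 y i) ^+ 2 * trunc k.+1 x t y)
     - trunc k.+2 x t y))).
Proof.
apply/is_derive_scal/is_derive_scal.
have h := is_derive_sub (is_derive_cst (coord4 x i) y (e4 i)) (is_derive_coord4 i i y).
apply: is_derive_eq (is_derive_mul h (is_derive_trunc k x t i y)) _.
by rewrite eqxx/cst/= mulr1n; ring.
Qed.

Lemma continuous_trunc k x t : continuous (trunc k x t).
Proof.
move=> y; apply: (@continuous_comp _ _ _ (fun y => t - sqd x y) (ppow k)).
  by apply: cvgB; [exact: cvg_cst|exact: continuous_sqd].
exact: continuous_ppow.
Qed.

Lemma trunc_bsupp x t : exists A, forall k y, ~ box4 A y -> trunc k.+1 x t y = 0.
Proof.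
(* Outside this box some [|x_i - y_i|] is at least [|t| + 1], a number larger than 1 or equal to it,
   so its square is at least [t]. *)
exists (\sum_(i < 4) `|coord4 x i| + `|t| + 1) => k y.
move=> /existsNP[i /negP]; rewrite -ltNge => yi.
apply: ppow_le0; rewrite subr_le0.
have : (coord4 x i - coord4 y i) ^+ 2 <= sqd x y.
  by rewrite /sqd (bigD1 i)//= lerDl sumr_ge0// => j _; exact: sqr_ge0.
apply: le_trans.
have : `|coord4 x i| <= \sum_(i < 4) `|coord4 x i|.
  by rewrite (bigD1 i)//= lerDl sumr_ge0.
have := lerB_dist (coord4 y i) (coord4 x i).
rewrite distrC -real_normK ?num_real//; move: yi.
set a := `|coord4 x i - coord4 y i|; set b := `|coord4 x i|; set c := \sum_(_ < _) _.
move=> yi h1 h2; have ht := ler_norm t; have ht0 := normr_ge0 t.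
have : `|t| + 1 <= a by lra.
by move=> h; nra.
Qed.

(** The regularity is imposed on the pure second derivatives, those that enter [Lap]. *)
Definition C2 g := continuous g /\ forall i,
  [/\ forall y, derivable g y (e4 i), continuous ('D_(e4 i) g),
      forall y, derivable ('D_(e4 i) g) y (e4 i) & continuous ('D_(e4 i) ('D_(e4 i) g))].

Lemma continuous_mul g h : continuous g -> continuous h -> continuous (fun y => g y * h y).
Proof. by move=> cg ch y; apply: cvgM; [exact: cg|exact: ch]. Qed.

Lemma continuous_sub g h : continuous g -> continuous h -> continuous (fun y => g y - h y).
Proof. by move=> cg ch y; apply: cvgB; [exact: cg|exact: ch]. Qed.

Lemma continuous_loc_integrable g x : continuous g ->
  loc_integrable leb4 (sqd x) g.
Proof.
move=> cg; split; first exact: continuous_measurable_R4.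
move=> t; have [A HA] := trunc_bsupp x t.
apply: (@integrable_continuous_bsupp R (fun y => g y * trunc 1 x t y) A).
  by apply: continuous_mul => //; exact: continuous_trunc.
by move=> y By; rewrite HA// mulr0.
Qed.

Lemma measurable_sqd x : measurable_fun setT (sqd x :
  measurableTypeR R * measurableTypeR R * measurableTypeR R * measurableTypeR R -> R).
Proof. by apply: continuous_measurable_R4; exact: continuous_sqd. Qed.

Local Notation S x := (tmoment (@leb4 R) (sqd x)).

(** Green's identity in one direction: the right side is [g] against the second derivative of the
    cut-off, and the two integrands differ by the [e4 i]-derivative of a function with bounded
    support, the one given to [Rintegral_derive_bsupp]. *)
Lemma integration_by_parts_trunc k x t i g : C2 g ->
  I (fun y => 'D_(e4 i) ('D_(e4 i) g) y * trunc k.+3 x t y) =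
  k.+3%:R * 2 *
    (k.+2%:R * 2 * I (fun y => g y * ((coord4 x i - coord4 y i) ^+ 2 * trunc k.+1 x t y))
    - I (fun y => g y * trunc k.+2 x t y)).
Proof.
move=> [cg /(_ i)[dg cdg ddg cddg]]; have [A HA] := trunc_bsupp x t.
have cc : continuous (fun y => (coord4 x i - coord4 y i) ^+ 2).
  move=> y; apply: (@continuous_comp _ _ _ (fun y => coord4 x i - coord4 y i) (fun r : R => r ^+ 2)); last exact: exprn_continuous.
  by apply: cvgB; [exact: cvg_cst|exact: continuous_coord4].
have I1 : intg (fun y => 'D_(e4 i) ('D_(e4 i) g) y * trunc k.+3 x t y).
  apply: (@integrable_continuous_bsupp _ _ A) => [|y By]; last by rewrite HA// mulr0.
  by apply: continuous_mul => //; exact: continuous_trunc.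
have I2 : intg (fun y => g y * ((coord4 x i - coord4 y i) ^+ 2 * trunc k.+1 x t y)).
  apply: (@integrable_continuous_bsupp _ _ A) => [|y By]; last by rewrite HA// !mulr0.
  by apply: continuous_mul => //; apply: continuous_mul => //; exact: continuous_trunc.
have I3 : intg (fun y => g y * trunc k.+2 x t y).
  apply: (@integrable_continuous_bsupp _ _ A) => [|y By]; last by rewrite HA// !mulr0.
  by apply: continuous_mul => //; exact: continuous_trunc.
rewrite -RintegralZl// -RintegralB//; last exact: integrable_scale.
rewrite -RintegralZl//; last by apply: integrable_subr => //; exact: integrable_scale.
apply/eqP; rewrite -subr_eq0 -RintegralB//; last first.
  by apply: integrable_scale; apply: integrable_subr => //; exact: integrable_scale.
apply/eqP.
apply: (@Rintegral_derive_bsupp _ i (fun y => 'D_(e4 i) g y * trunc k.+3 x t y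
   - g y * (k.+3%:R * (2 * ((coord4 x i - coord4 y i) * trunc k.+2 x t y)))) _ A).
- move=> y; have dg' := derivableP (dg y); have ddg' := derivableP (ddg y).
  apply: is_derive_eq (is_derive_sub (is_derive_mul ddg' (is_derive_trunc _ x t i y))
    (is_derive_mul dg' (is_derive_trunc2 _ x t i y))) _.
  ring.
- apply: continuous_sub => //; first by apply: continuous_mul => //; exact: continuous_trunc.
  apply: continuous_mul; first exact: cst_continuous.
  apply: continuous_sub; last by apply: continuous_mul => //; exact: continuous_trunc.
  apply: continuous_mul; first exact: cst_continuous.
  by apply: continuous_mul => //; apply: continuous_mul => //; exact: continuous_trunc.
- by move=> y By; rewrite !HA// !mulr0 subrr.
- by move=> y By; rewrite !HA// !mulr0 subrr mulr0 subrr.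
Qed.

(** The cut-off has Laplacian [4 (k+3) ((k+2) s (t-s)_+^(k+1) - 2 (t-s)_+^(k+2))], where 2 is half
    the dimension; writing [s] as [t - (t - s)] leaves moments of [g] alone. *)
Lemma tmoment_Lap k x t g : C2 g ->
  S x (Lap g) k.+3 t =
  4 * k.+3%:R * (k.+2%:R * t * S x g k.+1 t - k.+4%:R * S x g k.+2 t).
Proof.
move=> Cg; have [cg dg] := Cg; have [A HA] := trunc_bsupp x t.
have Ltr h k' : continuous h -> intg (fun y => h y * trunc k'.+1 x t y).
  move=> ch; apply: (@integrable_continuous_bsupp _ _ A) => [|y By]; last by rewrite HA// !mulr0.
  by apply: continuous_mul => //; exact: continuous_trunc.
have cc i : continuous (fun y => (coord4 x i - coord4 y i) ^+ 2).
  move=> y; apply: (@continuous_comp _ _ _ (fun y => coord4 x i - coord4 y i)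
    (fun r : R => r ^+ 2)); last exact: exprn_continuous.
  by apply: cvgB; [exact: cvg_cst|exact: continuous_coord4].
have -> : S x (Lap g) k.+3 t =
    \sum_(i < 4) I (fun y => 'D_(e4 i) ('D_(e4 i) g) y * trunc k.+3 x t y).
  rewrite -Rintegral_sum_ord; last by move=> i; apply: Ltr; have [] := dg i.
  by apply: eq_Rintegral => y _; rewrite /Lap mulr_suml.
under eq_bigr do rewrite integration_by_parts_trunc//.
rewrite -mulr_sumr sumrB -mulr_sumr sumr_const card_ord -Rintegral_sum_ord; last first.
  by move=> i; under eq_fun do rewrite mulrA; apply: Ltr; exact: continuous_mul.
have -> : I (fun y => \sum_(i < 4) (g y * ((coord4 x i - coord4 y i) ^+ 2 * trunc k.+1 x t y))) =
   S x (fun y => g y * sqd x y) k.+1 t.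
  by apply: eq_Rintegral => y _; rewrite -mulr_sumr -mulr_suml mulrA.
rewrite tmoment_mul//; [|exact: measurable_sqd|exact: sqd_ge0|exact: continuous_loc_integrable].
rewrite -/(S x g k.+2 t) -[X in _ - X]mulr_natl -!natr1; ring.
Qed.
End Laplacian_moments.

Section product_integral.
Local Open Scope ereal_scope.
Context d1 d2 (X : measurableType d1) (Y : measurableType d2) (R : realType).
Variables (m1 : {sigma_finite_measure set X -> \bar R})
  (m2 : {sigma_finite_measure set Y -> \bar R}).

Lemma integral_prod_mul (a : X -> R) (b : Y -> R) (A B : R) :
  measurable_fun setT a -> measurable_fun setT b ->
  (forall x, 0 <= a x)%R -> (forall y, 0 <= b y)%R ->
  \int[m1]_x (a x)%:E = A%:E -> \int[m2]_y (b y)%:E = B%:E ->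
  \int[m1 \x m2]_z (a z.1 * b z.2)%:E = (A * B)%:E.
Proof.
move=> ma mb a0 b0 IA IB.
rewrite (@fubini_tonelli1 _ _ _ _ _ m1 m2); last 2 first.
- apply/measurable_EFinP; apply: measurable_funM; first exact: measurableT_comp.
  exact: measurableT_comp.
- by move=> z; rewrite lee_fin mulr_ge0.
rewrite /fubini_F/=.
under eq_integral => x _.
  under eq_integral do rewrite EFinM.
  rewrite ge0_integralZl_EFin//; last 2 first.
    by move=> y _; rewrite lee_fin.
    exact/measurable_EFinP.
  rewrite IB.
  over.
rewrite ge0_integralZr//; first by rewrite IA.
- exact/measurable_EFinP.
- by move=> x _; rewrite lee_fin.
- by rewrite -IB integral_ge0// => y _; rewrite lee_fin.
Qed.
End product_integral.

(** * The moments of 1 and the limit at scale 0 *)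

Section R4_gaussian.
Context {R : realType}.
Implicit Types (x y : R4 R) (c : R).

Lemma integral_gauss_center c :
  (\int[@lebesgue_measure R]_r (expR (- (c - r) ^+ 2))%:E = (Num.sqrt pi)%:E)%E.
Proof.
(* Variance 1/2 turns the exponent of the normal density into [- (c - r)^2]. *)
pose s : R := Num.sqrt 2^-1.
have s2 : s ^+ 2 *+ 2 = 1 by rewrite sqr_sqrtr ?invr_ge0// -[_ *+ 2]mulr_natr mulVf// pnatr_eq0.
have s0 : s != 0 by rewrite sqrtr_eq0 -ltNge invr_gt0.
have p0 : 0 < Num.sqrt pi :> R by rewrite sqrtr_gt0 pi_gt0.
have h := integral_normal_pdf c s.
have E r : (expR (- (c - r) ^+ 2))%:E = ((Num.sqrt pi)%:E * (normal_pdf c s r)%:E)%E.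
  rewrite -EFinM /normal_pdf (negPf s0) /normal_peak /normal_fun.
  rewrite s2 divr1 -mulrnAl s2 mul1r mulrA divff ?gt_eqF// mul1r.
  by rewrite -sqrrN opprB.
under eq_integral do rewrite E.
rewrite ge0_integralZl_EFin//; first by rewrite h mule1.
- by move=> r _; rewrite lee_fin normal_pdf_ge0.
- by apply/measurable_EFinP; exact: measurable_normal_pdf.
Qed.

Lemma integral_gauss_R4 x :
  (\int[leb4]_y (expR (- sqd x y))%:E = (pi ^+ 2)%:E)%E.
Proof.
have mg c : measurable_fun setT (fun r : measurableTypeR R => expR (- (c - r) ^+ 2)).
  apply: continuous_measurable_fun => r.
  apply: (@continuous_comp _ _ _ (fun r => - (c - r) ^+ 2)); last exact: continuous_expR.
  apply: cvgN; apply: (@continuous_comp _ _ _ (fun r => c - r) (fun r => r ^+ 2)).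
    by apply: cvgB; [exact: cvg_cst|exact: cvg_id].
  exact: exprn_continuous.
have I2 := @integral_prod_mul _ _ _ _ _ (@lebesgue_measure R) (@lebesgue_measure R)
   _ _ _ _ (mg x.1.1.1) (mg x.1.1.2) (fun _ => expR_ge0 _) (fun _ => expR_ge0 _)
   (integral_gauss_center _) (integral_gauss_center _).
have m2 : measurable_fun setT (fun z : measurableTypeR R * measurableTypeR R =>
   expR (- (x.1.1.1 - z.1) ^+ 2) * expR (- (x.1.1.2 - z.2) ^+ 2)).
  by apply: measurable_funM; [exact: (measurableT_comp (mg _))|exact: (measurableT_comp (mg _))].
have I3 := @integral_prod_mul _ _ _ _ _ (leb2 R) (@lebesgue_measure R)
   _ _ _ _ m2 (mg x.1.2) (fun _ => mulr_ge0 (expR_ge0 _) (expR_ge0 _)) (fun _ => expR_ge0 _)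
   I2 (integral_gauss_center _).
have m3 : measurable_fun setT (fun z : measurableTypeR R * measurableTypeR R * measurableTypeR R =>
   expR (- (x.1.1.1 - z.1.1) ^+ 2) * expR (- (x.1.1.2 - z.1.2) ^+ 2)
   * expR (- (x.1.2 - z.2) ^+ 2)).
  by apply: measurable_funM; [exact: (measurableT_comp m2)|exact: (measurableT_comp (mg _))].
have I4 := @integral_prod_mul _ _ _ _ _ (leb3 R) (@lebesgue_measure R)
   _ _ _ _ m3 (mg x.2)
   (fun _ => mulr_ge0 (mulr_ge0 (expR_ge0 _) (expR_ge0 _)) (expR_ge0 _)) (fun _ => expR_ge0 _)
   I3 (integral_gauss_center _).
have -> : pi ^+ 2 = Num.sqrt pi * Num.sqrt pi * Num.sqrt pi * Num.sqrt pi :> R.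
  by rewrite -mulrA -!expr2 sqr_sqrtr ?pi_ge0.
rewrite -I4; apply: eq_integral => -[[[a b] c] e] _; congr (_%:E).
rewrite -!expRD; congr expR.
by rewrite /sqd sum_coord4 /coord4/= !inordK//= !opprD.
Qed.
End R4_gaussian.

Section scaling.
Context {R : realType}.
Implicit Types (t a b s w : R) (n k : nat).

Lemma is_derive_powV n t : t != 0 ->
  is_derive t 1 (fun t => t^-1 ^+ n) (- n%:R * t^-1 ^+ n.+1).
Proof.
move=> t0; elim: n => [|n IH].
  by rewrite oppr0 mul0r; exact: is_derive_cst.
have := is_derive_mul (is_deriveV t0 (is_derive_id t 1)) IH.
rewrite (_ : (fun y => _ * _) = (fun t => t^-1 ^+ n.+1)); last first.
  by apply/funext => y; rewrite exprS.
move=> h; apply: is_derive_eq h _.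
by rewrite [_ *: _]mulr1 -!exprVn -natr1 !exprS; ring.
Qed.

Lemma bernoulli_le b n : 0 <= b <= 1 -> 1 - n%:R * b <= (1 - b) ^+ n.
Proof.
move=> /andP[b0 b1]; elim: n => [|n IH]; first by rewrite mul0r subr0.
rewrite exprS; have := ler_wpM2l (_ : 0 <= 1 - b) IH; rewrite subr_ge0 => /(_ b1).
apply: le_trans; rewrite -natr1.
have : 0 <= n%:R * (b * b) by rewrite !mulr_ge0.
lra.
Qed.

Lemma ppow_le_expR n s : ppow n.+1 (1 - s / n.+1%:R) <= expR (- s).
Proof.
have -> : - s = n.+1%:R * (- s / n.+1%:R) by rewrite mulrC divfK// pnatr_eq0.
rewrite expRM_natl /ppow lerXn2r ?nnegrE ?expR_ge0 ?le_max ?lexx ?orbT//.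
rewrite ge_max expR_ge0 andbT.
by have := expR_ge1Dx (- s / n.+1%:R); rewrite mulNr.
Qed.

(** With [w = s / N], the inequality [(1 + w) exp (- w) <= 1] gives [(1 - w^2) exp (- w) <= 1 - w];
    take the [N]-th power and apply Bernoulli to [(1 - w^2)^N]. *)
Lemma ppow_ge_expR n s : 0 <= s -> s <= n.+1%:R ->
  (1 - s ^+ 2 / n.+1%:R) * expR (- s) <= ppow n.+1 (1 - s / n.+1%:R).
Proof.
move=> s0 sn; pose N : R := n.+1%:R; have N0 : 0 < N by rewrite ltr0n.
pose w := s / N.
have w0 : 0 <= w by rewrite divr_ge0// ltW.
have w1 : w <= 1 by rewrite ler_pdivrMr// mul1r.
rewrite -/N -/w ppow_ge; last by rewrite subr_ge0.
have E1 : (1 - w ^+ 2) * expR (- w) <= 1 - w.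
  have : (1 + w) * expR (- w) <= 1.
    by rewrite expRN ler_pdivrMr ?expR_gt0// mul1r expR_ge1Dx.
  have -> : 1 - w ^+ 2 = (1 - w) * (1 + w) by ring.
  by rewrite -mulrA => h; rewrite ler_piMr// subr_ge0.
have w2 : 0 <= w ^+ 2 <= 1 by rewrite sqr_ge0 exprn_ile1.
apply: (@le_trans _ _ (((1 - w ^+ 2) * expR (- w)) ^+ n.+1)); last first.
  by rewrite lerXn2r ?nnegrE ?subr_ge0// mulr_ge0 ?expR_ge0// subr_ge0; case/andP: w2.
rewrite exprMn -expRM_natl (_ : n.+1%:R * - w = - s); last first.
  by rewrite mulrN mulrC divfK// gt_eqF.
rewrite ler_wpM2r ?expR_ge0//.
have := bernoulli_le n.+1 w2; apply: le_trans.
rewrite -/N (_ : s ^+ 2 / N = N * w ^+ 2)//.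
by rewrite /w expr_div_n expr2 [in RHS]expr2; field; rewrite gt_eqF.
Qed.

Lemma cvg_ppow_expR s : 0 <= s ->
  ppow n.+1 (1 - s / n.+1%:R) @[n --> \oo] --> expR (- s).
Proof.
move=> s0.
apply: (@squeeze_cvgr _ _ _ _ (fun n => (1 - s ^+ 2 * harmonic n) * expR (- s)) (fun=> expR (- s))).
- near=> n; rewrite ppow_le_expR andbT ppow_ge_expR//.
  by rewrite (le_trans _ (_ : n%:R <= _)) ?ler_nat//; near: n; exact: nbhs_infty_ger.
- rewrite -[X in _ --> X]mul1r; apply: cvgMl.
  rewrite -[X in _ --> X]subr0; apply: cvgB; first exact: cvg_cst.
  by rewrite -(mulr0 (s ^+ 2)); apply: cvgMr; exact: cvg_harmonic.
- exact: cvg_cst.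
Unshelve. all: end_near. Qed.
End scaling.

(** * Derivatives of scaled moments in the scale, and the constant [pi^2] *)

Section scaled_moments.
Context {R : realType}.
Implicit Types (x y : R4 R) (g h : R4 R -> R) (i j : 'I_4) (k n : nat) (t : R).

Local Notation I := (Rintegral (@leb4 R) setT).
Local Notation intg g := ((@leb4 R).-integrable setT (EFin \o g)).
Local Notation S x := (tmoment (@leb4 R) (sqd x)).
Local Notation loc x := (loc_integrable (@leb4 R) (sqd x)).

Lemma is_derive_S x g k t : loc x g ->
  is_derive t 1 (S x g k.+2) (k.+2%:R * S x g k.+1 t).
Proof. by apply: is_derive_tmoment; [exact: measurable_sqd|exact: sqd_ge0]. Qed.

Lemma S_mul_sqd x g k t : loc x g ->
  S x (fun y => g y * sqd x y) k.+1 t = t * S x g k.+1 t - S x g k.+2 t.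
Proof. by apply: tmoment_mul; [exact: measurable_sqd|exact: sqd_ge0]. Qed.

Lemma is_derive_scaled_S x g n k t : loc x g -> 0 < t ->
  is_derive t 1 (fun t => t^-1 ^+ n * S x g k.+2 t)
    (t^-1 ^+ n.+1 * (k.+2%:R * t * S x g k.+1 t - n%:R * S x g k.+2 t)).
Proof.
move=> Lg t0; have tn0 : t != 0 by rewrite gt_eqF.
apply: is_derive_eq (is_derive_mul (is_derive_powV n tn0) (is_derive_S k t Lg)) _.
have -> : t^-1 ^+ n = t * t^-1 ^+ n.+1 by rewrite exprS mulrA divff// mul1r.
ring.
Qed.

(** With this power of [t] the weight is [(1 - s / t)_+^(k+2)]. Its derivative carries a factor [s],
    which will cancel the singular weight [1 / s] of the Newtonian potential. *)
Lemma is_derive_scaled_S_mul x g k t : loc x g -> 0 < t ->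
  is_derive t 1 (fun t => t^-1 ^+ k.+2 * S x g k.+2 t)
    (k.+2%:R * t^-1 ^+ k.+3 * S x (fun y => g y * sqd x y) k.+1 t).
Proof.
move=> Lg t0; apply: is_derive_eq (is_derive_scaled_S k.+2 k Lg t0) _.
by rewrite S_mul_sqd//; ring.
Qed.

(** [k + 4] is the degree in [t] of the moment of 1, the cut-off contributing [k + 2] and the volume
    2. The scaled moment is thus a weighted mean of [g], and the bracket in its derivative is the
    one of [tmoment_Lap]. *)
Lemma is_derive_scaled_S_Lap x g k t : C2 g -> 0 < t ->
  is_derive t 1 (fun t => t^-1 ^+ k.+4 * S x g k.+2 t)
    ((4 * k.+3%:R)^-1 * (t^-1 ^+ k.+4.+1 * S x (Lap g) k.+3 t)).
Proof.
move=> Cg t0; have Lg : loc x g by apply: continuous_loc_integrable; have [] := Cg.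
apply: is_derive_eq (is_derive_scaled_S k.+4 k Lg t0) _.
rewrite tmoment_Lap//; field.
by rewrite gt_eqF// pnatr_eq0.
Qed.

Lemma derive_cst4 (c : R) i : 'D_(e4 i) (fun=> c) = (fun=> 0) :> (R4 R -> R).
Proof. by apply/funext => y; exact: derive_cst. Qed.

Lemma C2_cst (c : R) : C2 (fun=> c : R).
Proof.
split=> [|i]; first exact: cst_continuous.
split; rewrite ?derive_cst4.
- by move=> y; exact: (derivable_cst c).
- exact: cst_continuous.
- by move=> y; exact: (derivable_cst (0 : R)).
- exact: cst_continuous.
Qed.

Lemma Lap_cst (c : R) : Lap (fun=> c : R) = (fun=> 0) :> (R4 R -> R).
Proof.
apply/funext => y; rewrite /Lap big1// => i _.
by rewrite derive_cst4; exact: derive_cst.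
Qed.

Local Notation one := (fun=> 1 : R).

Lemma loc1 x : loc x one.
Proof. by apply: continuous_loc_integrable; exact: cst_continuous. Qed.

Lemma tmoment_cst0 x k t : S x (fun=> 0) k t = 0.
Proof.
rewrite /tmoment (_ : (fun _ => _) = cst 0); first by rewrite Rintegral_cst// mul0r.
by apply/funext => y; rewrite mul0r.
Qed.

Lemma S1_rec x k t : k.+2%:R * t * S x one k.+1 t = k.+4%:R * S x one k.+2 t.
Proof.
have := tmoment_Lap k x t (C2_cst 1); rewrite Lap_cst tmoment_cst0 => /esym/eqP.
by rewrite mulf_eq0 mulf_eq0 !pnatr_eq0/= subr_eq0 => /eqP.
Qed.

(** Homogeneity by differentiation: the Laplacian of 1 vanishes, so the scaled moment of 1 is
    constant. *)
Lemma S1_scale x k t : 0 < t -> S x one k.+2 t = t ^+ k.+4 * S x one k.+2 1.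
Proof.
move=> t0.
have h (r : R) : 0 < r -> is_derive r 1 (fun t => t^-1 ^+ k.+4 * S x one k.+2 t) 0.
  move=> r0; apply: is_derive_eq (is_derive_scaled_S_Lap x k (C2_cst 1) r0) _.
  by rewrite Lap_cst tmoment_cst0 !mulr0.
have := constant_of_derive0_pos h t0 ltr01.
rewrite /= invr1 expr1n mul1r => <-.
by rewrite exprVn mulVKf// expf_neq0// gt_eqF.
Qed.

Lemma S1_const x k : k.+3%:R * k.+4%:R * S x one k.+2 1 = 12 * S x one 2 1.
Proof.
elim: k => [|k <-]; first by ring.
have := S1_rec x k.+1 1; rewrite mulr1 => h.
by rewrite -mulrA -h; ring.
Qed.

(** [(1 - s / N)_+^N] is dominated by and converges to [exp (- s)], whose integral over R^4 is
    [pi^2]; by homogeneity its integral is also an explicit multiple, with factor tending to 1, of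
    the constant sought. *)
Lemma S1_const_pi x : 12 * S x one 2 1 = pi ^+ 2.
Proof.
pose F n y := ppow n.+2 (1 - sqd x y / n.+2%:R).
have mF n : measurable_fun setT (F n : measurableTypeR R * measurableTypeR R *
    measurableTypeR R * measurableTypeR R -> R).
  apply: continuous_measurable_R4 => y.
  apply: (@continuous_comp _ _ _ (fun y => 1 - sqd x y / n.+2%:R) (ppow n.+2)); last first.
    exact: continuous_ppow.
  by apply: cvgB; [exact: cvg_cst|apply: cvgMl; exact: continuous_sqd].
have Ig : intg (fun y => expR (- sqd x y)).
  apply/integrableP; split.
    apply/measurable_EFinP; apply: continuous_measurable_R4 => y.
    apply: (@continuous_comp _ _ _ (fun y => - sqd x y) expR); last exact: continuous_expR.
    by apply: cvgN; exact: continuous_sqd.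
  under eq_integral do rewrite /= ger0_norm ?expR_ge0//.
  by rewrite integral_gauss_R4 ltry.
have Fcvg y : F n y @[n --> \oo] --> expR (- sqd x y).
  have := cvg_ppow_expR (sqd_ge0 x y); rewrite -(cvg_shiftn 1).
  by under eq_fun do rewrite addn1.
have Fle n y : `|F n y| <= expR (- sqd x y).
  by rewrite ger0_norm ?ppow_ge0//; exact: ppow_le_expR.
have [_ h] := Rintegral_dctW mF Ig Fcvg Fle.
have {}h : I (F n) @[n --> \oo] --> pi ^+ 2.
  by move: h; rewrite {2}/Rintegral integral_gauss_R4.
suff h2 : I (F n) @[n --> \oo] --> 12 * S x one 2 1 by exact: (cvg_unique _ h2 h).
(* With [N = n + 2] the two factors are [N / (N + 1)] and [N / (N + 2)]; they come from the product
   of consecutive integers in [S1_const]. *)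
have E n : I (F n) = (1 - harmonic n.+2) * (1 - 2 * harmonic n.+3) * (12 * S x one 2 1).
  have -> : I (F n) = n.+2%:R^-1 ^+ n.+2 * S x one n.+2 n.+2%:R.
    rewrite -RintegralZl//; last exact: (loc_integrable_ppow (measurable_sqd x) (sqd_ge0 x) _ _ (loc1 x)).
    apply: eq_Rintegral => y _; rewrite mul1r -ppowM ?invr_ge0//.
    by rewrite /F mulrBr mulVf ?pnatr_eq0// mulrC.
  rewrite S1_scale// -(S1_const x n) /= exprVn.
  have -> : n.+4%:R = n.+2%:R + 2 :> R by rewrite -[n.+4]addn2 natrD.
  have -> : n.+3%:R = n.+2%:R + 1 :> R by rewrite -[n.+3]addn1 natrD.
  rewrite -[n.+4]addn2 [X in _ * (X * _)]exprD.
  have X0 : n.+2%:R ^+ n.+2 != 0 :> R by rewrite expf_neq0// pnatr_eq0.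
  have N0 : 0 < n.+2%:R :> R by [].
  move: X0 N0; set X := _ ^+ n.+2; set N := n.+2%:R => X0 N0.
  by clearbody X N; field; rewrite X0 !gt_eqF ?addr_gt0.
rewrite (funext E) -[X in _ --> X](mul1r (12 * S x one 2 1)); apply: cvgMl.
rewrite -[X in _ --> X]mul1r; apply: cvgM.
  rewrite -[X in _ --> X]subr0; apply: cvgB; first exact: cvg_cst.
  by have := @cvg_harmonic R; rewrite -(cvg_shiftn 2); under eq_fun do rewrite addn2.
rewrite -[X in _ --> X]subr0; apply: cvgB; first exact: cvg_cst.
rewrite -(mulr0 2); apply: cvgMr.
by have := @cvg_harmonic R; rewrite -(cvg_shiftn 3); under eq_fun do rewrite addn3.
Qed.

Lemma ball_momentE x k t : 0 <= t ->
  S x one k.+2 t = pi ^+ 2 / (k.+3%:R * k.+4%:R) * t ^+ k.+4.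
Proof.
rewrite le_eqVlt => /predU1P[<-|t0].
  by rewrite tmoment_le0 ?expr0n ?mulr0//; exact: sqd_ge0.
rewrite S1_scale// -(S1_const_pi x) -(S1_const x k) mulrC; congr (_ * _).
by rewrite mulrC mulrA mulVf ?mul1r// mulf_neq0// pnatr_eq0.
Qed.

Lemma near_sqd g x : continuous g -> forall e, 0 < e ->
  exists2 r, 0 < r & forall y, sqd x y <= r -> `|g y - g x| <= e.
Proof.
move=> cg e e0; have /cvgrPdist_le/(_ e e0) := cg x.
move=> /nbhs_ballP[r /= r0 H]; exists ((r / 2) ^+ 2).
  by rewrite exprn_gt0// divr_gt0.
move=> y yr; rewrite distrC; apply: H.
have B i : `|coord4 x i - coord4 y i| < r.
  apply: (@le_lt_trans _ _ (r / 2)); last lra.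
  rewrite -(@ler_pXn2r _ 2)// ?nnegrE//; last by rewrite divr_ge0// ltW.
  rewrite real_normK ?num_real//; apply: le_trans yr.
  by rewrite /sqd (bigD1 i)//= lerDl sumr_ge0// => j _; exact: sqr_ge0.
have := (B (inord 0), B (inord 1), B (inord 2), B (inord 3)).
by rewrite /coord4/= !inordK//= => -[[[? ?] ?] ?].
Qed.

(** Only points with [s <= t] count, where [g] lies between [g x - e'] and [g x + e']; the moments
    of these constants are known exactly. *)
Lemma cvg_scaled_S0 g x k : continuous g ->
  (fun t => t^-1 ^+ k.+4 * S x g k.+2 t) n.+1%:R^-1 @[n --> \oo] -->
    pi ^+ 2 / (k.+3%:R * k.+4%:R) * g x.
Proof.
move=> cg; pose c : R := pi ^+ 2 / (k.+3%:R * k.+4%:R).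
have c0 : 0 <= c by rewrite divr_ge0// ?exprn_ge0 ?pi_ge0.
have Lg := continuous_loc_integrable x cg.
apply/cvgrPdist_le => e e0; pose e' := e / (c + 1).
have e'0 : 0 < e' by rewrite divr_gt0// ltr_pwDr.
have [r r0 H] := near_sqd x cg e'0.
near=> n; set t := n.+1%:R^-1.
have t0 : 0 < t by rewrite invr_gt0.
have tr : t <= r.
  rewrite invf_ple ?posrE// ltW//.
  by apply: (@lt_trans _ _ n%:R); [near: n; exact: nbhs_infty_gtr|rewrite ltr_nat].
have S1 := ball_momentE x k (ltW t0).
have L1 a : loc x (fun=> a) by apply: continuous_loc_integrable; exact: cst_continuous.
have Sc a : S x (fun=> a) k.+2 t = a * (c * t ^+ k.+4).
  rewrite -S1 -RintegralZl//; last exact: (loc_integrable_ppow (measurable_sqd x) (sqd_ge0 x) _ _ (loc1 x)).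
  by apply: eq_Rintegral => y _; rewrite mul1r.
have up : S x g k.+2 t <= (g x + e') * (c * t ^+ k.+4).
  rewrite -Sc; apply: le_tmoment => //; [exact: measurable_sqd|exact: sqd_ge0|].
  by move=> y yt; have := H y (le_trans yt tr); rewrite ler_distl => /andP[].
have lo : (g x - e') * (c * t ^+ k.+4) <= S x g k.+2 t.
  rewrite -Sc; apply: le_tmoment => //; [exact: measurable_sqd|exact: sqd_ge0|].
  by move=> y yt; have := H y (le_trans yt tr); rewrite ler_distl => /andP[].
have T0 : 0 < t ^+ k.+4 by rewrite exprn_gt0.
rewrite -/c distrC ler_distl exprVn [_^-1 * _]mulrC ler_pdivlMr// ler_pdivrMr//.
have ce : e' * c <= e by rewrite /e' mulrAC ler_pdivrMr ?ltr_pwDr// ler_wpM2l ?lerDl// ltW.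
apply/andP; split.
- apply: le_trans lo; have := ler_wpM2r (ltW T0) ce; lra.
- apply: (le_trans up); have := ler_wpM2r (ltW T0) ce; lra.
Unshelve. all: end_near. Qed.

End scaled_moments.

(** * Newtonian potential and growth of u *)

Section newton_integrability.
Context {R : realType}.
Implicit Types (x y : R4 R) (g h f : R4 R -> R) (i j : 'I_4) (k n : nat) (t : R).

Local Notation intg g := ((@leb4 R).-integrable setT (EFin \o g)).
Local Notation S x := (tmoment (@leb4 R) (sqd x)).
Local Notation loc x := (loc_integrable (@leb4 R) (sqd x)).
Local Notation one := (fun=> 1 : R).

(* A bounded continuous regularization of [1 / |x - y|^2] which increases to
   it as [e] decreases to 0, including at [y = x] where [0^-1 = 0]. *)
Definition regV e x y : R := sqd x y / (sqd x y ^+ 2 + e).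

Lemma regV_ge0 e x y : 0 <= e -> 0 <= regV e x y.
Proof. by move=> e0; rewrite divr_ge0 ?sqd_ge0// addr_ge0 ?sqr_ge0. Qed.

Lemma regV_den e x y : 0 < e -> 0 < sqd x y ^+ 2 + e.
Proof. by move=> e0; rewrite ltr_wpDl ?sqr_ge0. Qed.

Lemma continuous_regV e x : 0 < e -> continuous (regV e x).
Proof.
move=> e0 y; apply: cvgM; first exact: continuous_sqd.
apply: cvgV; first by rewrite gt_eqF// regV_den.
apply: cvgD; last exact: cvg_cst.
by apply: (@continuous_comp _ _ _ (sqd x) (fun r => r ^+ 2));
  [exact: continuous_sqd|exact: exprn_continuous].
Qed.

(** A bound uniform in [e]. Since [regV e x y] times [s] is at most 1, the derivative of [t^-3 S_3]
    is at most [3 t^-4] times the second moment of 1, that is [pi^2 / 4]. So [F] below is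
    nondecreasing, and it tends to 0 at scale 0, where the boundedness of [regV e] enters. *)
Lemma S_regV_le e x t : 0 < e -> 0 < t -> S x (regV e x) 3 t <= pi ^+ 2 / 4 * t ^+ 4.
Proof.
move=> e0 t0.
have Lh : loc x (regV e x).
  by apply: continuous_loc_integrable; exact: continuous_regV.
have L1 c : loc x (fun=> c : R) by apply: continuous_loc_integrable; exact: cst_continuous.
have Ls : loc x (fun y => regV e x y * sqd x y).
  apply: continuous_loc_integrable; apply: continuous_mul; first exact: continuous_regV.
  exact: continuous_sqd.
have Sc c r : 0 <= r -> S x (fun=> c) 3 r = c * (pi ^+ 2 / 20 * r ^+ 5).
  move=> r0; have := ball_momentE x 1 r0; rewrite (_ : 4%:R * 5%:R = 20 :> R); last by ring.
  move=> <-; rewrite -RintegralZl//; last first.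
    exact: (loc_integrable_ppow (measurable_sqd x) (sqd_ge0 x) _ _ (loc1 x)).
  by apply: eq_Rintegral => y _; rewrite mul1r.
pose F t := pi ^+ 2 / 4 * t - t^-1 ^+ 3 * S x (regV e x) 3 t.
have dF (r : R) : 0 < r -> is_derive r 1 F
    (pi ^+ 2 / 4 * 1 - 3%:R * r^-1 ^+ 4 * S x (fun y => regV e x y * sqd x y) 2 r).
  move=> r0; exact: (is_derive_sub (is_derive_scal _ (is_derive_id r 1))
    (is_derive_scaled_S_mul 1 Lh r0)).
have dF0 (r : R) : 0 < r -> 
    0 <= pi ^+ 2 / 4 * 1 - 3%:R * r^-1 ^+ 4 * S x (fun y => regV e x y * sqd x y) 2 r.
  move=> r0; rewrite subr_ge0.
  have : S x (fun y => regV e x y * sqd x y) 2 r <= S x one 2 r.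
    apply: le_tmoment => //; [exact: measurable_sqd|exact: sqd_ge0|].
    move=> y _; rewrite /regV mulrAC ler_pdivrMr ?regV_den// mul1r expr2.
    by rewrite lerDl ltW.
  rewrite (ball_momentE x 0 (ltW r0)) exprVn => h.
  apply: (@le_trans _ _ (3 / r ^+ 4 * (pi ^+ 2 / (3%:R * 4%:R) * r ^+ 4))).
    by rewrite ler_wpM2l// divr_ge0// exprn_ge0// ltW.
  by rewrite le_eqVlt; apply/orP; left; apply/eqP; field; rewrite gt_eqF.
have F0 : F t >= 0.
  apply/ler_addgt0Pl => d d0.
  (* [regV e <= 1 + e^-1], and [pi^2 / 20] is the constant of the third moment of 1; hence
     [a^-3 S_3 <= C a^2 <= C a <= d] at the scale [a] chosen next. *)
  pose C := (1 + e^-1) * (pi ^+ 2 / 20).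
  have C0 : 0 < C by rewrite mulr_gt0 ?addr_gt0 ?invr_gt0// divr_gt0// exprn_gt0// pi_gt0.
  pose a := Num.min (Num.min t 1) (d / C).
  have a0 : 0 < a by rewrite !lt_min t0 ltr01 divr_gt0.
  have at_ : a <= t by rewrite !ge_min lexx.
  have a1 : a <= 1 by rewrite !ge_min lexx orbT.
  have ad : a <= d / C by rewrite !ge_min lexx orbT.
  have Fa := le_of_derive_ge0 dF dF0 a0 at_.
  apply: le_trans (lerD (lexx d) Fa).
  have : S x (regV e x) 3 a <= S x (fun=> 1 + e^-1) 3 a.
    apply: le_tmoment => //; [exact: measurable_sqd|exact: sqd_ge0|].
    move=> y _; rewrite /regV ler_pdivrMr ?regV_den//.
    set s := sqd x y.
    have -> : (1 + e^-1) * (s ^+ 2 + e) = s ^+ 2 + e + s ^+ 2 / e + 1 by field; rewrite gt_eqF.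
    have : 0 <= s ^+ 2 / e by rewrite divr_ge0 ?sqr_ge0// ltW.
    by move=> ?; nra.
  rewrite (Sc _ _ (ltW a0)) => Sa.
  have : a^-1 ^+ 3 * S x (regV e x) 3 a <= C * a.
    rewrite exprVn mulrC ler_pdivrMr ?exprn_gt0//; apply: (le_trans Sa).
    have -> : (1 + e^-1) * (pi ^+ 2 / 20 * a ^+ 5) = C * a * a ^+ 3 * a by rewrite /C; ring.
    by rewrite ler_piMr//; apply: mulr_ge0; [apply: mulr_ge0|apply: exprn_ge0]; exact: ltW. 
  have : C * a <= d by rewrite mulrC -ler_pdivlMr.
  have : 0 <= pi ^+ 2 / 4 * a by rewrite mulr_ge0 ?divr_ge0 ?exprn_ge0 ?pi_ge0// ltW.
  rewrite /F; lra.
move: F0; rewrite /F subr_ge0 exprVn mulrC ler_pdivrMr ?exprn_gt0//.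
by rewrite [t ^+ 4]exprS mulrA.
Qed.

Lemma regV_le e d x y : 0 < d -> d <= e -> regV e x y <= regV d x y.
Proof.
move=> d0 de; rewrite /regV ler_wpM2l ?sqd_ge0// lef_pV2 ?posrE ?regV_den ?lerD2l//.
exact: lt_le_trans de.
Qed.

Lemma cvg_regV x y : regV n.+1%:R^-1 x y @[n --> \oo] --> (sqd x y)^-1.
Proof.
have [s0|s0] := eqVneq (sqd x y) 0.
  rewrite (_ : (fun _ => _) = cst 0); last by apply/funext => n; rewrite /regV s0 mul0r.
  by rewrite s0 invr0; exact: cvg_cst.
have -> : (sqd x y)^-1 = sqd x y / (sqd x y ^+ 2 + 0).
  by rewrite addr0 expr2 invfM mulrA divff// mul1r.
apply: cvgMr; apply: cvgV; first by rewrite addr0 expf_neq0.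
by apply: cvgD; [exact: cvg_cst|exact: cvg_harmonic].
Qed.

Lemma integrable_inv_sqd_loc x t : 0 < t ->
  intg (fun y => (sqd x y)^-1 * ppow 3 (t - sqd x y)).
Proof.
move=> t0.
have n0 n : 0 < n.+1%:R^-1 :> R by rewrite invr_gt0.
apply: (@integrable_nondecreasing_cvg _ _ _ (@leb4 R)
  (fun n y => regV n.+1%:R^-1 x y * ppow 3 (t - sqd x y)) _ (pi ^+ 2 / 4 * t ^+ 4)).
- move=> n; apply: (loc_integrable_ppow (measurable_sqd x) (sqd_ge0 x)).
  by apply: continuous_loc_integrable; exact: continuous_regV.
- by move=> n y; rewrite mulr_ge0 ?ppow_ge0// regV_ge0// ltW.
- move=> y m n mn; rewrite ler_wpM2r ?ppow_ge0// regV_le//.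
  by rewrite lef_pV2 ?posrE// ler_nat ltnS.
- by move=> y; apply: cvgMl; exact: cvg_regV.
- by move=> n; exact: S_regV_le.
Qed.

(** Where [s >= 1] the quotient is dominated by [|f|]; where [s < 1], [f] is bounded on a box and
    [(2 - s)_+^3 >= 1], so the local integrability of [1 / s] applies. *)
Lemma integrable_div_sqd f x : continuous f -> intg f ->
  intg (fun y => f y / sqd x y).
Proof.
move=> cf If; have [A HA] := trunc_bsupp x 2.
have [C C0 fC] := continuous_bounded_box4 A cf.
have mV : measurable_fun setT ((fun y => (sqd x y)^-1) : measurableTypeR R *
    measurableTypeR R * measurableTypeR R * measurableTypeR R -> R).
  apply: (measurable_fun_cvg (h := fun n => regV n.+1%:R^-1 x)).
    by move=> n; apply: continuous_measurable_R4; apply: continuous_regV; rewrite invr_gt0.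
  by move=> y _; exact: cvg_regV.
apply: (@integrable_dom _ _ _ (@leb4 R) _
  (fun y => `|f y| + C * ((sqd x y)^-1 * ppow 3 (2 - sqd x y)))).
- by apply: measurable_funM => //; exact: continuous_measurable_R4.
- apply: integrable_addr; first exact: integrable_normr.
  by apply: integrable_scale; exact: integrable_inv_sqd_loc.
- move=> y; rewrite normrM normfV (ger0_norm (sqd_ge0 x y)).
  have V0 : 0 <= (sqd x y)^-1 by rewrite invr_ge0 sqd_ge0.
  have [s1|s1] := leP 1 (sqd x y).
    rewrite -[leLHS]addr0 lerD//; last by apply: mulr_ge0 => //; apply: mulr_ge0 => //; exact: ppow_ge0.
    by rewrite ler_piMr// invf_le1// (lt_le_trans _ s1).
  rewrite -[leLHS]add0r lerD// mulrCA [leLHS]mulrC ler_wpM2l//.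
  have By : box4 A y.
    apply: contrapT => /(HA 0%N); rewrite /trunc ppow_ge ?subr_ge0; last lra.
    by rewrite expr1; lra.
  apply: (le_trans (fC y By)); rewrite ler_peMr// ppow_ge ?subr_ge0; last lra.
  by rewrite exprn_ege1//; lra.
Qed.
End newton_integrability.

(** * Growth of the means of [|u|] *)

Section growth.
Context {R : realType}.
Implicit Types (x y : R4 R) (g h f : R4 R -> R) (i j : 'I_4) (k n : nat) (t : R).

Local Notation I := (Rintegral (@leb4 R) setT).
Local Notation intg g := ((@leb4 R).-integrable setT (EFin \o g)).
Local Notation S x := (tmoment (@leb4 R) (sqd x)).
Local Notation loc x := (loc_integrable (@leb4 R) (sqd x)).

(** Since [|u| <= 2 G - u] with [G] integrable, a lower bound on the moments of [u] suffices. The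
    mean [H] of [u] has derivative [N / 12], where [N] is a mean of [Lap u], and [N'] is at least
    [- M / t^2] because [f] is integrable. So [N] is bounded below on [t >= 1], and [H] decreases at
    most linearly in [t]. *)
Lemma S_abs_growth (u G : R4 R -> R) x : C2 u -> C2 (Lap u) ->
  intg (Lap (Lap u)) -> intg G -> (forall y, 0 <= G y) -> (forall y, u y <= G y) ->
  exists2 C, 0 <= C & forall t, 2 <= t -> S x (fun y => `|u y|) 2 t <= C * t ^+ 5.
Proof.
move=> Cu CLu If IG G0 uG.
have ms := measurable_sqd x; have s0 := sqd_ge0 x.
have [cu _] := Cu; have Lu := continuous_loc_integrable x cu.
pose M := I (fun y => `|Lap (Lap u) y|).
have M0 : 0 <= M by exact: Rintegral_ge0.
have ME : I (fun y => `|Lap (Lap u) y|) = M by []; clearbody M.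
pose N t := t^-1 ^+ 5 * S x (Lap u) 3 t.
have N_ge t : 1 <= t -> N 1 - M <= N t.
  (* The added term has derivative [M / t^2], which absorbs the lower bound on [N']. *)
  move=> t1; pose F t := N t - M * t^-1 ^+ 1.
  have dF (r : R) : 0 < r -> is_derive r 1 F
      ((4 * 4%:R)^-1 * (r^-1 ^+ 6 * S x (Lap (Lap u)) 4 r) - M * (- 1%:R * r^-1 ^+ 2)).
    move=> r0; exact: (is_derive_sub (is_derive_scaled_S_Lap x 1 CLu r0)
       (is_derive_scal M (is_derive_powV 1 (lt0r_neq0 r0)))).
  have F'0 (r : R) : 0 < r ->
      0 <= (4 * 4%:R)^-1 * (r^-1 ^+ 6 * S x (Lap (Lap u)) 4 r) - M * (- 1%:R * r^-1 ^+ 2).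
    move=> r0; have /= := norm_tmoment_le ms s0 3 If (ltW r0).
    rewrite ME ler_norml => /andP[h _].
    have -> : (4 * 4%:R)^-1 * (r^-1 ^+ 6 * S x (Lap (Lap u)) 4 r) - M * (- 1%:R * r^-1 ^+ 2) =
       r^-1 ^+ 6 * (S x (Lap (Lap u)) 4 r / 16 + M * r ^+ 4).
      by field; rewrite gt_eqF.
    rewrite mulr_ge0// ?exprn_ge0 ?invr_ge0 ?(ltW r0)//.
    have rM : 0 <= M * r ^+ 4 by rewrite mulr_ge0// exprn_ge0// ltW.
    have aux (a b : R) : - b <= a -> 0 <= b -> 0 <= a / 16 + b by clear; lra.
    by apply: aux => //; rewrite mulrC.
  have := le_of_derive_ge0 dF F'0 ltr01 t1; rewrite /F invr1 expr1n mulr1 => h.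
  apply: (le_trans h); rewrite gerBl mulr_ge0// exprn_ge0// invr_ge0.
  exact: le_trans t1.
pose c := `|N 1 - M| / 12; have c0 : 0 <= c by rewrite divr_ge0.
pose H t := t^-1 ^+ 4 * S x u 2 t.
pose F t := H t + c * t.
have dF (r : R) : 1 < r -> is_derive r 1 F ((4 * 3%:R)^-1 * N r + c * 1).
  move=> r1; exact: (is_derive_add (is_derive_scaled_S_Lap x 0 Cu (lt_trans ltr01 r1))
    (is_derive_scal c (is_derive_id r 1))).
have F'0 (r : R) : 1 < r -> 0 <= (4 * 3%:R)^-1 * N r + c * 1.
  move=> /ltW/N_ge h; rewrite mulr1 /c.
  have := ler_norm (- (N 1 - M)); rewrite normrN.
  move: (N r) (N 1 - M) h => a b; move: (`|b|) => d; clear; lra.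
have Hge t : 2 <= t -> F 2 <= F t.
  by move=> t2; apply: le_of_derive_ge0 dF F'0 _ t2; lra.
pose D := `|F 2| + c.
have D0 : 0 <= D by rewrite addr_ge0.
have Su t : 2 <= t -> - D * t ^+ 5 <= S x u 2 t.
  move=> t2; have := Hge t t2; rewrite {2}/F /H exprVn => h.
  have t0 : 0 < t by lra.
  have : - D * t <= (t ^+ 4)^-1 * S x u 2 t.
    have := ler_norm (- F 2); rewrite normrN /D => h1.
    have h2 := normr_ge0 (F 2).
    move: h h1 h2 t2; move: (_^-1 * _) (F 2) => a b; move: (`|b|) => d; clear; nra.
  rewrite [_^-1 * _]mulrC ler_pdivlMr ?exprn_gt0//.
  by rewrite -mulrA -exprS.
pose K := I (fun y => `|G y|).
have K0 : 0 <= K by exact: Rintegral_ge0.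
have KE : I (fun y => `|G y|) = K by []; clearbody K.
exists (2 * K + D); first by rewrite addr_ge0// mulr_ge0.
move=> t t2; have t0 : 0 < t by lra.
have LG : loc x G := integrable_loc ms s0 IG.
have LGu : loc x (fun y => 2 * G y + -1 * u y).
  have [mu _] := Lu; have [mG _] := LG; split.
    apply: measurable_funD; first by apply: measurable_funM.
    by apply: measurable_funM.
  move=> r; have := integrable_addr (integrable_scale 2 (LG.2 r)) (integrable_scale (-1) (Lu.2 r)).
  by under eq_fun do rewrite !mulrA -mulrDl.
have : S x (fun y => `|u y|) 2 t <= S x (fun y => 2 * G y + -1 * u y) 2 t.
  apply: le_tmoment => //; first exact: loc_integrable_normr.
  move=> y _; have := G0 y; have := uG y.
  by move: (G y) (u y) => a b; clear; case: (ger0P b); lra.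
rewrite (tmoment_lin ms s0)//.
have /= := norm_tmoment_le ms s0 1 IG (ltW t0); rewrite KE ler_norml => /andP[_ h1] h2.
have h3 : t ^+ 2 * K <= t ^+ 5 * K.
  rewrite ler_wpM2r// ler_weXn2l//; lra.
have := Su t t2; move: h1 h2 h3.
move: (t ^+ 5) (t ^+ 2 * K) (S x G 2 t) (S x u 2 t) (S x _ 2 t) => a b d e g; clear; lra.
Qed.
End growth.

(** * Newtonian identity for [Lap u] at finite scale *)

Section laplacian_representation.
Context {R : realType}.
Implicit Types (x y : R4 R) (g h f : R4 R -> R) (i j : 'I_4) (k n : nat) (t : R).

Local Notation I := (Rintegral (@leb4 R) setT).
Local Notation intg g := ((@leb4 R).-integrable setT (EFin \o g)).
Local Notation S x := (tmoment (@leb4 R) (sqd x)).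
Local Notation loc x := (loc_integrable (@leb4 R) (sqd x)).

Lemma leb4_set1 x : (@leb4 R) [set x] = 0%E.
Proof.
have -> : [set x] = (([set x.1.1.1] `*` [set x.1.1.2]) `*` [set x.1.2]) `*` [set x.2].
  case: x => -[[a b] c] e; apply/seteqP; split => [_ -> //|[[[a' b'] c'] e']].
  by move=> [[[/= -> ->] ->] ->].
rewrite /leb4 product_measure1E//; last first.
  by do 2 (apply: measurableX; last exact: measurable_set1); exact: measurable_set1.
by rewrite [X in (_ * X)%E]lebesgue_measure_set1 mule0.
Qed.

Lemma sqd_eq0 x y : sqd x y = 0 -> y = x.
Proof.
move=> /eqP; rewrite psumr_eq0; last by move=> i _; exact: sqr_ge0.
move=> /allP H; have E i : coord4 x i = coord4 y i.
  by apply/eqP; rewrite -subr_eq0 -sqrf_eq0; apply: H; rewrite mem_index_enum.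
have := (E (inord 0), E (inord 1), E (inord 2), E (inord 3)).
case: x y {H E} => -[[a b] c] e [[[a' b'] c'] e'].
by rewrite /coord4/= !inordK//= => -[[[-> ->] ->] ->].
Qed.

(** The default values of the inverse and of [ln] at 0 occur only at [y = x]; this absorbs them into
    a null set. *)
Lemma ae_sqd_neq0 x : {ae (@leb4 R : {measure set _ -> \bar R}), forall y, sqd x y != 0}.
Proof.
exists [set x]; split; last 2 first.
- exact: leb4_set1.
- by move=> y /= /negP; rewrite negbK => /eqP/sqd_eq0.
have -> : [set x] = (([set x.1.1.1] `*` [set x.1.1.2]) `*` [set x.1.2]) `*` [set x.2].
  case: x => -[[a b] c] e; apply/seteqP; split => [_ -> //|[[[a' b'] c'] e']].
  by move=> [[[/= -> ->] ->] ->].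
by do 3 (apply: measurableX; last exact: measurable_set1); exact: measurable_set1.
Qed.

Global Instance ae_leb4_filter : Filter (almost_everywhere (@leb4 R)).
Proof. exact: (ae_filter_ringOfSetsType (@leb4 R : {measure set _ -> \bar R})). Qed.

Lemma ae_eq_Rintegral g h : measurable_fun setT (g : measurableTypeR R *
    measurableTypeR R * measurableTypeR R * measurableTypeR R -> R) ->
  measurable_fun setT (h : measurableTypeR R *
    measurableTypeR R * measurableTypeR R * measurableTypeR R -> R) ->
  {ae (@leb4 R : {measure set _ -> \bar R}), forall y, g y = h y} -> I g = I h.
Proof.
move=> mg mh gh; congr fine; apply: ae_eq_integral => //; try exact/measurable_EFinP.
by apply: filterS gh => y -> _.
Qed.

(** The integrands can differ only at [y = x], where the left one is 0. *)
Lemma S_div_mul x f k t : continuous f -> intg f ->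
  S x (fun y => f y / sqd x y * sqd x y) k.+1 t = S x f k.+1 t.
Proof.
move=> cf If; have Iv := integrable_div_sqd x cf If.
have mp : measurable_fun setT ((fun y => ppow k.+1 (t - sqd x y)) : measurableTypeR R *
    measurableTypeR R * measurableTypeR R * measurableTypeR R -> R).
  by apply: continuous_measurable_R4; exact: continuous_trunc.
apply: ae_eq_Rintegral.
- apply: measurable_funM => //; apply: measurable_funM; last exact: measurable_sqd.
  exact: integrable_measurable_fun Iv.
- by apply: measurable_funM => //; exact: continuous_measurable_R4.
- by apply: filterS (ae_sqd_neq0 x) => y s0; rewrite divfK.
Qed.

Lemma cvg_sqr_inv : (n.+1%:R ^+ 2)^-1 @[n --> \oo] --> (0 : R).
Proof.
rewrite -(mulr0 0); rewrite (_ : (fun _ => _) = (fun n => harmonic n * harmonic n)).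
  by apply: cvgM; exact: cvg_harmonic.
by apply/funext => n; rewrite /= expr2 invfM.
Qed.

Lemma scaled_tmomentE x h k t : 0 < t -> loc x h ->
  t^-1 ^+ k.+1 * S x h k.+1 t = I (fun y => h y * ppow k.+1 (1 - sqd x y / t)).
Proof.
move=> t0 Lh; rewrite -RintegralZl//; last first.
  exact: (loc_integrable_ppow (measurable_sqd x) (sqd_ge0 x) _ _ Lh).
apply: eq_Rintegral => y _; rewrite mulrCA -ppowM ?invr_ge0 ?(ltW t0)//.
by congr (_ * ppow _ _); rewrite mulrBr mulVf ?gt_eqF// mulrC.
Qed.

(** Dominated convergence, the cut-off tending to 1. The scale runs through squares so that the
    radius [sqrt t] is the integer [n + 1]. *)
Lemma cvg_scaled_tmoment_infty x h k : intg h ->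
  (fun t => t^-1 ^+ k.+1 * S x h k.+1 t) (n.+1%:R ^+ 2) @[n --> \oo] --> I h.
Proof.
move=> Ih; have mh := integrable_measurable_fun Ih.
have T0 n : 0 < n.+1%:R ^+ 2 :> R by rewrite exprn_gt0.
have Lh : loc x h := integrable_loc (measurable_sqd x) (sqd_ge0 x) Ih.
under eq_fun do rewrite scaled_tmomentE//.
have [|||n y|_] := @Rintegral_dctW _ _ _ (@leb4 R)
    (fun n y => h y * ppow k.+1 (1 - sqd x y / n.+1%:R ^+ 2)) h (fun y => `|h y|).
- move=> n; apply: measurable_funM => //; apply: continuous_measurable_R4 => y.
  apply: (@continuous_comp _ _ _ (fun y => 1 - sqd x y / n.+1%:R ^+ 2) (ppow k.+1)).
    by apply: cvgB; [exact: cvg_cst|apply: cvgMl; exact: continuous_sqd].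
  exact: continuous_ppow.
- exact: integrable_normr.
- move=> y; rewrite -[X in _ --> X]mulr1; apply: cvgMr.
  rewrite [X in _ --> X](_ : 1 = ppow k.+1 (1 - sqd x y * 0)); last first.
    by rewrite mulr0 subr0 ppow_ge// expr1n.
  apply: (continuous_cvg _ (@continuous_ppow R k.+1 _)).
  by apply: cvgB; [exact: cvg_cst|apply: cvgMr; exact: cvg_sqr_inv].
- rewrite normrM ler_piMr// ger0_norm ?ppow_ge0// ppow_le1// gerBl.
  by rewrite divr_ge0 ?sqd_ge0// ltW.
- exact.
Qed.

Lemma cvg_scaled_tmoment_zero x f k : continuous f -> intg f ->
  (fun t => t^-1 ^+ k.+1 * S x (fun y => f y / sqd x y) k.+1 t) n.+1%:R^-1
    @[n --> \oo] --> 0.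
Proof.
move=> cf If; have Ih := integrable_div_sqd x cf If.
have mh := integrable_measurable_fun Ih.
have T0 n : 0 < n.+1%:R^-1 :> R by rewrite invr_gt0.
have Lh := integrable_loc (measurable_sqd x) (sqd_ge0 x) Ih.
under eq_fun do rewrite scaled_tmomentE//.
have -> : 0 = I (cst 0) by rewrite Rintegral_cst// mul0r.
have [|||n y|_] := @Rintegral_dctW _ _ _ (@leb4 R)
    (fun n y => f y / sqd x y * ppow k.+1 (1 - sqd x y / n.+1%:R^-1)) (cst 0)
    (fun y => `|f y / sqd x y|).
- move=> n; apply: measurable_funM => //; apply: continuous_measurable_R4 => y.
  apply: (@continuous_comp _ _ _ (fun y => 1 - sqd x y / n.+1%:R^-1) (ppow k.+1)).
    by apply: cvgB; [exact: cvg_cst|apply: cvgMl; exact: continuous_sqd].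
  exact: continuous_ppow.
- exact: integrable_normr.
(* At [y = x] the integrand is 0 by the convention [0^-1 = 0]; elsewhere the shrinking cut-off
   eventually vanishes. *)
- move=> y; have [s0|s0] := eqVneq (sqd x y) 0.
    by under eq_fun do rewrite s0 invr0 mulr0 mul0r; exact: cvg_cst.
  have sp : 0 < sqd x y by rewrite lt_neqAle eq_sym s0 sqd_ge0.
  apply: cvg_near_cst; near=> n; rewrite ppow_le0 ?mulr0// subr_le0 invrK mulrC.
  rewrite -ler_pdivrMr// mul1r; apply: (@le_trans _ _ n%:R); last by rewrite ler_nat.
  by near: n; exact: nbhs_infty_ger.
- rewrite normrM ler_piMr// ger0_norm ?ppow_ge0// ppow_le1// gerBl.
  by rewrite divr_ge0 ?sqd_ge0// ltW.
- exact.
Unshelve. all: end_near. Qed.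

(** The derivatives of [t^-8 S_6[Lap u]] and [t^-8 S_8[f / s]] are [t^-9 S_7[f]] times 1/28 and 8,
    which gives the ratio 1/224; and [56 = 7 . 8] comes from the moment of 1. The Newtonian constant
    is the quotient of [1 / 224] by [pi^2 / 56], that is [1 / (4 pi^2)]. *)
Lemma scaled_S_Lap_repr u x t : C2 u -> C2 (Lap u) -> intg (Lap (Lap u)) -> 0 < t ->
  t^-1 ^+ 8 * S x (Lap u) 6 t =
  pi ^+ 2 / 56 * Lap u x +
  (224)^-1 * (t^-1 ^+ 8 * S x (fun y => Lap (Lap u) y / sqd x y) 8 t).
Proof.
move=> Cu CLu If t0; set f := Lap (Lap u) in If *.
have cf : continuous f.
  have [_ H] := CLu; apply: continuous_sum4 => i; by have [] := H i.
have Ih := integrable_div_sqd x cf If.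
have Lh := integrable_loc (measurable_sqd x) (sqd_ge0 x) Ih.
pose F t := t^-1 ^+ 8 * S x (Lap u) 6 t -
  (224)^-1 * (t^-1 ^+ 8 * S x (fun y => f y / sqd x y) 8 t).
have dF (r : R) : 0 < r -> is_derive r 1 F 0.
  move=> r0; apply: is_derive_eq (is_derive_sub (is_derive_scaled_S_Lap x 4 CLu r0)
    (is_derive_scal (224)^-1 (is_derive_scaled_S_mul 6 Lh r0))) _.
  rewrite S_div_mul// -/f; move: (S x f 7 r) => a.
  by field; rewrite gt_eqF.
have F0 : F n.+1%:R^-1 @[n --> \oo] --> pi ^+ 2 / 56 * Lap u x.
  rewrite -[X in _ --> X]subr0; apply: cvgB.
    have := @cvg_scaled_S0 R (Lap u) x 4 CLu.1.
    by rewrite (_ : 7%:R * 8%:R = 56 :> R); last ring.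
  rewrite -(mulr0 224^-1); apply: cvgMr; exact: cvg_scaled_tmoment_zero.
by have := constant_of_derive0 dF F0 t0; rewrite /F => <-; rewrite subrK.
Qed.
End laplacian_representation.

(** * Dependence of the far averages on the centre *)

Section ppow_taylor.
Context {R : realType}.
Implicit Types (w : R) (n : nat).

Lemma between_le1 (w0 w t : R) : w0 <= 1 -> w <= 1 ->
  Num.min w0 w <= t <= Num.max w0 w -> t <= 1.
Proof. by move=> w01 w1 /andP[_ /le_trans]; apply; rewrite ge_max w01. Qed.

Lemma ppow_lipschitz n (w0 w : R) : w0 <= 1 -> w <= 1 ->
  `|ppow n.+2 w - ppow n.+2 w0| <= n.+2%:R * `|w - w0|.
Proof.
move=> w01 w1; rewrite -[X in _ * X]expr1.
apply: (@derive_increment_bound _ _ (fun t => n.+2%:R * ppow n.+1 t)) => //.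
- by move=> t; exact: is_derive_ppow.
- move=> t /(between_le1 w01 w1) t1; rewrite expr0 mulr1.
  by rewrite ger0_norm ?mulr_ge0 ?ppow_ge0// ler_piMr// ppow_le1.
Qed.

Lemma ppow_taylor1 n (w0 w : R) : w0 <= 1 -> w <= 1 ->
  `|ppow n.+3 w - ppow n.+3 w0 - n.+3%:R * ppow n.+2 w0 * (w - w0)|
    <= n.+3%:R * n.+2%:R * `|w - w0| ^+ 2.
Proof.
move=> w01 w1.
pose F t := ppow n.+3 t - n.+3%:R * ppow n.+2 w0 * t.
have -> : ppow n.+3 w - ppow n.+3 w0 - n.+3%:R * ppow n.+2 w0 * (w - w0) = F w - F w0.
  by rewrite /F; ring.
apply: (@derive_increment_bound _ _ (fun t => n.+3%:R * ppow n.+2 t - n.+3%:R * ppow n.+2 w0 * 1)).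
- move=> t; exact: (is_derive_sub (is_derive_ppow n.+1 t) (is_derive_scal _ (is_derive_id t 1))).
- move=> t /(between_le1 w01 w1) t1; rewrite mulr1 -mulrBr normrM ger0_norm// expr1 -mulrA.
  by rewrite ler_wpM2l// ppow_lipschitz.
- by rewrite mulr_ge0.
Qed.

(** The derivative of the remainder is [n + 4] times the first order remainder one exponent lower,
    so [derive_increment_bound] raises the order by one. Points below 1 keep all powers of the
    positive part bounded by 1. *)
Lemma ppow_taylor2 n (w0 w : R) : w0 <= 1 -> w <= 1 ->
  `|ppow n.+4 w - ppow n.+4 w0 - (n.+4%:R * ppow n.+3 w0 * (w - w0)
     + n.+4%:R * n.+3%:R / 2 * ppow n.+2 w0 * (w - w0) ^+ 2)|
    <= n.+4%:R * (n.+3%:R * n.+2%:R) * `|w - w0| ^+ 3.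
Proof.
move=> w01 w1.
pose b := n.+4%:R * n.+3%:R / 2 * ppow n.+2 w0.
pose F (t : R) := ppow n.+4 t - (n.+4%:R * ppow n.+3 w0 * t + b * ((t - w0) * (t - w0))).
rewrite [X in `|X|](_ : _ = F w - F w0); last by rewrite /F /b; ring.
have dF (t : R) : is_derive t 1 F (n.+4%:R * (ppow n.+3 t - ppow n.+3 w0 - n.+3%:R * ppow n.+2 w0 * (t - w0))).
  have h := is_derive_sub (is_derive_id t 1) (is_derive_cst w0 t 1).
  apply: is_derive_eq (is_derive_sub (is_derive_ppow n.+2 t)
    (is_derive_add (is_derive_scal (n.+4%:R * ppow n.+3 w0) (is_derive_id t 1))
      (is_derive_scal b (is_derive_mul h h)))) _.
  by rewrite /b /cst/=; field.
apply: (derive_increment_bound dF); last by rewrite !mulr_ge0.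
move=> t /(between_le1 w01 w1) t1; rewrite normrM ger0_norm// -[leRHS]mulrA.
by rewrite ler_wpM2l// ppow_taylor1.
Qed.
End ppow_taylor.

Section far_field.
Context {R : realType}.
Implicit Types (x y : R4 R) (g h f u : R4 R -> R) (i j : 'I_4) (k n : nat) (t : R).

Local Notation I := (Rintegral (@leb4 R) setT).
Local Notation intg g := ((@leb4 R).-integrable setT (EFin \o g)).
Local Notation S x := (tmoment (@leb4 R) (sqd x)).

Definition dot4 x y : R := \sum_(i < 4) coord4 x i * coord4 y i.

Lemma coord4_0 i : coord4 (0 : R4 R) i = 0.
Proof. by case: i => [[|[|[|[|//]]]] Hi]. Qed.

Lemma sqd_dot x y : sqd x y = sqd 0 x - 2 * dot4 x y + sqd 0 y.
Proof. by rewrite /sqd /dot4 !sum_coord4 !coord4_0; ring. Qed.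

(** Expand the nonnegative sum of squares of [r x_i - e y_i], divided by [r], for both signs [e].
    The free parameter [r] yields all comparisons between [|x - y|^2] and [|y|^2] below. *)
Lemma dot4_le x y r : 0 < r -> 2 * `|dot4 x y| <= r * sqd 0 x + sqd 0 y / r.
Proof.
move=> r0; have H (e : R) : e ^+ 2 = 1 -> 2 * (e * dot4 x y) <= r * sqd 0 x + sqd 0 y / r.
  move=> e1; rewrite -subr_ge0.
  have -> : r * sqd 0 x + sqd 0 y / r - 2 * (e * dot4 x y) =
     (\sum_(i < 4) (r * coord4 x i - e * coord4 y i) ^+ 2) / r.
    rewrite /sqd /dot4 !sum_coord4 !coord4_0.
    have H a b : (r * a - e * b) ^+ 2 = r * (r * a ^+ 2 - 2 * (e * a * b)) + b ^+ 2.
      transitivity (r * (r * a ^+ 2 - 2 * (e * a * b)) + e ^+ 2 * b ^+ 2); first by ring.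
      by rewrite e1 mul1r.
    rewrite !H.
    by field; rewrite gt_eqF.
  by rewrite divr_ge0 ?(ltW r0)// sumr_ge0// => i _; exact: sqr_ge0.
have := (H 1, H (-1)); rewrite !expr1n sqrrN expr1n => -[/(_ erefl) h1 /(_ erefl) h2].
by move: h1 h2; rewrite mul1r mulN1r; case: (ger0P (dot4 x y)).
Qed.

(** Here [r] stands for a squared radius: outside the ball of twice the radius, [y] is at least one
    radius away from [x]. *)
Lemma far_sqd x y r : sqd 0 x <= r -> 4 * r < sqd 0 y -> r <= sqd x y.
Proof.
move=> xr ry; have := @dot4_le x y 2 ltac:(lra); have := ler_norm (dot4 x y).
have := sqd_dot x y; move: (sqd x y) (sqd 0 x) (sqd 0 y) xr ry (dot4 x y) (`|dot4 x y|).
by clear => a b c h1 h2 e d -> h3 h4; lra.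
Qed.

Lemma near_sqd_diff x y r : 1 <= r -> sqd 0 y <= 4 * r ^+ 2 ->
  `|sqd x y - sqd 0 y| <= (2 * sqd 0 x + 4) * r.
Proof.
move=> r1 yr; have r0 : 0 < r by lra.
have h := @dot4_le x y r r0.
have h2 : sqd 0 y / r <= 4 * r by rewrite ler_pdivrMr// -mulrA -expr2.
rewrite sqd_dot addrK.
apply: (le_trans (ler_normB _ _)); rewrite normrM (ger0_norm (sqd_ge0 _ _)) ger0_norm//.
have := sqd_ge0 0 x; move: (`|dot4 _ _|) (sqd 0 x) (sqd 0 y / r) h h2.
move: r1; clear => r1 a b c h h2 b0.
have : b <= b * r by rewrite ler_peMr.
by move: h; rewrite [r * b]mulrC; lra.
Qed.

(** Weight and volume contribute [t^2] each, so the mean of [|u|] may grow like [t], the square of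
    the radius. *)
Definition volume_growth u (C : R) := forall t, 2 <= t -> S 0 (fun y => `|u y|) 2 t <= C * t ^+ 5.

(** On the ball of radius [2 r] the weight [(8 r^2 - s)_+^2] is at least [16 r^4], so the integral
    is at most [e / (16 r^4)] times the second moment of [|u|] at scale [8 r^2]; 2048 is
    [8^5 / 16]. *)
Lemma far_error u C (E : R4 R -> R) r e : continuous u -> volume_growth u C ->
  measurable_fun setT (E : measurableTypeR R * measurableTypeR R * measurableTypeR R *
      measurableTypeR R -> R) ->
  1 <= r -> 0 <= e ->
  (forall y, sqd 0 y <= 4 * r ^+ 2 -> `|E y| <= e) ->
  (forall y, 4 * r ^+ 2 < sqd 0 y -> E y = 0) ->
  intg (fun y => u y * E y) /\
  `|r^-1 ^+ 4 * I (fun y => u y * E y)| <= 2048 * C * e * r ^+ 2.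
Proof.
move=> cu Cu mE r1 e0 En Ef; have r0 : 0 < r by lra.
have Lu := loc_integrable_normr (continuous_loc_integrable 0 cu).
have ID := integrable_scale (e * r^-1 ^+ 4 / 16)
  (loc_integrable_ppow (measurable_sqd 0) (sqd_ge0 0) 1 (8 * r ^+ 2) Lu).
have dom y : `|u y * E y| <= e * r^-1 ^+ 4 / 16 * (`|u y| * ppow 2 (8 * r ^+ 2 - sqd 0 y)).
  rewrite normrM mulrCA ler_wpM2l//.
  have [ys|ys] := leP (sqd 0 y) (4 * r ^+ 2); last first.
    by rewrite Ef// normr0 mulr_ge0 ?ppow_ge0// divr_ge0// mulr_ge0// exprn_ge0// invr_ge0 ltW.
  apply: (le_trans (En y ys)).
  have : (4 * r ^+ 2) ^+ 2 <= ppow 2 (8 * r ^+ 2 - sqd 0 y).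
    have h : 0 <= 4 * r ^+ 2 by rewrite mulr_ge0// sqr_ge0.
    rewrite -(ppow_ge 2 h) ppow_le//; move: ys; lra.
  move=> h; rewrite [leLHS](_ : e = e * r^-1 ^+ 4 / 16 * (4 * r ^+ 2) ^+ 2); last first.
    by field; rewrite gt_eqF.
  by rewrite ler_wpM2l// divr_ge0// mulr_ge0// exprn_ge0// invr_ge0 ltW.
have IE : intg (fun y => u y * E y).
  apply: integrable_dom ID dom; apply: measurable_funM => //.
  exact: continuous_measurable_R4.
split=> //; rewrite normrM ger0_norm ?exprn_ge0 ?invr_ge0 ?(ltW r0)//.
have := norm_Rintegral_le IE ID dom.
rewrite RintegralZl//; last exact: (loc_integrable_ppow (measurable_sqd 0) (sqd_ge0 0) 1).
have r2 : 1 <= r ^+ 2 by rewrite exprn_ege1.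
have := Cu (8 * r ^+ 2) ltac:(lra); rewrite /tmoment.
move: (I _) (`|I _|) => a b ha hb.
apply: (@le_trans _ _ (r^-1 ^+ 4 * (e * r^-1 ^+ 4 / 16 * (C * (8 * r ^+ 2) ^+ 5)))).
  rewrite ler_wpM2l ?exprn_ge0 ?invr_ge0 ?(ltW r0)//; apply: (le_trans hb).
  by rewrite ler_wpM2l// divr_ge0// mulr_ge0// exprn_ge0// invr_ge0 ltW.
by rewrite le_eqVlt; apply/orP; left; apply/eqP; field; rewrite gt_eqF.
Qed.
End far_field.

(** * Expansion of the averages of [u] in the centre *)

Section moment_expansion.
Context {R : realType}.
Implicit Types (x y : R4 R) (g h f u : R4 R -> R) (i j : 'I_4) (k n : nat) (t r : R).

Local Notation I := (Rintegral (@leb4 R) setT).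
Local Notation intg g := ((@leb4 R).-integrable setT (EFin \o g)).
Local Notation pw k r x y := (ppow k (1 - sqd x y / r ^+ 2)).

Lemma continuous_pw k r x : continuous (fun y => pw k r x y).
Proof.
move=> y; apply: (@continuous_comp _ _ _ (fun y => 1 - sqd x y / r ^+ 2) (ppow k)).
  by apply: cvgB; [exact: cvg_cst|apply: cvgMl; exact: continuous_sqd].
exact: continuous_ppow.
Qed.

Lemma integrable_pw k r x g : 0 < r -> continuous g -> intg (fun y => g y * pw k.+1 r x y).
Proof.
move=> r0 cg; have [A HA] := trunc_bsupp x (r ^+ 2).
apply: (@integrable_continuous_bsupp _ _ A).
  by apply: continuous_mul => //; exact: continuous_pw.
move=> y /(HA 0%N); rewrite /trunc => h.
rewrite ppow_le0 ?mulr0// subr_le0 ler_pdivlMr ?exprn_gt0// mul1r -subr_le0 leNgt.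
by apply/negP => h2; move: h; rewrite ppow_ge ?ltW// expr1 => h3; rewrite h3 ltxx in h2.
Qed.

Lemma pw_far k r x y : 0 < r -> sqd 0 x <= r ^+ 2 -> 4 * r ^+ 2 < sqd 0 y ->
  pw k.+1 r x y = 0.
Proof.
move=> r0 xr yr; apply: ppow_le0; rewrite subr_le0 ler_pdivlMr ?exprn_gt0// mul1r.
exact: far_sqd yr.
Qed.

Lemma pw_arg_le1 r x y : 1 - sqd x y / r ^+ 2 <= 1.
Proof. by rewrite gerBl divr_ge0 ?sqd_ge0// sqr_ge0. Qed.

Lemma pw_arg_diff r x y : 1 <= r -> sqd 0 y <= 4 * r ^+ 2 ->
  `|(1 - sqd x y / r ^+ 2) - (1 - sqd 0 y / r ^+ 2)| <= (2 * sqd 0 x + 4) / r.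
Proof.
move=> r1 yr; have r0 : 0 < r by lra.
have -> : (1 - sqd x y / r ^+ 2) - (1 - sqd 0 y / r ^+ 2) = - (sqd x y - sqd 0 y) / r ^+ 2.
  by rewrite mulNr mulrBl; ring.
rewrite normrM normrN normfV [`|r ^+ 2|]ger0_norm ?sqr_ge0// ler_pdivrMr ?exprn_gt0//.
by rewrite expr2 mulrA divfK ?gt_eqF//; exact: near_sqd_diff.
Qed.

Lemma sqd00 : sqd 0 (0 : R4 R) = 0 :> R.
Proof. by rewrite /sqd big1// => i _; rewrite subrr expr0n. Qed.

(** The cut-offs centred at [x] and 0 differ by O(1/r) on the ball of radius [2 r] and vanish beyond
    it, so the bound is O(r). The prefactor [r^-6] of the averages giving [Lap u] improves it to
    O(1/r). *)
Lemma scaled_S_diff u C n r x : continuous u -> volume_growth u C ->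
  1 <= r -> sqd 0 x <= r ^+ 2 ->
  `|r^-1 ^+ 4 * (I (fun y => u y * pw n.+2 r x y) - I (fun y => u y * pw n.+2 r 0 y))| <=
    2048 * C * (n.+2%:R * ((2 * sqd 0 x + 4) / r)) * r ^+ 2.
Proof.
move=> cu Cu r1 xr; have r0 : 0 < r by lra.
have X0 := sqd_ge0 0 x.
rewrite -RintegralB//; [|exact: integrable_pw..].
have E0 : 0 <= n.+2%:R * ((2 * sqd 0 x + 4) / r).
  by rewrite mulr_ge0// divr_ge0 ?(ltW r0)// addr_ge0// mulr_ge0.
have [|y yr|y yr|_ h] := @far_error R u C (fun y => pw n.+2 r x y - pw n.+2 r 0 y) r _ cu Cu _ r1 E0.
- apply: continuous_measurable_R4; apply: continuous_sub; exact: continuous_pw.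
- apply: (le_trans (ppow_lipschitz _ (pw_arg_le1 _ _ _) (pw_arg_le1 _ _ _))).
  by rewrite ler_wpM2l// pw_arg_diff.
- have z : sqd (0 : R4 R) 0 <= r ^+ 2 by rewrite sqd00 exprn_ge0// ltW.
  by rewrite (pw_far _ r0 xr yr) (pw_far _ r0 z yr) subrr.
- by apply: le_trans h; under eq_Rintegral do rewrite -mulrBr.
Qed.

Definition quad4 (b : 'I_4 -> R) (a : 'I_4 -> 'I_4 -> R) x : R :=
  \sum_(i < 4) b i * coord4 x i + \sum_(i < 4) \sum_(j < 4) a i j * coord4 x i * coord4 x j.

Lemma continuous_dot4 x : continuous (dot4 x).
Proof.
apply: continuous_sum4 => i; apply: continuous_mul; first exact: cst_continuous.
exact: continuous_coord4.
Qed.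

Lemma Rintegral_quad n k r c d u : continuous u -> 0 < r ->
  exists b a, forall x,
  I (fun y => u y * (c * pw n.+1 r 0 y * (2 * dot4 x y - sqd 0 x)
     + d * pw k.+1 r 0 y * dot4 x y ^+ 2)) = quad4 b a x.
Proof.
move=> cu r0.
exists (fun i => 2 * c * I (fun y => u y * coord4 y i * pw n.+1 r 0 y)).
(* The Kronecker term represents [- c |x|^2]. *)
exists (fun i j => d * I (fun y => u y * coord4 y i * coord4 y j * pw k.+1 r 0 y)
   - (i == j)%:R * c * I (fun y => u y * pw n.+1 r 0 y)).
move=> x.
have I0 := integrable_pw n 0 r0 cu.
have cc := @continuous_coord4 R.
have I1 i : intg (fun y => u y * coord4 y i * pw n.+1 r 0 y).
  by apply: integrable_pw => //; exact: continuous_mul.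
have I2 i j : intg (fun y => u y * coord4 y i * coord4 y j * pw k.+1 r 0 y).
  by apply: integrable_pw => //; apply: continuous_mul => //; exact: continuous_mul.
have E y : u y * (c * pw n.+1 r 0 y * (2 * dot4 x y - sqd 0 x)
     + d * pw k.+1 r 0 y * dot4 x y ^+ 2) =
   \sum_(i < 4) 2 * c * coord4 x i * (u y * coord4 y i * pw n.+1 r 0 y) +
   (\sum_(i < 4) \sum_(j < 4) d * coord4 x i * coord4 x j *
        (u y * coord4 y i * coord4 y j * pw k.+1 r 0 y)
    - c * sqd 0 x * (u y * pw n.+1 r 0 y)).
  by rewrite /dot4 !sum_coord4; ring.
rewrite (funext E) RintegralD//; last 2 first.
- by apply: integrable_sum_ord => i; exact: integrable_scale.
- apply: integrable_subr; last exact: integrable_scale.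
  by apply: integrable_sum_ord => i; apply: integrable_sum_ord => j; exact: integrable_scale.
rewrite RintegralB//; last 2 first.
- by apply: integrable_sum_ord => i; apply: integrable_sum_ord => j; exact: integrable_scale.
- exact: integrable_scale.
rewrite !Rintegral_sum_ord; last 2 first.
- by move=> i; apply: integrable_sum_ord => j; exact: integrable_scale.
- by move=> i; exact: integrable_scale.
rewrite RintegralZl// /quad4; congr (_ + _).
  by apply: eq_bigr => i _; rewrite RintegralZl//; ring.
rewrite [in RHS](eq_bigr (fun i => \sum_(j < 4) (d * coord4 x i * coord4 x j *
    I (fun y => u y * coord4 y i * coord4 y j * pw k.+1 r 0 y))
    - c * coord4 x i ^+ 2 * I (fun y => u y * pw n.+1 r 0 y))); last first.
  move=> i _; rewrite [X in _ - X](_ : _ = \sum_(j < 4) (i == j)%:R * c * coord4 x i * coord4 x j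
     * I (fun y => u y * pw n.+1 r 0 y)); last first.
    rewrite (bigD1 i)//= big1 ?addr0; last first.
      by move=> j /negPf; rewrite eq_sym => ->; rewrite !mul0r.
    by rewrite eqxx mulr1n; ring.
  by rewrite -sumrB; apply: eq_bigr => j _; ring.
rewrite sumrB; congr (_ - _).
  apply: eq_bigr => i _; rewrite Rintegral_sum_ord; last by move=> j; exact: integrable_scale.
  by apply: eq_bigr => j _; rewrite RintegralZl.
rewrite -mulr_suml -mulr_sumr /sqd; congr (_ * _ * _).
by apply: eq_bigr => i _; rewrite coord4_0; ring.
Qed.

(** The coefficients depend on [r] but not on [x]. The error of the cut-off is O(r^-3), which the
    growth of [u] turns into O(1/r). *)
Lemma scaled_S_taylor u C n r : continuous u -> volume_growth u C -> 1 <= r ->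
  exists b a, forall x, sqd 0 x <= r ^+ 2 ->
  `|r^-1 ^+ 4 * (I (fun y => u y * pw n.+4 r x y) - I (fun y => u y * pw n.+4 r 0 y))
      - quad4 b a x| <=
    2048 * C * (n.+4%:R * (n.+3%:R * n.+2%:R) * (2 * sqd 0 x + 4) ^+ 3 +
      n.+4%:R * n.+3%:R / 2 * (3 * sqd 0 x ^+ 2 + 8 * sqd 0 x)) / r.
Proof.
move=> cu Cu r1; have r0 : 0 < r by lra.
(* The argument of the cut-off changes by [(2 x.y - |x|^2) / r^2]. Its first power is kept entirely;
   of its square only [4 (x.y)^2 / r^4] is kept, which produces the factor 2 in [d]. *)
pose c := n.+4%:R / r ^+ 2; pose d := 2 * n.+4%:R * n.+3%:R / r ^+ 4.
have [b0 [a0 Hq]] := Rintegral_quad n.+2 n.+1 c d cu r0.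
exists (fun i => r^-1 ^+ 4 * b0 i); exists (fun i j => r^-1 ^+ 4 * a0 i j) => x xr.
have X0 := sqd_ge0 0 x.
pose pol y := c * pw n.+3 r 0 y * (2 * dot4 x y - sqd 0 x) + d * pw n.+2 r 0 y * dot4 x y ^+ 2.
have -> : quad4 (fun i => r^-1 ^+ 4 * b0 i) (fun i j => r^-1 ^+ 4 * a0 i j) x =
    r^-1 ^+ 4 * I (fun y => u y * pol y).
  rewrite Hq /quad4 mulrDr !mulr_sumr; congr (_ + _).
    by apply: eq_bigr => i _; rewrite mulrA.
  by apply: eq_bigr => i _; rewrite mulr_sumr; apply: eq_bigr => j _; rewrite !mulrA.
have Ipol : intg (fun y => u y * pol y).
  have I1 : intg (fun y => c * (u y * (2 * dot4 x y - sqd 0 x) * pw n.+3 r 0 y)).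
    apply: integrable_scale; apply: integrable_pw => //; apply: continuous_mul => //.
    apply: continuous_sub; last exact: cst_continuous.
    by apply: continuous_mul; [exact: cst_continuous|exact: continuous_dot4].
  have I2 : intg (fun y => d * (u y * (dot4 x y * dot4 x y) * pw n.+2 r 0 y)).
    apply: integrable_scale; apply: integrable_pw => //; apply: continuous_mul => //.
    by apply: continuous_mul; exact: continuous_dot4.
  have := integrable_addr I1 I2.
  by rewrite (_ : (fun y => _ + _) = (fun y => u y * pol y))//; apply/funext => y; rewrite /pol; ring.
rewrite -mulrBr -RintegralB//; [|exact: integrable_pw..].
rewrite -RintegralB//; last by apply: integrable_subr => //; exact: integrable_pw.
pose D := n.+4%:R * (n.+3%:R * n.+2%:R) * (2 * sqd 0 x + 4) ^+ 3 +
      n.+4%:R * n.+3%:R / 2 * (3 * sqd 0 x ^+ 2 + 8 * sqd 0 x).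
have D0 : 0 <= D.
  have h : 0 <= 2 * sqd 0 x + 4 by rewrite addr_ge0// mulr_ge0.
  apply: addr_ge0; apply: mulr_ge0.
  - by rewrite !mulr_ge0.
  - exact: exprn_ge0.
  - by rewrite divr_ge0// mulr_ge0.
  - by rewrite addr_ge0 ?mulr_ge0 ?sqr_ge0.
pose E y := pw n.+4 r x y - pw n.+4 r 0 y - pol y.
have [||y yr|y yr|_ h] := @far_error R u C E r (D / r ^+ 3) cu Cu _ r1.
- apply: continuous_measurable_R4; apply: continuous_sub.
    by apply: continuous_sub; exact: continuous_pw.
  move=> y; apply: cvgD.
    apply: continuous_mul; last first.
      apply: continuous_sub; last exact: cst_continuous.
      by apply: continuous_mul; [exact: cst_continuous|exact: continuous_dot4].
    by apply: continuous_mul; [exact: cst_continuous|exact: continuous_pw].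
  apply: (@continuous_mul _ (fun y => d * pw n.+2 r 0 y) (fun y => dot4 x y ^+ 2)).
    by apply: continuous_mul; [exact: cst_continuous|exact: continuous_pw].
  by move=> z; apply: (@continuous_comp _ _ _ (dot4 x) (fun r => r ^+ 2));
    [exact: continuous_dot4|exact: exprn_continuous].
- by rewrite divr_ge0// exprn_ge0// ltW.
- have w1 := pw_arg_le1 r x y; have w01 := pw_arg_le1 r 0 y.
  have dw := pw_arg_diff x r1 yr.
  have dwE : (1 - sqd x y / r ^+ 2) - (1 - sqd 0 y / r ^+ 2) =
     (2 * dot4 x y - sqd 0 x) / r ^+ 2 by rewrite [sqd x y]sqd_dot; ring.
  have taylor := ppow_taylor2 n w01 w1.
  have pw1 : 0 <= pw n.+2 r 0 y <= 1 by rewrite ppow_ge0 ppow_le1.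
  have dot_le : 2 * `|dot4 x y| <= r * sqd 0 x + 4 * r.
    apply: le_trans (dot4_le x y r0) _; rewrite lerD2l ler_pdivrMr//.
    by rewrite -mulrA -expr2.
  (* The last term collects what was dropped from the square, of degree 3 and 4 in [x]; it is
     O(r^-3) as well, since [x.y] is O(r) on the ball. *)
  have EE : E y = (pw n.+4 r x y - pw n.+4 r 0 y - (n.+4%:R * pw n.+3 r 0 y *
        ((1 - sqd x y / r ^+ 2) - (1 - sqd 0 y / r ^+ 2))
     + n.+4%:R * n.+3%:R / 2 * pw n.+2 r 0 y *
        ((1 - sqd x y / r ^+ 2) - (1 - sqd 0 y / r ^+ 2)) ^+ 2)) +
     n.+4%:R * n.+3%:R / 2 * pw n.+2 r 0 y *
       ((sqd 0 x ^+ 2 - 4 * sqd 0 x * dot4 x y) / r ^+ 4).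
    rewrite /E /pol /c /d dwE; field; rewrite gt_eqF//.
  rewrite EE; apply: (le_trans (ler_normD _ _)); rewrite [D / _]mulrDl lerD//.
    apply: (le_trans taylor); rewrite -[leRHS]mulrA ler_wpM2l ?mulr_ge0//.
    rewrite -expr_div_n lerXn2r ?nnegrE// divr_ge0 ?(ltW r0)// addr_ge0// mulr_ge0//.
  rewrite -[leRHS]mulrA normrM [`|_ * pw _ _ _ _|]ger0_norm; last first.
    by rewrite mulr_ge0 ?ppow_ge0// divr_ge0// mulr_ge0.
  rewrite -[leLHS]mulrA ler_wpM2l ?divr_ge0 ?mulr_ge0//.
  apply: (@le_trans _ _ (`|(sqd 0 x ^+ 2 - 4 * sqd 0 x * dot4 x y) / r ^+ 4|)).
    by rewrite ler_piMl//; case/andP: pw1.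
  rewrite normrM normfV [`|r ^+ 4|]ger0_norm ?exprn_ge0 ?(ltW r0)//.
  rewrite ler_pdivrMr ?exprn_gt0// [r ^+ 4]exprSr mulrA divfK ?expf_neq0 ?gt_eqF//.
  apply: (le_trans (ler_normB _ _)).
  rewrite ger0_norm ?sqr_ge0// normrM [`|4 * _|]ger0_norm ?mulr_ge0//.
  move: dot_le X0 r1; move: (sqd 0 x) (`|dot4 x y|) => X e; clear => h X0 r1.
  have h1 := ler_wpM2l X0 h.
  have h2 : X ^+ 2 <= X ^+ 2 * r by rewrite ler_peMr ?sqr_ge0.
  by move: h1; rewrite -subr_ge0 => h1; nra.
- have z : sqd (0 : R4 R) 0 <= r ^+ 2 by rewrite sqd00 exprn_ge0// ltW.
  by rewrite /E /pol !(pw_far _ r0 z yr) (pw_far _ r0 xr yr) !(mulr0, mul0r) addr0 !subr0.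
have -> : (fun y => u y * pw n.+4 r x y - u y * pw n.+4 r 0 y - u y * pol y) =
    (fun y => u y * E y) by apply/funext => y; rewrite /E; ring.
apply: (le_trans h); rewrite le_eqVlt; apply/orP; left; apply/eqP. rewrite -/D.
by clearbody D; field; rewrite gt_eqF.
Qed.
End moment_expansion.

(** * Logarithmic potential *)

Section truncated_log.
Context {R : realType}.
Implicit Types (s t w : R) (n k : nat).

(** Taylor remainder of [- ln (1 - w)] at 0. *)
Definition log_rem n w : R := - ln (1 - w) - \sum_(k < n) w ^+ k.+1 / k.+1%:R.

Lemma is_derive_log_rem n w : w < 1 -> is_derive w 1 (log_rem n) (w ^+ n / (1 - w)).
Proof.
move=> w1; have w10 : 0 < 1 - w by rewrite subr_gt0.
elim: n => [|n IH].
  have -> : log_rem 0 = (fun w => - 1 * ln (1 - w)).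
    by apply/funext => z; rewrite /log_rem big_ord0 subr0 mulN1r.
  have h := is_derive_sub (is_derive_cst (1 : R) w 1) (is_derive_id w 1).
  have := is_derive_scal (-1) (@is_derive_chain R _ (@ln R) (fun w => 1 - w) w 1 _ _ (is_derive1_ln w10) h).
  move=> h1; apply: is_derive_eq h1 _; rewrite expr0 /cst/=; ring.
have -> : log_rem n.+1 = (fun w => log_rem n w - n.+1%:R^-1 * w ^+ n.+1).
  by apply/funext => z; rewrite /log_rem big_ord_recr/=; ring.
have h : is_derive w 1 (fun w => w ^+ n.+1) (n.+1%:R * w ^+ n).
  apply: DeriveDef; first exact: exprn_derivable.
  by rewrite exp_derive /GRing.scale/= mulr1.
apply: is_derive_eq (is_derive_sub IH (is_derive_scal _ h)) _.
by rewrite mulrA mulVf ?pnatr_eq0// exprS; field; rewrite gt_eqF.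
Qed.

(** For [n >= 1] and [s > 0] this is the integral of [(1 - s / a)_+^n / a] over [a] from 0 to [t],
    that is the positive part of [ln (t / s)] minus a polynomial in the cut-off. Its derivative in
    [t] is a scaled cut-off, so that integrating [f] against it gives a primitive of a scaled
    moment. *)
Definition trunc_log n t s : R := log_rem n (Num.max (1 - s / t) 0).

Lemma is_derive_trunc_log n t s : 0 < t -> 0 < s ->
  is_derive t 1 (fun t => trunc_log n.+1 t s) (t^-1 * ppow n.+1 (1 - s / t)).
Proof.
move=> t0 s0; have w1 : 1 - s / t < 1 by rewrite gtrBl divr_gt0.
have G := @is_derive_glue R (log_rem n.+1) (fun w => w ^+ n.+1 / (1 - w)) 1 (1 - s / t)
   ltr01 (fun w => @is_derive_log_rem n.+1 w).
have {}G := G _ _ w1.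
have h := is_derive_sub (is_derive_cst (1 : R) t 1)
   (is_derive_scal s (is_derive_powV 1 (lt0r_neq0 t0))).
have E : (fun t => trunc_log n.+1 t s) =
   (fun t => (fun w => log_rem n.+1 (Num.max w 0)) (1 - s * t^-1 ^+ 1)) by [].
rewrite E; apply: is_derive_eq (@is_derive_chain R _ _ (fun t => 1 - s * t^-1 ^+ 1) t 1 _ _ (G _ _) h) _.
- by rewrite /log_rem subr0 ln1 oppr0 big1 ?subr0// => i _; rewrite expr0n mul0r.
- by rewrite expr0n mul0r.
rewrite /cst/=.
have [w0|w0] := leP (1 - s / t) 0.
  by rewrite ppow_le0// expr0n/= !mul0r mulr0.
rewrite ppow_ge ?(ltW w0)//; set w := 1 - s / t; have -> : 1 - w = s / t by rewrite /w; ring.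
by clearbody w; field; rewrite !gt_eqF.
Qed.

Lemma trunc_log_ge n t s : 0 < t -> t <= s -> trunc_log n t s = 0.
Proof.
move=> t0 ts; rewrite /trunc_log max_r; last by rewrite subr_le0 ler_pdivlMr// mul1r.
by rewrite /log_rem subr0 ln1 oppr0 big1 ?subr0// => i _; rewrite expr0n mul0r.
Qed.

Lemma trunc_logE n t s : 0 < t -> 0 < s ->
  trunc_log n t s = Num.max (ln t - ln s) 0 - \sum_(k < n) ppow k.+1 (1 - s / t) / k.+1%:R.
Proof.
move=> t0 s0; have [ts|st] := leP t s.
  rewrite trunc_log_ge// max_r ?subr_le0 ?ler_ln ?posrE// big1 ?subr0// => i _.
  by rewrite ppow_le0 ?mul0r// subr_le0 ler_pdivlMr// mul1r.
have w0 : 0 <= 1 - s / t by rewrite subr_ge0 ler_pdivrMr// mul1r ltW.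
rewrite max_l ?subr_ge0 ?ler_ln ?posrE// ?(ltW st)// /trunc_log max_l//.
rewrite /log_rem (_ : 1 - (1 - s / t) = s / t); last ring.
rewrite ln_div ?posrE// opprB; congr (_ - _).
by apply: eq_bigr => i _; rewrite ppow_ge.
Qed.

Lemma sum_ppow_bound n s t : 0 <= s -> 0 < t ->
  0 <= \sum_(k < n) ppow k.+1 (1 - s / t) / k.+1%:R <= n%:R.
Proof.
move=> s0 t0; apply/andP; split; first by apply: sumr_ge0 => i _; rewrite divr_ge0// ppow_ge0.
rewrite -[n in leRHS]card_ord -sum1_card natr_sum; apply: ler_sum => i _.
rewrite ler_pdivrMr// mul1r (le_trans (_ : _ <= 1))// ?ler1n//.
by apply: ppow_le1; rewrite gerBl divr_ge0// ltW.
Qed.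

(** Crude, but linear in [t / s]: the integrability of [f / s] then covers the logarithmic
    singularity, and the moments are O(t) at scale 0. *)
Lemma norm_trunc_log_le n t s : 0 < t -> 0 < s ->
  `|trunc_log n t s| <= n.+1%:R * (t / s).
Proof.
move=> t0 s0; have [ts|st] := leP t s.
  by rewrite trunc_log_ge// normr0 mulr_ge0// divr_ge0// ltW.
have ts1 : 1 <= t / s by rewrite ler_pdivlMr// mul1r ltW.
rewrite trunc_logE// -natr1 mulrDl mul1r [leRHS]addrC.
have /andP[b0 bn] := sum_ppow_bound n (ltW s0) t0.
apply: (le_trans (ler_normB _ _)); rewrite [X in X + _]ger0_norm ?le_max ?lexx ?orbT//.
rewrite [X in _ + X]ger0_norm// lerD//; last by apply: (le_trans bn); rewrite ler_peMr.
rewrite ge_max divr_ge0 ?(ltW t0) ?(ltW s0)// andbT -ln_div ?posrE//.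
by rewrite ltW// ln_sublinear// divr_gt0.
Qed.

(** Taking the positive part is 1-Lipschitz, which cancels [ln t], and both sums lie between 0 and
    [n]. The bound is uniform in [t], as dominated convergence at infinite scale requires. *)
Lemma norm_trunc_log_sub_le n t s s' : 0 < t -> 0 < s -> 0 < s' ->
  `|trunc_log n t s - trunc_log n t s'| <= `|ln s' - ln s| + n%:R.
Proof.
move=> t0 s0 s0'; rewrite !trunc_logE//.
have := sum_ppow_bound n (ltW s0) t0; have := sum_ppow_bound n (ltW s0') t0.
move: (\sum_(_ < _) _) (\sum_(_ < _) _) (ln t) (ln s) (ln s') (n%:R : R).
clear => a b c d e N /andP[a0 aN] /andP[b0 bN].
have : `|Num.max (c - d) 0 - Num.max (c - e) 0| <= `|e - d|.
  rewrite ler_norml; have := ler_norm (e - d); have := ler_norm (- (e - d)); rewrite normrN.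
  by case: (leP (c - d) 0); case: (leP (c - e) 0) => *; apply/andP; split; lra.
move: (Num.max _ _) (Num.max _ _) (`|e - d|) => A B D; rewrite !ler_norml => /andP[? ?].
by apply/andP; split; lra.
Qed.

Lemma cvg_sum_ppow n s :
  \sum_(k < n) ppow k.+1 (1 - s / (m.+1%:R ^+ 2)) / k.+1%:R @[m --> \oo] -->
  \sum_(k < n) ((k.+1%:R)^-1 : R).
Proof.
apply: cvg_big => [|i _]; first exact: add_continuous.
rewrite -[X in _ --> X]mul1r; apply: cvgMl.
rewrite [X in _ --> X](_ : 1 = ppow i.+1 (1 - s * 0)); last first.
  by rewrite mulr0 subr0 ppow_ge// expr1n.
apply: (continuous_cvg _ (@continuous_ppow R i.+1 _)).
by apply: cvgB; [exact: cvg_cst|apply: cvgMr; exact: cvg_sqr_inv].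
Qed.

(** Each term diverges like the logarithm of the scale; this logarithm and the limiting harmonic
    sums cancel in the difference. *)
Lemma cvg_trunc_log_sub n s t : 0 < s -> 0 < t ->
  trunc_log n (m.+1%:R ^+ 2) s - trunc_log n (m.+1%:R ^+ 2) t @[m --> \oo] --> ln t - ln s.
Proof.
move=> s0 t0.
have H r : 0 < r -> \forall m \near \oo, trunc_log n (m.+1%:R ^+ 2) r =
    ln (m.+1%:R ^+ 2) - ln r - \sum_(k < n) ppow k.+1 (1 - r / (m.+1%:R ^+ 2)) / k.+1%:R.
  move=> r0; near=> m.
  have m0 : 0 < m.+1%:R ^+ 2 :> R by rewrite exprn_gt0.
  have rm : r <= m%:R by near: m; exact: nbhs_infty_ger.
  have mm : m%:R <= m.+1%:R ^+ 2 :> R.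
    by rewrite -natrX ler_nat (leq_trans (leqnSn m))// leq_pmulr.
  by rewrite trunc_logE// max_l// subr_ge0 ler_ln ?posrE// (le_trans rm).
rewrite -[X in _ --> X]subr0 -(subrr (\sum_(k < n) ((k.+1%:R)^-1 : R))).
pose A s m : R := \sum_(k < n) ppow k.+1 (1 - s / (m.+1%:R ^+ 2)) / k.+1%:R.
have C : ln t - ln s - (A s m - A t m) @[m --> \oo] -->
    ln t - ln s - (\sum_(k < n) ((k.+1%:R)^-1 : R) - \sum_(k < n) ((k.+1%:R)^-1 : R)).
  by apply: cvgB; [exact: cvg_cst|apply: cvgB; exact: cvg_sum_ppow].
apply: (cvg_trans _ C).
apply: near_eq_cvg; near=> m.
have -> : trunc_log n (m.+1%:R ^+ 2) s = ln (m.+1%:R ^+ 2) - ln s -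
   \sum_(k < n) ppow k.+1 (1 - s / (m.+1%:R ^+ 2)) / k.+1%:R by near: m; exact: H.
have -> : trunc_log n (m.+1%:R ^+ 2) t = ln (m.+1%:R ^+ 2) - ln t -
   \sum_(k < n) ppow k.+1 (1 - t / (m.+1%:R ^+ 2)) / k.+1%:R by near: m; exact: H.
by rewrite /A; ring.
Unshelve. all: end_near. Qed.

Lemma measurable_log_rem n : measurable_fun setT (log_rem n : R -> R).
Proof.
apply: measurable_funB.
  apply: measurableT_comp => //; apply: measurableT_comp; first exact: measurable_ln.
  by apply: measurable_funB.
elim: n => [|n IH].
  by rewrite (_ : (fun _ => _) = cst 0)//; apply/funext => x; rewrite big_ord0.
under eq_fun do rewrite big_ord_recr/=.
by apply: measurable_funD => //; apply: measurable_funM => //; exact: measurable_funX.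
Qed.
End truncated_log.

Section log_potential.
Context {R : realType}.
Implicit Types (x y : R4 R) (f : R4 R -> R) (i j : 'I_4) (k n : nat) (t : R).

Local Notation I := (Rintegral (@leb4 R) setT).
Local Notation intg g := ((@leb4 R).-integrable setT (EFin \o g)).
Local Notation S x := (tmoment (@leb4 R) (sqd x)).
Local Notation MR4 := (measurableTypeR R * measurableTypeR R * measurableTypeR R * measurableTypeR R)%type.

(* The factor [f y / s * s] equals [f y] except at [y = x], where it vanishes
   so that the junk value of the logarithm at [0] plays no role. *)
Definition log_moment f x n t : R :=
  I (fun y => f y / sqd x y * sqd x y * trunc_log n t (sqd x y)).

Lemma measurable_trunc_log n t x :
  measurable_fun setT ((fun y => trunc_log n t (sqd x y)) : MR4 -> R).
Proof.
apply: (measurableT_comp (f := log_rem n)); first exact: measurable_log_rem.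
apply: continuous_measurable_R4 => y.
apply: (@continuous_comp _ _ _ (fun y => 1 - sqd x y / t) (fun w => Num.max w 0)).
  by apply: cvgB; [exact: cvg_cst|apply: cvgMl; exact: continuous_sqd].
by apply: continuous_max => //; exact: cvg_cst.
Qed.

Lemma norm_log_integrand_le f x n t y : 0 < t ->
  `|f y / sqd x y * sqd x y * trunc_log n t (sqd x y)| <= n.+1%:R * t * `|f y / sqd x y|.
Proof.
move=> t0; have [->|s0] := eqVneq (sqd x y) 0.
  by rewrite invr0 !mulr0 mul0r normr0 mulr0.
have sp : 0 < sqd x y by rewrite lt_neqAle eq_sym s0 sqd_ge0.
rewrite -mulrA normrM mulrC ler_wpM2r// normrM gtr0_norm//.
by rewrite mulrC -ler_pdivlMr// -mulrA norm_trunc_log_le.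
Qed.

Lemma integrable_log_integrand f x n t : continuous f -> intg f -> 0 < t ->
  intg (fun y => f y / sqd x y * sqd x y * trunc_log n t (sqd x y)).
Proof.
move=> cf If t0; have Ih := integrable_div_sqd x cf If.
apply: (@integrable_dom _ _ _ (@leb4 R) _ (fun y => n.+1%:R * t * `|f y / sqd x y|)).
- apply: measurable_funM; last exact: measurable_trunc_log.
  by apply: measurable_funM; [exact: integrable_measurable_fun Ih|exact: measurable_sqd].
- by apply: integrable_scale; exact: integrable_normr.
- by move=> y; exact: norm_log_integrand_le.
Qed.

Lemma norm_log_moment_le f x n t : continuous f -> intg f -> 0 < t ->
  `|log_moment f x n t| <= n.+1%:R * t * I (fun y => `|f y / sqd x y|).
Proof.
move=> cf If t0; have Ih := integrable_normr (integrable_div_sqd x cf If).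
rewrite -RintegralZl//; apply: norm_Rintegral_le.
- exact: integrable_log_integrand.
- exact: integrable_scale.
- by move=> y; exact: norm_log_integrand_le.
Qed.

Lemma integrable_div_mul f x : continuous f -> intg f ->
  intg (fun y => f y / sqd x y * sqd x y).
Proof.
move=> cf If; have mh := integrable_measurable_fun (integrable_div_sqd x cf If).
apply: (@integrable_dom _ _ _ (@leb4 R) _ (fun y => `|f y|)).
- by apply: measurable_funM => //; exact: measurable_sqd.
- exact: integrable_normr.
- move=> y; have [->|s0] := eqVneq (sqd x y) 0; first by rewrite mulr0 normr0.
  by rewrite divfK.
Qed.

Lemma is_derive_log_moment f x n t : continuous f -> intg f -> 0 < t ->
  is_derive t 1 (log_moment f x n.+1) (t^-1 ^+ n.+2 * S x f n.+1 t).
Proof.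
move=> cf If t0.
have Ih := integrable_div_mul x cf If.
have Lh := integrable_loc (measurable_sqd x) (sqd_ge0 x) Ih.
pose F t y := f y / sqd x y * sqd x y * trunc_log n.+1 t (sqd x y).
have dF (r : R) y : 0 < r -> is_derive r 1 (F ^~ y)
    (f y / sqd x y * sqd x y * (r^-1 * ppow n.+1 (1 - sqd x y / r))).
  move=> r0; have [s0|s0] := eqVneq (sqd x y) 0.
    rewrite s0 mulr0 mul0r; rewrite (_ : F ^~ y = cst 0); first exact: is_derive_cst.
    by apply/funext => z; rewrite /F s0 mulr0 mul0r.
  apply: is_derive_scal; apply: is_derive_trunc_log => //.
  by rewrite lt_neqAle eq_sym s0 sqd_ge0.
have J (r : R) : `]t / 2, 2 * t[%classic r -> 0 < r.
  by rewrite /= in_itv/= => /andP[+ _]; apply: lt_trans; rewrite divr_gt0.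
have Jt : `]t / 2, 2 * t[%classic t by rewrite /= in_itv/=; apply/andP; split; lra.
have d1F (r : R) y : 0 < r -> partial1of2 F r y =
    f y / sqd x y * sqd x y * (r^-1 * ppow n.+1 (1 - sqd x y / r)).
  by move=> r0; rewrite partial1of2E; have [_ ->] := dF r y r0.
(* On the window [r > t / 2], so [r^-1] is at most [2 / t] and the cut-off at most 1. *)
pose G y := 2 / t * `|f y / sqd x y * sqd x y|.
have G0 y : 0 <= G y by rewrite mulr_ge0// divr_ge0// ltW.
have IG : intg G by apply: integrable_scale; exact: integrable_normr.
have GF r y : `]t / 2, 2 * t[%classic r -> setT y -> `|partial1of2 F r y| <= G y.
  move=> Jr _; have r0 := J r Jr; rewrite d1F// normrM mulrC ler_wpM2r//.
  rewrite ger0_norm ?mulr_ge0 ?ppow_ge0 ?invr_ge0 ?(ltW r0)//.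
  apply: (@le_trans _ _ (r^-1 * 1)).
    rewrite ler_wpM2l ?invr_ge0 ?(ltW r0)// ppow_le1// gerBl.
    by rewrite divr_ge0 ?sqd_ge0// ltW.
  rewrite mulr1 -[leRHS]invf_div lef_pV2 ?posrE ?divr_gt0//.
  by move: Jr; rewrite /= in_itv/= => /andP[/ltW].
have h := cvg_differentiation_under_integral measurableT Jt
  (fun r Jr => integrable_log_integrand x n.+1 cf If (J r Jr))
  (fun r y Jr _ => @ex_derive _ _ _ _ _ _ _ (dF r y (J r Jr))) G0 IG GF.
apply/is_derive_cvgP.
have -> : t^-1 ^+ n.+2 * S x f n.+1 t = I (partial1of2 F t).
  rewrite (_ : partial1of2 F t = fun y => f y / sqd x y * sqd x y *
      (t^-1 * ppow n.+1 (1 - sqd x y / t))); last by apply/funext => y; exact: d1F.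
  rewrite -S_div_mul// exprS -mulrA scaled_tmomentE//.
  have mm : intg (fun y => f y / sqd x y * sqd x y * ppow n.+1 (1 - sqd x y / t)).
    apply: (@integrable_dom _ _ _ (@leb4 R) _ (fun y => `|f y / sqd x y * sqd x y|)).
    - apply: measurable_funM; first exact: integrable_measurable_fun Ih.
      apply: continuous_measurable_R4 => y.
      apply: (@continuous_comp _ _ _ (fun y => 1 - sqd x y / t) (ppow n.+1)).
        by apply: cvgB; [exact: cvg_cst|apply: cvgMl; exact: continuous_sqd].
      exact: continuous_ppow.
    - exact: integrable_normr.
    - move=> y; rewrite [leLHS]normrM ler_piMr// ger0_norm ?ppow_ge0// ppow_le1// gerBl.
      by rewrite divr_ge0 ?sqd_ge0// ltW.
  by rewrite -RintegralZl//; apply: eq_Rintegral => y _; rewrite mulrCA.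
by under eq_fun do rewrite [_ *: 1]mulr1.
Qed.

(** With [f] merely integrable each moment may diverge at infinite scale; in the difference the
    integrands are dominated uniformly in [m]. The factor 2 comes from taking logarithms of squared
    distances. *)
Lemma cvg_log_moment_sub f x n : continuous f -> intg f ->
  log_moment f x n (m.+1%:R ^+ 2) - log_moment f 0 n (m.+1%:R ^+ 2) @[m --> \oo] -->
  2 * I (fun y => ln (enorm4 y / enorm4 (x - y)) * f y).
Proof.
move=> cf If; have mf := integrable_measurable_fun If.
have T0 m : 0 < m.+1%:R ^+ 2 :> R by rewrite exprn_gt0.
(* [ft] is [f] away from [x] and 0 and vanishes at these two points, so the bounds below hold at
   every [y] whatever the default values. *)
pose ft y := f y / (sqd x y * sqd 0 y) * (sqd x y * sqd 0 y).
have ftE y : sqd x y != 0 -> sqd 0 y != 0 -> ft y = f y.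
  by move=> sx s0; rewrite /ft divfK// mulf_neq0.
have Iv z := integrable_div_sqd z cf If.
have mVz z : measurable_fun setT ((fun y => (sqd z y)^-1) : MR4 -> R).
  apply: (measurable_fun_cvg (h := fun n => regV n.+1%:R^-1 z)).
    by move=> k; apply: continuous_measurable_R4; apply: continuous_regV; rewrite invr_gt0.
  by move=> y _; exact: cvg_regV.
have mV : measurable_fun setT ((fun y => f y / (sqd x y * sqd 0 y)) : MR4 -> R).
  under eq_fun do rewrite invfM.
  exact: (measurable_funM mf (measurable_funM (mVz x) (mVz 0))).
have mft : measurable_fun setT (ft : MR4 -> R).
  exact: (measurable_funM mV (measurable_funM (measurable_sqd x) (measurable_sqd 0))).
pose F m y := ft y * (trunc_log n (m.+1%:R ^+ 2) (sqd x y) - trunc_log n (m.+1%:R ^+ 2) (sqd 0 y)).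
pose h y := ft y * (ln (sqd 0 y) - ln (sqd x y)).
have aen : {ae (@leb4 R : {measure set _ -> \bar R}), forall y, sqd x y != 0 /\ sqd 0 y != 0}.
  have := ae_sqd_neq0 (0 : R4 R); have := ae_sqd_neq0 x.
  by apply: filterS2 => y.
have mF m : measurable_fun setT (F m : MR4 -> R).
  apply: (measurable_funM mft).
  by apply: measurable_funB; exact: measurable_trunc_log.
have mh : measurable_fun setT (h : MR4 -> R).
  apply: (measurable_funM mft); apply: measurable_funB;
    by apply: (measurableT_comp (f := @ln R)); [exact: measurable_ln|exact: measurable_sqd].
pose X := sqd 0 x; have X0 : 0 <= X := sqd_ge0 0 x.
(* [ln a <= a] bounds the logarithm, with either sign, by a ratio of [|y|^2] and [|x - y|^2]; each
   ratio is at most 2 plus [2 X] over its denominator, and [n] accounts for the polynomial part. *)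
pose G y := ((4 + n%:R) * `|f y| + 2 * X * `|f y / sqd x y|) + 2 * X * `|f y / sqd 0 y|.
have G0 y : 0 <= G y by rewrite !addr_ge0// !mulr_ge0// addr_ge0.
have IG : intg G.
  apply: integrable_addr; [apply: integrable_addr|];
    by apply: integrable_scale; exact: integrable_normr.
(* The two forms of [|v + w|^2 <= 2 |v|^2 + 2 |w|^2], read with [a = |x - y|^2], [b = |y|^2],
   [c = x.y], [Z = |x|^2]. *)
have aux1 (a b c e Z : R) : a = Z - 2 * c + b -> 2 * e <= 2 * Z + b / 2 -> c <= e ->
  b <= 2 * a + 2 * Z by clear; lra.
have aux2 (a b c e Z : R) : a = Z - 2 * c + b -> 2 * e <= Z + b -> - c <= e ->
  a <= 2 * b + 2 * Z by clear; lra.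
have FG m y : `|F m y| <= G y.
  rewrite /F; have [sx|sx] := eqVneq (sqd x y) 0.
    by rewrite /ft sx !(mul0r, mulr0) normr0.
  have [s0|s0] := eqVneq (sqd 0 y) 0; first by rewrite /ft s0 !(mul0r, mulr0) normr0.
  have sxp : 0 < sqd x y by rewrite lt_neqAle eq_sym sx sqd_ge0.
  have s0p : 0 < sqd 0 y by rewrite lt_neqAle eq_sym s0 sqd_ge0.
  rewrite ftE// normrM.
  apply: (@le_trans _ _ (`|f y| * (4 + 2 * X / sqd x y + 2 * X / sqd 0 y + n%:R))); last first.
    rewrite /G !normrM !normfV (gtr0_norm sxp) (gtr0_norm s0p).
    by rewrite le_eqVlt; apply/orP; left; apply/eqP; ring.
  rewrite ler_wpM2l//; apply: (le_trans (norm_trunc_log_sub_le _ (T0 m) sxp s0p)).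
  rewrite lerD2r.
  have h1 : ln (sqd 0 y) - ln (sqd x y) <= sqd 0 y / sqd x y.
    by rewrite -ln_div ?posrE// ltW// ln_sublinear// divr_gt0.
  have h2 : ln (sqd x y) - ln (sqd 0 y) <= sqd x y / sqd 0 y.
    by rewrite -ln_div ?posrE// ltW// ln_sublinear// divr_gt0.
  have hd := sqd_dot x y; have := dot4_le x y (r := 2) ltac:(lra).
  have := dot4_le x y (r := 1) ltr01; rewrite divr1 mul1r -/X => d1 d2.
  have ha := ler_norm (dot4 x y); have hb := ler_norm (- dot4 x y); rewrite normrN in hb.
  have h3 : sqd 0 y / sqd x y <= 2 + 2 * X / sqd x y.
    have -> : 2 + 2 * X / sqd x y = (2 * sqd x y + 2 * X) / sqd x y by field.
    by rewrite ler_wpM2r ?invr_ge0 ?sqd_ge0//; exact: aux1 hd d2 ha.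
  have h4 : sqd x y / sqd 0 y <= 2 + 2 * X / sqd 0 y.
    have -> : 2 + 2 * X / sqd 0 y = (2 * sqd 0 y + 2 * X) / sqd 0 y by field.
    by rewrite ler_wpM2r ?invr_ge0 ?sqd_ge0//; exact: aux2 hd d1 hb.
  have p1 : 0 <= 2 * X / sqd x y by rewrite divr_ge0 ?mulr_ge0// sqd_ge0.
  have p2 : 0 <= 2 * X / sqd 0 y by rewrite divr_ge0 ?mulr_ge0// sqd_ge0.
  move: h1 h2 h3 h4 p1 p2.
  move: (ln _) (ln _) (sqd 0 y / _) (sqd x y / _) (2 * X / _) (2 * X / _); clear.
  by move=> a b c d e g *; rewrite ler_norml; apply/andP; split; lra.
have Fh y : F m y @[m --> \oo] --> h y.
  rewrite /F /h; have [sx|sx] := eqVneq (sqd x y) 0.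
    rewrite (_ : ft y = 0); last by rewrite /ft sx !(mul0r, mulr0).
    by rewrite mul0r; under eq_fun do rewrite mul0r; exact: cvg_cst.
  have [s0|s0] := eqVneq (sqd 0 y) 0.
    rewrite (_ : ft y = 0); last by rewrite /ft s0 !(mul0r, mulr0).
    by rewrite mul0r; under eq_fun do rewrite mul0r; exact: cvg_cst.
  by apply: cvgMr; apply: cvg_trunc_log_sub; rewrite lt_neqAle eq_sym ?sx ?s0 sqd_ge0.
have [Ih C] := Rintegral_dctW mF IG Fh FG.
have -> : 2 * I (fun y => ln (enorm4 y / enorm4 (x - y)) * f y) = I h.
  have E y : sqd x y != 0 -> sqd 0 y != 0 ->
      2 * (ln (enorm4 y / enorm4 (x - y)) * f y) = h y.
    move=> sx s0; rewrite /h ftE//.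
    have nx : 0 < enorm4 (x - y).
      rewrite lt_neqAle eq_sym sqrtr_ge0 andbT; apply: contra_neq sx => e.
      by rewrite -enorm4_sqr e expr0n.
    have e0 : enorm4 y ^+ 2 = sqd 0 y.
      rewrite -enorm4_sqr; congr (_ ^+ 2); rewrite /enorm4; congr Num.sqrt.
      by apply: eq_bigr => i _; rewrite coord4B coord4_0 sub0r sqrrN.
    have n0 : 0 < enorm4 y.
      rewrite lt_neqAle eq_sym sqrtr_ge0 andbT; apply: contra_neq s0 => e.
      by rewrite -e0 e expr0n.
    rewrite -e0 -enorm4_sqr (lnXn 2 nx) (lnXn 2 n0) (ln_div n0 nx).
    by move: (ln (enorm4 y)) (ln (enorm4 (x - y))) (f y); clear => a b c; ring.
  have mE : measurable_fun setT ((fun y => ln (enorm4 y / enorm4 (x - y)) * f y) : MR4 -> R).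
    have m1 : measurable_fun setT ((fun y => Num.sqrt (sqd 0 y)) : MR4 -> R).
      apply: (measurableT_comp (f := @Num.sqrt R)); last exact: measurable_sqd.
      by apply: continuous_measurable_fun; exact: sqrt_continuous.
    have m2 : measurable_fun setT ((fun y => Num.sqrt (sqd x y)^-1) : MR4 -> R).
      apply: (measurableT_comp (f := @Num.sqrt R)); last exact: mVz.
      by apply: continuous_measurable_fun; exact: sqrt_continuous.
    have m3 : measurable_fun setT ((fun y => ln (enorm4 y / enorm4 (x - y))) : MR4 -> R).
      apply: (measurableT_comp (f := @ln R)); first exact: measurable_ln.
      rewrite (_ : (fun y => _) = (fun y => Num.sqrt (sqd 0 y) * Num.sqrt (sqd x y)^-1)).
        exact: (measurable_funM m1 m2).
      apply/funext => y; rewrite sqrtrV ?sqd_ge0//; congr (_ / _); congr Num.sqrt.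
        by apply: eq_bigr => i _; rewrite coord4_0 sub0r sqrrN.
      by apply: eq_bigr => i _; rewrite coord4B.
    exact: (measurable_funM m3 mf).
  have mh2 := integrable_measurable_fun (integrable_scale 2^-1 Ih).
  have ae2 : {ae (@leb4 R : {measure set _ -> \bar R}), forall y,
      ln (enorm4 y / enorm4 (x - y)) * f y = 2^-1 * h y}.
    by apply: filterS aen => y [sx s0]; rewrite -E// [RHS]mulrA mulVf ?mul1r.
  have e1 := ae_eq_Rintegral mE mh2 ae2.
  have e2 := RintegralZl 2^-1 measurableT Ih.
  by rewrite e1 e2 mulrA divff// mul1r.
have D m : log_moment f x n (m.+1%:R ^+ 2) - log_moment f 0 n (m.+1%:R ^+ 2) = I (F m).
  have Ix := integrable_log_integrand x n cf If (T0 m).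
  have I0 := integrable_log_integrand 0 n cf If (T0 m).
  rewrite /log_moment -RintegralB//.
  apply: (ae_eq_Rintegral (integrable_measurable_fun (integrable_subr Ix I0)) (mF m)).
  by apply: filterS aen => y [sx s0]; rewrite /F ftE// !divfK//; ring.
by rewrite (funext D).
Qed.
End log_potential.

(** * Limit at infinite scale *)

Section quadratic_limit.
Context {R : realType}.
Implicit Types (x y : R4 R) (g q : R4 R -> R) (i j : 'I_4).

(** The coefficients are recovered from finitely many values of [q], so they follow any pointwise
    limit. *)
Definition lin_part q i : R := (q (e4 i) - q (-1 *: e4 i)) / 2.
Definition bil_part q i j : R := (q (e4 i + e4 j) - q (e4 i) - q (e4 j)) / 2.

Lemma sum_delta (F : 'I_4 -> R) i : \sum_(k < 4) F k * (i == k)%:R = F i.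
Proof.
rewrite (bigD1 i)//= eqxx mulr1 big1 ?addr0// => k /negPf.
by rewrite eq_sym => ->; rewrite mulr0.
Qed.

(** [bil_part] returns the symmetrized matrix [(a i j + a j i) / 2], which defines the same
    quadratic form. *)
Lemma quad4_polarize b a x :
  quad4 (lin_part (quad4 b a)) (bil_part (quad4 b a)) x = quad4 b a x.
Proof.
have bil (v w : R4 R) i j : (forall k, coord4 v k = (i == k)%:R) ->
    (forall k, coord4 w k = (j == k)%:R) ->
    \sum_(k < 4) \sum_(l < 4) a k l * coord4 v k * coord4 w l = a i j.
  move=> vi wj; rewrite -[RHS](sum_delta (fun k => a k j)); apply: eq_bigr => k _.
  rewrite -[a k j](sum_delta (fun l => a k l)) mulr_suml; apply: eq_bigr => l _.
  by rewrite vi wj; ring.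
have ce i k := @coord4_e4 R i k.
have qe i : quad4 b a (e4 i) = b i + a i i.
  rewrite /quad4 (bil _ _ i i)//; congr (_ + _).
  by rewrite -[RHS](sum_delta b); apply: eq_bigr => k _; rewrite ce.
have qm i : quad4 b a (-1 *: e4 i) = - b i + a i i.
  rewrite /quad4 -(bil (e4 i) (e4 i) i i)//; congr (_ + _).
    by rewrite -[b i](sum_delta b) -sumrN; apply: eq_bigr => k _; rewrite coord4Z ce; ring.
  by apply: eq_bigr => k _; apply: eq_bigr => l _; rewrite !coord4Z; ring.
have qd i j : quad4 b a (e4 i + e4 j) = b i + b j + (a i i + a j j + (a i j + a j i)).
  rewrite /quad4; congr (_ + _).
    rewrite -[b i](sum_delta b) -[b j](sum_delta b) -big_split; apply: eq_bigr => k _.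
    by rewrite /= coord4D !ce; ring.
  rewrite -(bil (e4 i) (e4 i) i i)// -(bil (e4 j) (e4 j) j j)//.
  rewrite -(bil (e4 i) (e4 j) i j)// -(bil (e4 j) (e4 i) j i)//.
  rewrite -!big_split; apply: eq_bigr => k _; rewrite -!big_split; apply: eq_bigr => l _.
  by rewrite /= !coord4D; ring.
rewrite [LHS]/quad4 [RHS]/quad4; congr (_ + _).
  by apply: eq_bigr => i _; rewrite /lin_part qe qm; congr (_ * _); field.
have -> : \sum_(i < 4) \sum_(j < 4) bil_part (quad4 b a) i j * coord4 x i * coord4 x j =
    2^-1 * (\sum_(i < 4) \sum_(j < 4) a i j * coord4 x i * coord4 x j +
      \sum_(i < 4) \sum_(j < 4) a j i * coord4 x i * coord4 x j).
  rewrite -big_split mulr_sumr; apply: eq_bigr => i _.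
  rewrite -big_split mulr_sumr; apply: eq_bigr => j _.
  by rewrite /= /bil_part qd !qe; field.
have -> : \sum_(i < 4) \sum_(j < 4) a j i * coord4 x i * coord4 x j =
    \sum_(i < 4) \sum_(j < 4) a i j * coord4 x i * coord4 x j.
  rewrite exchange_big; apply: eq_bigr => i _; apply: eq_bigr => j _.
  by rewrite mulrAC.
by field.
Qed.

Lemma quad4_cvg (q : nat -> R4 R -> R) g :
  (forall m, exists b a, forall x, q m x = quad4 b a x) ->
  (forall x, q m x @[m --> \oo] --> g x) ->
  forall x, g x = quad4 (lin_part g) (bil_part g) x.
Proof.
move=> qE qg x.
have E m : q m x = quad4 (lin_part (q m)) (bil_part (q m)) x.
  have [b [a ba]] := qE m; have -> : q m = quad4 b a by apply/funext.
  by rewrite quad4_polarize.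
suff h : q m x @[m --> \oo] --> quad4 (lin_part g) (bil_part g) x.
  exact: (cvg_unique _ (qg x) h).
rewrite (funext E); apply: cvgD.
  apply: cvg_big => [|i _]; first exact: add_continuous.
  by apply: cvgMl; apply: cvgMl; apply: cvgB; exact: qg.
apply: cvg_big => [|i _]; first exact: add_continuous.
apply: cvg_big => [|j _]; first exact: add_continuous.
by do 2 apply: cvgMl; apply: cvgMl; apply: cvgB; [apply: cvgB|]; exact: qg.
Qed.
End quadratic_limit.

(** * The two representation formulas *)

Section representation.
Context {R : realType}.
Implicit Types (x y : R4 R) (u f : R4 R -> R) (t r : R).

Local Notation I := (Rintegral (@leb4 R) setT).
Local Notation intg g := ((@leb4 R).-integrable setT (EFin \o g)).
Local Notation S x := (tmoment (@leb4 R) (sqd x)).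
Local Notation pw k r x y := (ppow k (1 - sqd x y / r ^+ 2)).

Lemma continuous_Lap u : C2 u -> continuous (Lap u).
Proof. by move=> [_ du]; apply: continuous_sum4 => i; have [] := du i. Qed.

(** The coefficients cancel the derivative: the first term yields [S_6[Lap u]], the second [S_5] and
    [S_6] of [Lap u], the third [S_7[f]], which [tmoment_Lap] writes as [28 (6 t S_5 - 8 S_6)]; here
    [672 = 24 . 28]. Only the first term survives at scale 0, with [42 = 6 . 7]. Then
    [42 / 672 = 1 / 16] becomes the [1 / 8] of the theorem through the factor 2 of squared
    distances. *)
Lemma scaled_S_repr u x t : C2 u -> C2 (Lap u) -> intg (Lap (Lap u)) -> 0 < t ->
  t^-1 ^+ 7 * S x u 5 t - 24^-1 * (t^-1 ^+ 7 * S x (Lap u) 6 t)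
    + 672^-1 * log_moment (Lap (Lap u)) x 7 t = pi ^+ 2 / 42 * u x.
Proof.
move=> Cu CLu If; have cf := continuous_Lap CLu.
move: t; pose F t := t^-1 ^+ 7 * S x u 5 t - 24^-1 * (t^-1 ^+ 7 * S x (Lap u) 6 t)
    + 672^-1 * log_moment (Lap (Lap u)) x 7 t.
have LLu := continuous_loc_integrable x CLu.1.
have dF (r : R) : 0 < r -> is_derive r 1 F 0.
  move=> r0; apply: is_derive_eq (is_derive_add
    (is_derive_sub (is_derive_scaled_S_Lap x 3 Cu r0)
      (is_derive_scal 24^-1 (is_derive_scaled_S 7 4 LLu r0)))
    (is_derive_scal 672^-1 (is_derive_log_moment x 6 cf If r0))) _.
  have key (A a b v : R) : A = 4 * 7%:R * (6%:R * r * a - 8%:R * b) ->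
      (4 * 6%:R)^-1 * (v * b) - 24^-1 * (v * (6%:R * r * a - 7%:R * b)) + 672^-1 * (v * A) = 0.
    by clear => ->; field.
  exact: key (tmoment_Lap 4 x r CLu).
apply: (constant_of_derive0 dF).
rewrite -[X in _ --> X]addr0; apply: cvgD.
  rewrite -[X in _ --> X]subr0; apply: cvgB.
    have := @cvg_scaled_S0 R u x 3 Cu.1.
    by rewrite (_ : 6%:R * 7%:R = 42 :> R); last ring.
  rewrite -(mulr0 24^-1); apply: cvgMr.
  have h := @cvg_scaled_S0 R (Lap u) x 4 CLu.1.
  (* One power of [t] is left over: [t^-7 S_6] is [t] times [t^-8 S_6], which has a limit. *)
  rewrite (_ : (fun n : nat => _) = (fun n : nat => harmonic n *
      (n.+1%:R^-1^-1 ^+ 8 * S x (Lap u) 6 n.+1%:R^-1))).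
    rewrite -(mul0r (pi ^+ 2 / (7%:R * 8%:R) * Lap u x)).
    by apply: cvgM; [exact: cvg_harmonic|exact: h].
  apply/funext => n; rewrite /= invrK mulrA; congr (_ * _).
  by rewrite [n.+1%:R ^+ 8]exprS mulrA mulVf ?mul1r// pnatr_eq0.
rewrite -(mulr0 672^-1); apply: cvgMr.
pose M := I (fun y => `|Lap (Lap u) y / sqd x y|).
apply: norm_cvg0; apply: (@squeeze_cvgr _ _ _ _ (cst 0) (fun n => 8 * harmonic n * M)).
- apply: nearW => n; rewrite normr_ge0/=.
  by apply: norm_log_moment_le => //; rewrite invr_gt0.
- exact: cvg_cst.
- rewrite -[X in _ --> X](mul0r M); apply: cvgMl.
  by rewrite -(mulr0 8); apply: cvgMr; exact: cvg_harmonic.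
Qed.

(** Averages of [Lap u] become averages of [u], the quantity controlled by [volume_growth]. *)
Lemma scaled_S_LapE u x r : C2 u -> 0 < r ->
  (r ^+ 2)^-1 ^+ 8 * S x (Lap u) 6 (r ^+ 2) =
  24 * r^-1 ^+ 6 * (5 * I (fun y => u y * pw 4 r x y) - 7 * I (fun y => u y * pw 5 r x y)).
Proof.
move=> Cu r0; have T0 : 0 < r ^+ 2 by rewrite exprn_gt0.
have Lu := continuous_loc_integrable x Cu.1.
rewrite (tmoment_Lap 3 x _ Cu) -(scaled_tmomentE 3 T0 Lu) -(scaled_tmomentE 4 T0 Lu).
move: (S x u 4 _) (S x u 5 _) => a b; by field; rewrite gt_eqF.
Qed.

Lemma scaled_S_uE u x r : C2 u -> 0 < r ->
  (r ^+ 2)^-1 ^+ 7 * S x u 5 (r ^+ 2) -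
   24^-1 * ((r ^+ 2)^-1 ^+ 7 * S x (Lap u) 6 (r ^+ 2)) =
  r^-1 ^+ 4 * (8 * I (fun y => u y * pw 5 r x y) - 5 * I (fun y => u y * pw 4 r x y)).
Proof.
move=> Cu r0; have T0 : 0 < r ^+ 2 by rewrite exprn_gt0.
have Lu := continuous_loc_integrable x Cu.1.
rewrite (tmoment_Lap 3 x _ Cu) -(scaled_tmomentE 3 T0 Lu) -(scaled_tmomentE 4 T0 Lu).
move: (S x u 4 _) (S x u 5 _) => a b; by field; rewrite gt_eqF.
Qed.

Lemma norm_lin_le (c a b p q P Q : R) : 0 <= c -> 0 <= a -> 0 <= b ->
  `|p| <= P -> `|q| <= Q -> `|c * (a * p - b * q)| <= c * (a * P + b * Q).
Proof.
move=> c0 a0 b0 pP qQ; rewrite normrM (ger0_norm c0) ler_wpM2l//.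
by rewrite (le_trans (ler_normB _ _))// !normrM (ger0_norm a0) (ger0_norm b0) lerD// ler_wpM2l.
Qed.

Lemma near_sqd_le x : \forall m \near \oo, sqd 0 x <= m.+1%:R ^+ 2.
Proof.
near=> m; have rm : sqd 0 x <= m%:R by near: m; exact: nbhs_infty_ger.
apply: (le_trans rm); rewrite -natrX ler_nat (leq_trans (leqnSn m))// leq_pmulr//.
Unshelve. all: end_near. Qed.

Lemma cvg_div_nat (K : R) : K / m.+1%:R @[m --> \oo] --> 0.
Proof. by rewrite -(mulr0 K); apply: cvgMr; exact: cvg_harmonic. Qed.

Section with_growth.
Variables (u : R4 R -> R) (C : R).
Hypotheses (Cu : C2 u) (CLu : C2 (Lap u)) (If : intg (Lap (Lap u))).
Hypothesis (gu : volume_growth u C).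

(** At infinite scale [N x] tends to [L x] by the Newtonian identity and [N x - N 0] to 0 by the
    growth bound, so [L x = L 0]; divide by [pi^2 / 56]. *)
Lemma Lap_repr x : Lap u x = Lap u 0 +
  (4 * pi ^+ 2)^-1 * I (fun y => Lap (Lap u) y / sqd 0 y) -
  (4 * pi ^+ 2)^-1 * I (fun y => Lap (Lap u) y / sqd x y).
Proof.
have cf := continuous_Lap CLu.
have T0 m : 0 < m.+1%:R ^+ 2 :> R by rewrite exprn_gt0.
pose N x m := (m.+1%:R ^+ 2)^-1 ^+ 8 * S x (Lap u) 6 (m.+1%:R ^+ 2).
pose L x := pi ^+ 2 / 56 * Lap u x + 224^-1 * I (fun y => Lap (Lap u) y / sqd x y).
have NL z : N z m @[m --> \oo] --> L z.
  rewrite /N; under eq_fun do rewrite scaled_S_Lap_repr//.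
  apply: cvgD; first exact: cvg_cst.
  apply: cvgMr; apply: cvg_scaled_tmoment_infty; exact: integrable_div_sqd.
pose K := 24 * (5 * (2048 * C * (4%:R * (2 * sqd 0 x + 4))) + 7 * (2048 * C * (5%:R * (2 * sqd 0 x + 4)))).
have ND : N x m - N 0 m @[m --> \oo] --> 0.
  apply: norm_cvg0; apply: (@squeeze_cvgr _ _ _ _ (cst 0) (fun m => K / m.+1%:R)).
  - near=> m; rewrite normr_ge0/=.
    have xr : sqd 0 x <= m.+1%:R ^+ 2 by near: m; exact: near_sqd_le.
    move: xr; rewrite /N; set r := m.+1%:R : R => xr.
    have r1 : 1 <= r by rewrite ler1n.
    have r0 : 0 < r by rewrite ltr0n.
    have d4 := @scaled_S_diff R u C 2 r x Cu.1 gu r1 xr.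
    have d5 := @scaled_S_diff R u C 3 r x Cu.1 gu r1 xr.
    rewrite (scaled_S_LapE x Cu r0) (scaled_S_LapE 0 Cu r0).
    have key (a b c d X : R) :
        `|r^-1 ^+ 4 * (a - b)| <= 2048 * C * (4%:R * ((2 * X + 4) / r)) * r ^+ 2 ->
        `|r^-1 ^+ 4 * (c - d)| <= 2048 * C * (5%:R * ((2 * X + 4) / r)) * r ^+ 2 ->
        `|24 * r^-1 ^+ 6 * (5 * a - 7 * c) - 24 * r^-1 ^+ 6 * (5 * b - 7 * d)| <=
         24 * (5 * (2048 * C * (4%:R * (2 * X + 4))) + 7 * (2048 * C * (5%:R * (2 * X + 4)))) / r.
      clear -r0 => d4 d5.
      have c0 : 0 <= 24 * r^-1 ^+ 2 by rewrite mulr_ge0// exprn_ge0// invr_ge0 ltW.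
      have h := norm_lin_le c0 (ler0n _ 5) (ler0n _ 7) d4 d5.
      rewrite [X in `|X|](_ : _ =
        24 * r^-1 ^+ 2 * (5 * (r^-1 ^+ 4 * (a - b)) - 7 * (r^-1 ^+ 4 * (c - d)))); last by field; rewrite gt_eqF.
      apply: (le_trans h); rewrite le_eqVlt; apply/orP; left; apply/eqP.
      by field; rewrite gt_eqF.
    exact: key d4 d5.
  - exact: cvg_cst.
  - exact: cvg_div_nat.
have e : L x - L 0 = 0.
  by apply: (cvg_unique _ _ ND) => //; apply: cvgB; exact: NL.
have p0 : pi != 0 :> R by rewrite gt_eqF// pi_gt0.
have key (A B a b p : R) : p != 0 ->
    p ^+ 2 / 56 * A + 224^-1 * a - (p ^+ 2 / 56 * B + 224^-1 * b) = 0 ->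
    A = B + (4 * p ^+ 2)^-1 * b - (4 * p ^+ 2)^-1 * a.
  clear => p0 /eqP; rewrite subr_eq0 => /eqP e.
  have -> : A = 56 / p ^+ 2 * (p ^+ 2 / 56 * A + 224^-1 * a) - (4 * p ^+ 2)^-1 * a by field.
  by rewrite e; field.
exact: key p0 e.
Unshelve. all: end_near. Qed.

(** The averages [Q] equal [u x - u 0] minus a multiple of the difference of log moments, hence
    converge; they are also O(1/r)-close to polynomials [q m] vanishing at 0, which therefore have
    the same limit. *)
Lemma log_potential_repr : exists b a, forall x, u x =
  (8 * pi ^+ 2)^-1 * I (fun y => ln (enorm4 y / enorm4 (x - y)) * Lap (Lap u) y)
   + (u 0 + quad4 b a x).
Proof.
have cf := continuous_Lap CLu; have p0 : pi != 0 :> R by rewrite gt_eqF// pi_gt0.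
pose J x := I (fun y => ln (enorm4 y / enorm4 (x - y)) * Lap (Lap u) y).
pose W k x m := m.+1%:R^-1 ^+ 4 *
  (I (fun y => u y * pw k m.+1%:R x y) - I (fun y => u y * pw k m.+1%:R 0 y)).
pose Q x m := 42 / pi ^+ 2 * (8 * W 5 x m - 5 * W 4 x m).
pose D k (x : R4 R) := 2048 * C * (k.+4%:R * (k.+3%:R * k.+2%:R) * (2 * sqd 0 x + 4) ^+ 3 +
      k.+4%:R * k.+3%:R / 2 * (3 * sqd 0 x ^+ 2 + 8 * sqd 0 x)).
have QJ x : Q x m @[m --> \oo] --> u x - u 0 - (8 * pi ^+ 2)^-1 * J x.
  pose Lm x m := log_moment (Lap (Lap u)) x 7 (m.+1%:R ^+ 2).
  have E m : Q x m = u x - u 0 - (16 * pi ^+ 2)^-1 * (Lm x m - Lm 0 m).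
    have r0 : 0 < m.+1%:R :> R by rewrite ltr0n.
    have T0 : 0 < m.+1%:R ^+ 2 :> R by rewrite exprn_gt0.
    have ex := scaled_S_repr x Cu CLu If T0; have e0 := scaled_S_repr 0 Cu CLu If T0.
    rewrite (scaled_S_uE x Cu r0) in ex; rewrite (scaled_S_uE 0 Cu r0) in e0.
    have key (w a b a' b' l l' A B p : R) : p != 0 ->
        w * (8 * a - 5 * b) + 672^-1 * l = p ^+ 2 / 42 * A ->
        w * (8 * a' - 5 * b') + 672^-1 * l' = p ^+ 2 / 42 * B ->
        42 / p ^+ 2 * (8 * (w * (a - a')) - 5 * (w * (b - b'))) =
        A - B - (16 * p ^+ 2)^-1 * (l - l').
      clear => p0 eA eB.
      have -> : A = 42 / p ^+ 2 * (p ^+ 2 / 42 * A) by field.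
      have -> : B = 42 / p ^+ 2 * (p ^+ 2 / 42 * B) by field.
      by rewrite -eA -eB; field.
    exact: key p0 ex e0.
  rewrite (funext E); apply: cvgB; first exact: cvg_cst.
  have -> : (8 * pi ^+ 2)^-1 * J x = (16 * pi ^+ 2)^-1 * (2 * J x).
    have key (p j : R) : p != 0 -> (8 * p ^+ 2)^-1 * j = (16 * p ^+ 2)^-1 * (2 * j).
      by move=> p1; field.
    exact: key p0.
  by apply: cvgMr; exact: (@cvg_log_moment_sub R _ x 7 cf If).
have T k m : exists ba : ('I_4 -> R) * ('I_4 -> 'I_4 -> R), forall x, sqd 0 x <= m.+1%:R ^+ 2 ->
    `|W k.+4 x m - quad4 ba.1 ba.2 x| <= D k x / m.+1%:R.
  have m1 : 1 <= m.+1%:R :> R by rewrite ler1n.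
  have [b [a H]] := @scaled_S_taylor R u C k _ Cu.1 gu m1.
  by exists (b, a).
(* One polynomial per scale, valid on the ball of that radius; every fixed [x] is eventually
   covered. *)
have [q5 H5] := choice (T 1); have [q4 H4] := choice (T 0).
pose q m x := 42 / pi ^+ 2 * (8 * quad4 (q5 m).1 (q5 m).2 x - 5 * quad4 (q4 m).1 (q4 m).2 x).
have qE m : exists b a, forall x, q m x = quad4 b a x.
  exists (fun i => 42 / pi ^+ 2 * (8 * (q5 m).1 i - 5 * (q4 m).1 i)).
  exists (fun i j => 42 / pi ^+ 2 * (8 * (q5 m).2 i j - 5 * (q4 m).2 i j)) => x.
  have key (k a b a' b' : R) : k * (8 * (a + b) - 5 * (a' + b')) =
      k * (8 * a - 5 * a') + k * (8 * b - 5 * b') by ring.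
  have key2 (k a b z : R) : k * (8 * (a * z) - 5 * (b * z)) = k * (8 * a - 5 * b) * z by ring.
  rewrite /q /quad4 key; congr (_ + _); rewrite !mulr_sumr -sumrB mulr_sumr; apply: eq_bigr => i _.
    exact: key2.
  rewrite !mulr_sumr -sumrB mulr_sumr; apply: eq_bigr => j _.
  by rewrite -!mulrA key2 -!mulrA.
pose c : R := 42 / pi ^+ 2.
have c0 : 0 <= c by rewrite divr_ge0// sqr_ge0.
have qJ x : q m x @[m --> \oo] --> u x - u 0 - (8 * pi ^+ 2)^-1 * J x.
  have h : Q x m - q m x @[m --> \oo] --> 0.
    apply: norm_cvg0; apply: (@squeeze_cvgr _ _ _ _ (cst 0)
      (fun m => c * (8 * D 1%N x + 5 * D 0%N x) / m.+1%:R)).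
    - near=> m; rewrite normr_ge0/=.
      have xr : sqd 0 x <= m.+1%:R ^+ 2 by near: m; exact: near_sqd_le.
      have h5 := H5 m x xr; have h4 := H4 m x xr.
      have h := norm_lin_le c0 (ler0n _ 8) (ler0n _ 5) h5 h4.
      have -> : Q x m - q m x = c * (8 * (W 5 x m - quad4 (q5 m).1 (q5 m).2 x)
          - 5 * (W 4 x m - quad4 (q4 m).1 (q4 m).2 x)).
        have key (k a b a' b' : R) : k * (8 * a - 5 * b) - k * (8 * a' - 5 * b') =
            k * (8 * (a - a') - 5 * (b - b')) by ring.
        exact: key.
      apply: (le_trans h); rewrite le_eqVlt; apply/orP; left; apply/eqP.
      have key (k a b s : R) : k * (8 * (a / s) + 5 * (b / s)) = k * (8 * a + 5 * b) / s.
        by ring.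
      exact: key.
    - exact: cvg_cst.
    - exact: cvg_div_nat.
  rewrite -[X in _ --> X]subr0.
  rewrite (_ : (fun m => q m x) = (fun m => Q x m - (Q x m - q m x))); last first.
    by apply/funext => m; rewrite opprB addrC subrK.
  by apply: cvgB; [exact: QJ|exact: h].
have G := quad4_cvg qE qJ.
set g := (fun x : R4 R => u x - u 0 - (8 * pi ^+ 2)^-1 * J x) in G.
exists (lin_part g), (bil_part g) => x.
rewrite -(G x); have key (a b d : R) : a = d + (b + (a - b - d)) by ring.
exact: key.
Unshelve. all: end_near. Qed.
End with_growth.
End representation.

(** * Regularity of [Lap u], integrable majorant of [u], and the theorem *)

Section conclusion.
Context {R : realType}.
Implicit Types (x y : R4 R) (u f : R4 R -> R) (i j : 'I_4).

Local Notation intg g := ((@leb4 R).-integrable setT (EFin \o g)).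
Local Notation iterD := Defs.iterD.

Lemma iterD_derivable u s i x : C4 u -> (size s < 4)%N -> derivable (iterD s u) x (e4 i).
Proof. by move=> Cu s4; have [_] := Cu s (ltnW s4); exact. Qed.

Lemma iterD_continuous u s : C4 u -> (size s <= 4)%N -> continuous (iterD s u).
Proof. by move=> Cu s4; have [] := Cu s s4. Qed.

Lemma C4_C2 u : C4 u -> C2 u.
Proof.
move=> Cu; split=> [|i]; first exact: (@iterD_continuous u [::]).
split.
- by move=> y; exact: (@iterD_derivable u [::]).
- exact: (@iterD_continuous u [:: i]).
- by move=> y; exact: (@iterD_derivable u [:: i]).
- exact: (@iterD_continuous u [:: i; i]).
Qed.

Lemma is_derive_iterD_sum u (s : 'I_4 -> seq 'I_4) j x : C4 u -> (forall i, size (s i) < 4)%N ->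
  is_derive x (e4 j) (fun y => \sum_(i < 4) iterD (s i) u y)
    (\sum_(i < 4) iterD (j :: s i) u x).
Proof.
move=> Cu s4; rewrite (_ : (fun y => _) = \sum_(i < 4) iterD (s i) u); last first.
  by apply/funext => y; rewrite fct_sumE.
by apply: is_derive_sum => i; apply: DeriveDef => //; exact: iterD_derivable.
Qed.

(** Derivatives of [Lap u] are sums of iterated derivatives of [u], up to [[:: j; j; i; i]], of
    length exactly 4. *)
Lemma C4_C2_Lap u : C4 u -> C2 (Lap u).
Proof.
move=> Cu; pose s0 i := [:: i; i]; pose s1 j i := j :: s0 i.
have d0 j x : is_derive x (e4 j) (Lap u) (\sum_(i < 4) iterD (s1 j i) u x).
  exact: (@is_derive_iterD_sum u s0).
have d1 j x : is_derive x (e4 j) ('D_(e4 j) (Lap u)) (\sum_(i < 4) iterD (j :: s1 j i) u x).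
  rewrite (_ : 'D_(e4 j) (Lap u) = fun x => \sum_(i < 4) iterD (s1 j i) u x).
    exact: (@is_derive_iterD_sum u (s1 j)).
  by apply/funext => y; have [] := d0 j y.
split=> [|j].
  by apply: continuous_sum4 => i; exact: (@iterD_continuous u (s0 i)).
split.
- by move=> y; have [] := d0 j y.
- rewrite (_ : 'D_(e4 j) (Lap u) = fun x => \sum_(i < 4) iterD (s1 j i) u x).
    by apply: continuous_sum4 => i; exact: (@iterD_continuous u (s1 j i)).
  by apply/funext => y; have [] := d0 j y.
- by move=> y; have [] := d1 j y.
- rewrite (_ : 'D_(e4 j) _ = fun x => \sum_(i < 4) iterD (j :: s1 j i) u x).
    by apply: continuous_sum4 => i; exact: (@iterD_continuous u (j :: s1 j i)).
  by apply/funext => y; have [] := d1 j y.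
Qed.

(* Where [|y|^p >= 2] the right-hand side dominates [exp (4 u) >= u]. *)
Lemma u_dominated u p : 0 < p -> continuous u ->
  intg (fun y => (1 - enorm4 y `^ p) * expR (4 * u y)) ->
  exists G : R4 R -> R, [/\ intg G, forall y, 0 <= G y & forall y, u y <= G y].
Proof.
(* The squared radius from which on [|y| >= 2^(1/p)], that is [|y|^p >= 2]. *)
move=> p0 cu If; pose rho : R := 2 `^ p^-1 ^+ 2.
have far y : rho <= sqd 0 y -> 2 <= enorm4 y `^ p.
  rewrite -enorm4_sqr sub0r => h.
  have e0 z : 0 <= enorm4 z :> R by exact: sqrtr_ge0.
  have eN : enorm4 (- y) = enorm4 y.
    by rewrite /enorm4; congr Num.sqrt; apply: eq_bigr => i _; rewrite -scaleN1r coord4Z mulN1r sqrrN.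
  have : 2 `^ p^-1 <= enorm4 y by rewrite -(ler_pXn2r (ltn0Sn 1)) ?nnegrE ?powR_ge0// -eN.
  move=> h2; have := ge0_ler_powR (ltW p0) (powR_ge0 _ _) (e0 y) h2.
  by rewrite -powRrM mulVf ?gt_eqF// powRr1.
have [A HA] := @trunc_bsupp R 0 (rho + 1).
have [C C0 uC] := continuous_bounded_box4 A cu.
have cT : continuous (fun y => C * trunc 1 0 (rho + 1) y).
  by move=> y; apply: cvgMr; exact: continuous_trunc.
have IT : intg (fun y => C * trunc 1 0 (rho + 1) y).
  by apply: (integrable_continuous_bsupp cT (A := A)) => y yA; rewrite HA ?mulr0.
(* Where [s < rho] the bump is at least 1, and [C] bounds [|u|] on a box containing its support. *)
exists (fun y => `|(1 - enorm4 y `^ p) * expR (4 * u y)| + C * trunc 1 0 (rho + 1) y); split.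
- exact: (integrableD measurableT (integrable_norm If) IT).
- by move=> y; rewrite addr_ge0// mulr_ge0// ppow_ge0.
move=> y; have T0 : 0 <= trunc 1 0 (rho + 1) y by exact: ppow_ge0.
have [h|h] := leP rho (sqd 0 y).
  apply: (@le_trans _ _ `|(1 - enorm4 y `^ p) * expR (4 * u y)|); last by rewrite lerDl mulr_ge0.
  rewrite normrM (ger0_norm (expR_ge0 _)) distrC.
  have E : 1 + 4 * u y <= expR (4 * u y) := expR_ge1Dx _.
  have E0 := expR_gt0 (4 * u y); have f2 := far _ h.
  have n1 : 1 <= `|enorm4 y `^ p - 1| by rewrite ger0_norm; lra.
  have key (a n e : R) : 1 + 4 * a <= e -> 0 < e -> 1 <= n -> a <= n * e.
    by move=> ae e0 n1'; nra.
  exact: key E E0 n1.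
have yA : box4 A y.
  apply: contrapT => yA; have := HA 0 y yA; rewrite /trunc /ppow.
  by rewrite expr1 max_l; lra.
have T1 : 1 <= trunc 1 0 (rho + 1) y by rewrite /trunc /ppow expr1 max_l; lra.
apply: (le_trans (ler_norm _)); apply: (le_trans (uC _ yA)).
by rewrite (le_trans (_ : C <= C * trunc 1 0 (rho + 1) y)) ?lerDr// ler_peMr.
Qed.
End conclusion.

Theorem theorem4p1 (R : realType) (p : R) (u : R4 R -> R) :
  0 < p ->
  C4 u ->
  (forall x, Lap (Lap u) x = (1 - enorm4 x `^ p) * expR (4 * u x)) ->
  leb4.-integrable setT
    (fun y => ((1 - enorm4 y `^ p) * expR (4 * u y))%:E) ->
  let v := fun x : R4 R =>
    (8 * pi ^+ 2)^-1 *
    Rintegral leb4 setT (fun y => ln (enorm4 y / enorm4 (x - y)) *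
                                  ((1 - enorm4 y `^ p) * expR (4 * u y))) in
  (exists P : R4 R -> R, poly_deg_le2 P /\ forall x, u x = v x + P x) /\
  (exists C : R, forall x,
     Lap u x = - (4 * pi ^+ 2)^-1 *
       Rintegral leb4 setT (fun y => (enorm4 (x - y) ^+ 2)^-1 *
                                     ((1 - enorm4 y `^ p) * expR (4 * u y)))
       + C).
Proof.
move=> p0 C4u eq0 If v; have Cu := C4_C2 C4u; have CLu := C4_C2_Lap C4u.
have fE : Lap (Lap u) = fun y => (1 - enorm4 y `^ p) * expR (4 * u y) by apply/funext.
have [G [IG G0 uG]] := u_dominated p0 Cu.1 If.
have IfL : (@leb4 R).-integrable setT (EFin \o Lap (Lap u)) by rewrite fE.
have [C _ gu] := S_abs_growth 0 Cu CLu IfL IG G0 uG; split.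
  have [b [a ba]] := log_potential_repr Cu CLu IfL gu; exists (fun x => u 0 + quad4 b a x); split.
    by exists (u 0), b, a => x; rewrite /quad4 addrA.
  by move=> x; rewrite ba fE.
exists (Lap u 0 + (4 * pi ^+ 2)^-1 * Rintegral leb4 setT (fun y => Lap (Lap u) y / sqd 0 y)) => x.
rewrite (Lap_repr Cu CLu IfL gu x) addrC mulNr; congr (- (_ * Rintegral _ _ _) + _).
by apply/funext => y; rewrite enorm4_sqr fE mulrC.
Qed.
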